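(* Under the hypotheses of the main universality theorem ($W=e^{-Q}\in\mathcal F(C^2)$, $Q$ even, $\lim_{x\to\infty}T(x)=\alpha\in(1,\infty)$; $\xi_k$ independent, mean $0$, variance $1$, $\sup_k\mathbb E|\xi_k|^{2+\varepsilon_0}<\infty$; $\tilde\xi_k$ i.i.d. standard Gaussian), $$\lim_{\varepsilon\to0}\lim_{n\to\infty}\frac{\mathbb E[N_{P_n^*}(\mathbb R\setminus D(\varepsilon))]}{n}=\lim_{\varepsilon\to0}\lim_{n\to\infty}\frac{\mathbb E[N_{\widetilde P_n^*}(\mathbb R\setminus D(\varepsilon))]}{n}=0,$$ where $D(\varepsilon)=[-1+\varepsilon,1-\varepsilon]$ (the inner limits may be replaced by $\limsup$).
   Context: $P_n^*(x)=\sum_{j=0}^n\xi_jp_j(a_nx)$, $\widetilde P_n^*(x)=\sum_{j=0}^n\tilde\xi_jp_j(a_nx)$; $N_P(E)$ is the number of zeros of $P$ in $E$. Weight class $\mathcal F(C^2)$: $W=e^{-Q}$ with $Q:\mathbb R\to[0,\infty)$, $Q'$ continuous, $Q(0)=0$, $Q'$ non-decreasing, $Q''$ exists off $0$, $Q\to\infty$ at $\pm\infty$, $T(t)=tQ'(t)/Q(t)$ quasi-increasing on $(0,\infty)$ and on $(-\infty,0)$ with $T\ge\Lambda>1$, and $Q''/|Q'|\le C_2|Q'|/Q$ off $0$. $p_j$: orthonormal polynomials w.r.t. $W^2dx$. $a_n>0$: $n=\frac2\pi\int_0^1\frac{a_ntQ'(a_nt)}{\sqrt{1-t^2}}dt$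.
   Formalization: The number of zeros of the identically zero polynomial is taken to be 0 (otherwise the expectation is infinite when the coefficients can all vanish with positive probability); zeros are counted with multiplicity and the inner limits are taken as limsup, as the statement allows. *)

(* Defs.v *)
From HB Require Import structures.
From mathcomp Require Import all_boot all_order all_algebra.
From mathcomp Require Import all_classical all_reals all_analysis.
Set Implicit Arguments. Unset Strict Implicit. Unset Printing Implicit Defensive.
Import Order.TTheory GRing.Theory Num.Theory.
Import numFieldNormedType.Exports.
Local Open Scope classical_set_scope.
Local Open Scope ring_scope.

Definition Tfun {R : realType} (Q : R -> R) (t : R) : R := t * (derive1 Q) t / Q t.

(* The class F(C^2) (Levin--Lubinsky), as in the paper's context. *)
Definition weight_class_FC2 {R : realType} (Q : R -> R) : Prop :=
  (forall x, 0 <= Q x) /\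
  (forall x, derivable Q x 1) /\
  continuous (derive1 Q) /\
  Q 0 = 0 /\
  {homo (derive1 Q) : x y / x <= y} /\
  (forall x, x != 0 -> derivable (derive1 Q) x 1) /\
  (Q x @[x --> +oo] --> +oo) /\ (Q x @[x --> -oo] --> +oo) /\
  (exists2 C : R, 0 < C &
     (forall x y, 0 < x -> x <= y -> Tfun Q x <= C * Tfun Q y) /\
     (forall x y, y <= x -> x < 0 -> Tfun Q x <= C * Tfun Q y)) /\
  (exists2 Lam : R, 1 < Lam & forall x, x != 0 -> Lam <= Tfun Q x) /\
  (exists C2 : R, forall x, x != 0 ->
     derive1 (derive1 Q) x / `|(derive1 Q) x| <= C2 * `|(derive1 Q) x| / Q x).

Definition orthonormal_polys {R : realType} (W : R -> R) (p : nat -> {poly R}) : Prop :=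
  forall i j,
    [/\ size (p j) = j.+1, 0 < lead_coef (p j),
        (@lebesgue_measure R).-integrable setT
           (fun x => ((p i).[x] * (p j).[x] * W x ^+ 2)%:E) &
        (\int[@lebesgue_measure R]_(x in setT) ((p i).[x] * (p j).[x] * W x ^+ 2)%:E
           = (i == j)%:R%:E)%E].

(* a_n: the Mhaskar--Rakhmanov--Saff numbers (n >= 1). *)
Definition MRS_numbers {R : realType} (Q : R -> R) (a : nat -> R) : Prop :=
  forall n : nat, (0 < n)%N ->
    0 < a n /\
    (n%:R%:E = (2 / pi)%:E *
       \int[@lebesgue_measure R]_(t in `[0%R, 1%R])
          (a n * t * (derive1 Q) (a n * t) / Num.sqrt (1 - t ^+ 2))%:E)%E.

Definition nzeros {R : realType} (p : {poly R}) (E : set R) : \bar R :=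
  if p == 0 then 0%E else
  ereal_sup [set ((\sum_(x <- s) mup x p)%N%:R)%:E
            | s in [set s : seq R | uniq s /\ (forall x, x \in s -> E x)]].

Definition rand_poly {R : realType} (p : nat -> {poly R}) (a : nat -> R)
  (c : nat -> R) (n : nat) : {poly R} :=
  \sum_(j < n.+1) (c j)%:P * (p j \Po (a n *: 'X)).

Definition mutually_independent {d} {T : measurableType d} {R : realType}
  (P : probability T R) (X : nat -> T -> R) : Prop :=
  forall (I : seq nat) (B : nat -> set R), uniq I ->
    (forall i, measurable (B i)) ->
    P (\big[setI/setT]_(i <- I) (X i @^-1` B i)) =
    (\prod_(i <- I) P (X i @^-1` B i))%E.

Definition Dset {R : realType} (eps : R) : set R := `[-1 + eps, 1 - eps].

Definition exp_zero_ratio {d} {T : measurableType d} {R : realType}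
  (P : probability T R) (xi : nat -> T -> R) (p : nat -> {poly R}) (a : nat -> R)
  (eps : R) (n : nat) : \bar R :=
  ((n%:R)^-1%:E * \int[P]_(w in setT) nzeros (rand_poly p a (fun j => xi j w) n) (~` Dset eps))%E.

(* Main.v *)
Require Import Defs.
From HB Require Import structures.
From mathcomp Require Import all_boot all_order all_algebra.
From mathcomp Require Import complex ring lra zify.
From mathcomp Require Import all_classical all_reals all_analysis measurable_realfun.
Import Order.TTheory GRing.Theory Num.Theory.
Import numFieldNormedType.Exports.
Local Open Scope classical_set_scope.
Local Open Scope ring_scope.

Set Implicit Arguments.
Unset Strict Implicit.
Unset Printing Implicit Defensive.

(**
The core is deterministic: P = P_n^* has O(eps n) complex roots of modulus above 1 - eps as soon
as its coefficients are at most n^2 and one of the last K of them is at least 1/2.  Let X be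
the modulus of the leading coefficient of P times the product over the roots z of the gauge
exp g((z - tau)/s), where g is the Green function of the complement of [-1,1].

Upper bound for X: the mean of ln |P| over Chebyshev nodes of [tau-s,tau+s] dominates
ln X + n ln(s/2) up to lower order terms, for a residue class of nodes which stays away from the
roots.  Since |P| is at most a power of n times e^Q at suitably shifted nodes, this gives
X (s/2)^n <= exp(n (s^alpha/alpha + o(1))).

Lower bound for X: let q be monic of degree n - O(1) with nodes on [-1,1] following the
equilibrium measure, so that q W <= exp(n (-ln 2 - 1/alpha + o(1))).  Dividing P = H q + r,
Bessel's inequality bounds the coefficient of index n - k by the norm of H q W, and H is bounded
by X times a factor theta < 1 for every root whose gauge exceeds 1 + eps/2.

Taking s = 1 - 2 eps and comparing, the exponents cancel up to O(eps^2), which leaves O(eps n)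
roots of large gauge.  The coefficients fail the hypotheses with probability at most
(1 - q)^K + o(1), by independence, and then n bounds the number of roots.
*)

(** * Products over Chebyshev nodes *)

(** The gain beats the cost because (s^alpha - 1)/alpha - ln s vanishes to second order at s = 1.
    Shrinking the test interval to half-length 1 - 2 eps costs only a multiple of eps^2 n in the
    exponent, while every root of modulus above 1 - eps then has gauge at least 1 + eps/2 and gains
    a multiple of eps. No potential is computed by integration. The equilibrium measure of |x|^alpha
    is the mixture of the arcsine laws of [-u^(1/alpha), u^(1/alpha)], u uniform in (0,1), and for
    an arcsine law the discrete counterpart is an explicit product over Chebyshev nodes. The factor
    of |x|^alpha in the resulting potential is identified by averaging over one more arcsine grid,
    and the same average occurs in the definition of a_n. Residue classes of nodes are needed
    because ln |P| is unbounded below near real roots. A window of K coefficients is needed because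
    a single one may be small with a probability that does not tend to 0. *)

Notation normc := ComplexField.Normc.normc.

Lemma normc_le_add (R : realType) (x y : R[i]) : normc (x + y) <= normc x + normc y.
Proof. exact: (@le_normcD R x y). Qed.

Lemma normc_opp (R : realType) (x : R[i]) : normc (- x) = normc x.
Proof. exact: (@normcN R x). Qed.

Lemma normc_ge0 (R : realType) (x : R[i]) : 0 <= normc x.
Proof. by case: x => a b; exact: sqrtr_ge0. Qed.

Lemma normc_sub_le (R : realType) (x y : R[i]) : normc (x - y) <= normc x + normc y.
Proof. by rewrite -(normc_opp y); exact: normc_le_add. Qed.

Lemma normc_distC (R : realType) (x y : R[i]) : normc (x - y) = normc (y - x).
Proof. by rewrite -normc_opp opprB. Qed.

Lemma normc_ge_sub (R : realType) (x y : R[i]) : normc x - normc y <= normc (x - y).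
Proof. by have := normc_le_add (x - y) y; rewrite subrK; lra. Qed.

Lemma normcX (R : realType) (x : R[i]) n : normc (x ^+ n) = normc x ^+ n.
Proof.
elim: n => [|n IH]; first by rewrite !expr0 ComplexField.Normc.normc1.
by rewrite !exprS ComplexField.Normc.normcM IH.
Qed.

Lemma normc_real (R : realType) (x : R) : normc (x%:C)%C = `|x|.
Proof. by rewrite /= expr0n /= addr0 sqrtr_sqr. Qed.

Lemma normc_prod (R : realType) I (s : seq I) (P : pred I) (f : I -> R[i]) :
  normc (\prod_(i <- s | P i) f i) = \prod_(i <- s | P i) normc (f i).
Proof.
elim/big_rec2: _ => [|i x y _ <-]; first by rewrite ComplexField.Normc.normc1.
by rewrite ComplexField.Normc.normcM.
Qed.

Lemma normc_sum (R : realType) I (s : seq I) (P : pred I) (f : I -> R[i]) :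
  normc (\sum_(i <- s | P i) f i) <= \sum_(i <- s | P i) normc (f i).
Proof.
elim/big_rec2: _ => [|i x y _ h]; first by rewrite ComplexField.Normc.normc0.
by apply: le_trans (normc_le_add _ _) _; rewrite lerD2l.
Qed.

Definition rot (R : realType) (t : R) : R[i] := Complex (cos t) (sin t).

Lemma rotD (R : realType) (s t : R) : rot (s + t) = rot s * rot t.
Proof.
rewrite /rot cosD sinD; apply/eqP; rewrite eq_complex /=; apply/andP; split; apply/eqP; ring.
Qed.

Lemma rotX (R : realType) (t : R) n : rot t ^+ n = rot (t * n%:R).
Proof.
elim: n => [|n IH]; first by rewrite expr0 mulr0 /rot cos0 sin0.
by rewrite exprS IH -rotD -natr1 mulrDr mulr1 addrC.
Qed.

Lemma normc_rot (R : realType) (t : R) : normc (rot t) = 1.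
Proof. by rewrite /rot /= cos2Dsin2 sqrtr1. Qed.

Lemma rot_neq0 (R : realType) (t : R) : rot t != 0.
Proof. by apply/eqP => h; have := normc_rot t; rewrite h ComplexField.Normc.normc0; lra. Qed.

Lemma rotV (R : realType) (t : R) : (rot t)^-1 = rot (- t).
Proof.
apply: (mulfI (rot_neq0 t)); rewrite mulfV ?rot_neq0 // -rotD subrr /rot cos0 sin0 //.
Qed.

Lemma rot_add_inv (R : realType) (t : R) : rot t + (rot t)^-1 = (2 * cos t)%:C%C.
Proof.
rewrite rotV /rot cosN sinN; apply/eqP; rewrite eq_complex /=; apply/andP; split; apply/eqP; ring.
Qed.

Definition qnode (R : realType) (M j : nat) : R := cos (2 * pi * j%:R / M%:R).

Lemma rot2pi (R : realType) : rot (2 * pi : R) = 1.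
Proof. by rewrite /rot mulr_natl cos2pi sin2pi. Qed.

Lemma rot_neq1 (R : realType) (t : R) : 0 < t -> t < 2 * pi -> rot t != 1.
Proof.
move=> t0 t1; rewrite /rot eq_complex /= negb_and; apply/orP; left.
have s0 : 0 < sin (t / 2) by apply: sin_gt0_pi; apply/andP; split; lra.
have e : t = t / 2 + t / 2 by field.
rewrite e cosD; have := cos2Dsin2 (t / 2) => h.
by apply/eqP; nra.
Qed.

Lemma rot_root_prim (R : realType) (N : nat) :
  (0 < N)%N -> N.-primitive_root (rot (2 * pi / N%:R : R)).
Proof.
move=> N0.
have N0' : (0 : R) < N%:R by rewrite ltr0n.
have h : rot (2 * pi / N%:R : R) ^+ N = 1.
  by rewrite rotX divfK ?rot2pi // gt_eqF.
have [m pm dm] := prim_order_exists N0 h.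
have e : N = m; last by move: pm; rewrite -e.
have m0 := prim_order_gt0 pm.
apply/eqP; rewrite eqn_leq andbC dvdn_leq //= leqNgt; apply/negP => mN.
have := prim_expr_order pm; rewrite rotX => /eqP; apply/negP; apply: rot_neq1.
  by rewrite mulr_gt0 ?divr_gt0 ?mulr_gt0 ?pi_gt0 ?ltr0n.
rewrite mulrAC ltr_pdivrMr // ltr_pM2l ?ltr_nat // mulr_gt0 // pi_gt0 //.
Qed.

Lemma prod_sub_root (F : fieldType) (z w e : F) N : N.-primitive_root z -> e != 0 ->
  \prod_(k < N) (w - e * z ^+ k) = w ^+ N - e ^+ N.
Proof.
move=> pz e0.
have /(congr1 (fun q => q.[w / e])) := factor_Xn_sub_1 pz.
rewrite horner_prod big_mkord hornerD hornerN hornerXn hornerC.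
under eq_bigr => k _ do rewrite hornerXsubC.
move=> h.
transitivity (\prod_(k < N) (e * (w / e - z ^+ k))).
  by apply: eq_bigr => k _; rewrite mulrBr mulrCA mulfV // mulr1.
rewrite big_split /= prodr_const card_ord.
rewrite h mulrBr mulr1 expr_div_n mulrC divfK // expf_neq0 //.
Qed.

(** Each factor equals (w - u)(w - 1/u)/w with u = e z^k, so the product consists of two
    factorisations of the kind X^N - e^N, one for [z] and one for its inverse. *)
Lemma prod_node (F : fieldType) (z w e : F) N : N.-primitive_root z -> e != 0 -> w != 0 ->
  \prod_(k < N) (w + w^-1 - (e * z ^+ k + (e * z ^+ k)^-1)) =
  (w ^+ N - e ^+ N) * (w ^+ N - e^-1 ^+ N) / w ^+ N.
Proof.
move=> pz e0 w0.
have z0 : z != 0.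
  apply/eqP => z0; have := prim_expr_order pz; rewrite z0 expr0n.
  by have := prim_order_gt0 pz; case: (N) => //= n _ /eqP; rewrite eq_sym oner_eq0.
have pz' : N.-primitive_root z^-1.
  have /andP[N0 /forallP hz] := pz; apply/andP; split=> //; apply/forallP => i.
  by rewrite -(eqP (hz i)) !unity_rootE exprVn invr_eq1.
rewrite -(prod_sub_root w pz e0) -(prod_sub_root w pz' (invr_neq0 e0)).
rewrite -big_split /= -[w ^+ N](_ : \prod_(k < N) w = _); last by rewrite prodr_const card_ord.
rewrite -prodf_div; apply: eq_bigr => k _.
have zk : z ^+ k != 0 by rewrite expf_neq0.
by rewrite exprVn; field; rewrite e0 w0 zk.
Qed.

(* The modulus of the root w, |w| >= 1, of w + 1/w = 2y: the exponential of the Green function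
   of C \ [-1,1] at y. *)
Definition gauge (R : realType) (y : R[i]) : R :=
  Num.max (normc (y + sqrtc (y ^+ 2 - 1))) (normc (y - sqrtc (y ^+ 2 - 1))).

(** The two candidates in [gauge] are inverse to each other, as (y + s)(y - s) = 1; hence the larger
    one has modulus at least 1. *)
Lemma gaugeP (R : realType) (y : R[i]) :
  exists w, [/\ normc w = gauge y, 1 <= normc w & w + w^-1 = y + y].
Proof.
set s := sqrtc (y ^+ 2 - 1).
have h : (y + s) * (y - s) = 1.
  by rewrite mulrC -subr_sqr sqr_sqrtc opprB addrC subrK.
have hn : normc (y + s) * normc (y - s) = 1.
  by rewrite -ComplexField.Normc.normcM h ComplexField.Normc.normc1.
have a0 : y + s != 0 by apply/eqP => e; move: h; rewrite e mul0r => /eqP; rewrite eq_sym oner_eq0.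
have iv : (y + s)^-1 = y - s by apply: (mulfI a0); rewrite mulfV.
have iv' : (y - s)^-1 = y + s by rewrite -iv invrK.
have g1 := normc_ge0 (y + s); have g2 := normc_ge0 (y - s).
rewrite /gauge -/s; case: (leP (normc (y + s)) (normc (y - s))) => hl.
  exists (y - s); split => //; first by nra.
  by rewrite iv'; ring.
exists (y + s); split => //; first by nra.
by rewrite iv; ring.
Qed.

Lemma gauge_ge1 (R : realType) (y : R[i]) : 1 <= gauge y.
Proof. by have [w [<- ]] := gaugeP y. Qed.

Lemma gauge_unique (R : realType) (y w : R[i]) : 1 <= normc w -> w + w^-1 = y + y ->
  gauge y = normc w.
Proof.
move=> w1 e; have [v [<- v1 e']] := gaugeP y.
have w0 : w != 0 by apply/eqP => w0; move: w1; rewrite w0 ComplexField.Normc.normc0; lra.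
have v0 : v != 0 by apply/eqP => v0; move: v1; rewrite v0 ComplexField.Normc.normc0; lra.
have /eqP : (w - v) * (w * v - 1) = 0.
  have : w * v * (w + w^-1 - (v + v^-1)) = 0 by rewrite e e' subrr mulr0.
  move=> <-; field; by rewrite w0 v0.
rewrite mulf_eq0 => /orP[|]; rewrite subr_eq0 => /eqP h; first by rewrite h.
have : normc w * normc v = 1 by rewrite -ComplexField.Normc.normcM h ComplexField.Normc.normc1.
nra.
Qed.

Lemma normc_le_gauge (R : realType) (y : R[i]) : normc y <= gauge y.
Proof.
have [w [<- w1 e]] := gaugeP y.
have h : normc (y + y) <= normc w + normc w.
  rewrite -e; apply: le_trans (normc_le_add _ _) _; rewrite lerD2l ComplexField.Normc.normcV.
  by apply: (le_trans _ w1); rewrite invf_le1 // (lt_le_trans _ w1).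
have : normc (y + y) = 2 * normc y by rewrite -mulr2n normcMn mulr_natl.
lra.
Qed.

Lemma gauge_real_le1 (R : realType) (y : R) : `|y| <= 1 -> gauge (y%:C)%C = 1.
Proof.
move=> y1.
have y2 : y ^+ 2 <= 1 by rewrite -(real_normK (num_real y)); have := normr_ge0 y; nra.
set s := Num.sqrt (1 - y ^+ 2).
have hs : s ^+ 2 = 1 - y ^+ 2 by rewrite sqr_sqrtr //; lra.
pose w : R[i] := Complex y s.
have nw : normc w = 1 by rewrite /w /= hs addrC subrK sqrtr1.
rewrite -nw; apply: gauge_unique; first by rewrite nw.
have w0 : w != 0 by apply/eqP => w0; move: nw; rewrite w0 ComplexField.Normc.normc0; lra.
have -> : w^-1 = Complex y (- s).
  apply: (mulfI w0); rewrite mulfV //; apply/eqP; rewrite eq_complex /=.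
  by apply/andP; split; apply/eqP; move: hs; rewrite ?expr2; lra.
by apply/eqP; rewrite eq_complex /=; apply/andP; split; apply/eqP; ring.
Qed.

Lemma gauge_real_gt1 (R : realType) (y : R) : 1 <= `|y| ->
  gauge (y%:C)%C = `|y| + Num.sqrt (y ^+ 2 - 1).
Proof.
move=> y1; set s := Num.sqrt (y ^+ 2 - 1).
have y2 : 1 <= y ^+ 2 by rewrite -(real_normK (num_real y)); nra.
have s0 : 0 <= s := sqrtr_ge0 _.
have hs : s ^+ 2 = y ^+ 2 - 1 by rewrite sqr_sqrtr //; lra.
wlog y0 : y y1 y2 s s0 hs / 0 <= y.
  case: (leP 0 y) => y0; first by apply.
  have e : gauge (((- y)%:C)%C) = gauge ((y%:C)%C).
    have -> : ((- y)%:C)%C = - (y%:C)%C by apply/eqP; rewrite eq_complex /= oppr0 !eqxx.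
    rewrite /gauge sqrrN maxC; congr Num.max; rewrite -normc_opp; congr (normc _); ring.
  move=> h; rewrite -e (h (- y) _ _ s) ?normrN ?sqrrN //; lra.
rewrite ger0_norm // in y1 *.
have nw : normc (((y + s)%:C)%C) = y + s by rewrite normc_real ger0_norm // addr_ge0.
rewrite -nw; apply: gauge_unique; first by rewrite nw; lra.
have ys : y + s != 0 by rewrite gt_eqF //; lra.
rewrite -fmorphV -rmorphD -rmorphD /=; congr (_%:C)%C.
apply: (mulfI ys); rewrite mulrDr mulfV //; move: hs; rewrite !expr2; nra.
Qed.


Lemma rot_node (R : realType) (N L r k : nat) : (0 < N)%N -> (0 < L)%N ->
  let z := rot (2 * pi / (N * L)%:R : R) in
  (z ^+ r * (z ^+ L) ^+ k + (z ^+ r * (z ^+ L) ^+ k)^-1) =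
   (2 * qnode R (N * L) (r + L * k))%:C%C.
Proof.
move=> N0 L0 z; rewrite -exprM -exprD /z rotX rot_add_inv /qnode.
congr ((2 * cos _)%:C)%C; rewrite mulrAC //.
Qed.

Lemma rot_expN (R : realType) (N L : nat) : (0 < N)%N -> (0 < L)%N ->
  rot (2 * pi / (N * L)%:R : R) ^+ N = rot (2 * pi / L%:R).
Proof.
move=> N0 L0; rewrite rotX natrM; congr rot; field.
by rewrite !pnatr_eq0 -!lt0n N0 L0.
Qed.

Lemma rot_expL (R : realType) (N L : nat) : (0 < N)%N -> (0 < L)%N ->
  rot (2 * pi / (N * L)%:R : R) ^+ L = rot (2 * pi / N%:R).
Proof. by move=> N0 L0; rewrite mulnC rot_expN. Qed.

(** The indices congruent to r modulo L form a copy of the N-point grid rotated by z^r, and the N-th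
    power of this rotation is the L-th root of unity [e]. So the product over the class can only be
    small if w^N is close to [e] or to its inverse. *)
Lemma prod_subgrid (R : realType) (y w : R[i]) (N L r : nat) :
  (0 < N)%N -> (0 < L)%N -> w != 0 -> w + w^-1 = y + y ->
  let e := rot (2 * pi / L%:R : R) ^+ r in
  2 ^+ N * \prod_(k < N) normc (y - (qnode R (N * L) (r + L * k))%:C%C) =
  normc (w ^+ N - e) * normc (w ^+ N - e^-1) / normc w ^+ N.
Proof.
move=> N0 L0 w0 ew e.
set z := rot (2 * pi / (N * L)%:R : R).
have z0 : z != 0 := rot_neq0 _.
have zN : z ^+ N = rot (2 * pi / L%:R) by rewrite rot_expN.
have eE : (z ^+ r) ^+ N = e by rewrite /e -zN -!exprM mulnC.
have := prod_node (rot_root_prim R N0) (expf_neq0 r z0) w0.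
rewrite exprVn eE => /(congr1 (@normc R)).
rewrite !ComplexField.Normc.normcM ComplexField.Normc.normcV normcX => <-.
rewrite normc_prod -[2 ^+ N](_ : \prod_(k < N) 2 = _); last by rewrite prodr_const card_ord.
rewrite -big_split /=; apply: eq_bigr => k _.
rewrite ew -(rot_expL R N0 L0) -/z rot_node //.
set q := qnode _ _ _.
rewrite -[2 in LHS](@ger0_norm _ (2:R)) // -normc_real -ComplexField.Normc.normcM; congr (normc _).
have -> : (2 : R)%:C%C = 1 + 1 by apply/eqP; rewrite eq_complex /= addr0 !eqxx.
have -> : (2 * q)%:C%C = (1 + 1) * q%:C%C :> R[i].
  by apply/eqP; rewrite eq_complex /=; apply/andP; split; apply/eqP; ring.
by ring.
Qed.

Lemma prod_grid_le (R : realType) (y : R[i]) (N : nat) : (0 < N)%N ->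
  \prod_(k < N) normc (y - (qnode R N k)%:C%C) <= 4 * (gauge y / 2) ^+ N.
Proof.
move=> N0; have [w [wg w1 ew]] := gaugeP y.
have w0 : w != 0 by apply/eqP => w0; move: w1; rewrite w0 ComplexField.Normc.normc0; lra.
have := prod_subgrid 0 N0 (ltn0Sn 0) w0 ew.
rewrite /= !expr0 invr1 muln1; under eq_bigr => k _ do rewrite add0n mul1n.
set P := \prod_(k < N) _ => h.
have wN : 1 <= normc w ^+ N by rewrite exprn_ege1.
have h2 : normc (w ^+ N - 1) <= 2 * normc w ^+ N.
  have := normc_sub_le (w ^+ N) 1; rewrite normcX ComplexField.Normc.normc1; lra.
have h0 := normc_ge0 (w ^+ N - 1).
rewrite expr_div_n -wg mulrA ler_pdivlMr ?exprn_gt0 // mulrC h.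
rewrite ler_pdivrMr; last lra.
have : 0 <= (2 * normc w ^+ N - normc (w ^+ N - 1)) * (2 * normc w ^+ N + normc (w ^+ N - 1)).
  by apply: mulr_ge0; lra.
lra.
Qed.

(** With e = z^j, the L powers of e sum to 0, so the sum of 1 - e^i over i < L is L; but each term
    has modulus at most L |1 - e|. *)
Lemma prim_root_sep (R : realType) (L : nat) (z : R[i]) (j : nat) : L.-primitive_root z ->
  normc z = 1 -> z ^+ j != 1 -> L%:R^-1 <= normc (1 - z ^+ j).
Proof.
move=> pz z1 zj; set e := z ^+ j.
have L0 := prim_order_gt0 pz.
have L0' : (0:R) < L%:R by rewrite ltr0n.
have e1 : normc e = 1 by rewrite /e normcX z1 expr1n.
have eL : e ^+ L = 1 by rewrite /e exprAC (prim_expr_order pz) expr1n.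
have s0 : \sum_(i < L) e ^+ i = 0.
  have /eqP := subrX1 e L; rewrite eL subrr eq_sym mulf_eq0 subr_eq0 (negbTE zj) /=.
  by move/eqP.
have hb i : normc (1 - e ^+ i) <= i%:R * normc (1 - e).
  elim: i => [|i IH]; first by rewrite expr0 subrr ComplexField.Normc.normc0 mul0r.
  have -> : 1 - e ^+ i.+1 = (1 - e ^+ i) + e ^+ i * (1 - e) by rewrite exprSr; ring.
  apply: le_trans (normc_le_add _ _) _.
  rewrite ComplexField.Normc.normcM normcX e1 expr1n mul1r -natr1 mulrDl mul1r lerD2r //.
have : (L%:R : R) <= L%:R * (L%:R * normc (1 - e)).
  have e2 : normc (\sum_(i < L) (1 - e ^+ i)) = L%:R.
    rewrite sumrB s0 subr0 sumr_const card_ord -[X in normc X](_ : (L%:R : R)%:C%C = _).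
      by rewrite normc_real ger0_norm // ltW.
    by rewrite rmorph_nat.
  rewrite -{1}e2; apply: le_trans (normc_sum _ _ _) _.
  apply: (@le_trans _ _ (\sum_(i < L) (L%:R * normc (1 - e)))).
    apply: ler_sum => i _.
    by apply: le_trans (hb i) _; rewrite ler_wpM2r ?normc_ge0 // ler_nat ltnW.
  by rewrite sumr_const card_ord -[X in X <= _]mulr_natl.
rewrite -{1}[L%:R]mulr1 ler_pM2l // => h.
by rewrite -div1r ler_pdivrMr // mulrC.
Qed.

Lemma normc_dist_eq (R : realType) (L : nat) (z a : R[i]) (d : R) (i j : nat) : L.-primitive_root z ->
  normc z = 1 -> d <= (2 * L%:R)^-1 -> (i < L)%N -> (j < L)%N ->
  normc (a - z ^+ i) < d -> normc (a - z ^+ j) < d -> i = j.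
Proof.
move=> pz z1 hd.
wlog ij : i j / (i <= j)%N.
  move=> h iL jL hi hj; case: (leqP i j) => ij; first exact: h.
  by apply/esym/h => //; exact: ltnW.
move=> iL jL hi hj.
have L0 := prim_order_gt0 pz.
have L0' : (0:R) < L%:R by rewrite ltr0n.
suff : i == j %[mod L] by rewrite !modn_small // => /eqP.
rewrite -(eq_prim_root_expr pz) eq_sym.
have -> : z ^+ j = z ^+ i * z ^+ (j - i) by rewrite -exprD subnKC.
have z0 : z != 0 by apply/eqP => z0; move: z1; rewrite z0 ComplexField.Normc.normc0; lra.
rewrite -{2}[z ^+ i]mulr1 (inj_eq (mulfI (expf_neq0 i z0))).
apply/negPn/negP => /(prim_root_sep pz z1); apply/negP; rewrite -ltNge.
have -> : normc (1 - z ^+ (j - i)) = normc (z ^+ i - z ^+ j).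
  have -> : z ^+ i - z ^+ j = z ^+ i * (1 - z ^+ (j - i)).
    by rewrite mulrBr mulr1 -exprD subnKC.
  by rewrite ComplexField.Normc.normcM normcX z1 expr1n mul1r.
have -> : z ^+ i - z ^+ j = (a - z ^+ j) - (a - z ^+ i) by ring.
have := normc_sub_le (a - z ^+ j) (a - z ^+ i).
have : (2 * L%:R)^-1 = L%:R^-1 / 2 :> R by field; rewrite gt_eqF.
lra.
Qed.

(* A point at relative distance O(1/L) from the L-th root of unity indexed by r
   spoils the lower bound on the subgrid r; by separation each y spoils at most two. *)
Definition bad_residues (R : realType) (L : nat) (a : R[i]) : {set 'I_L} :=
  let z := rot (2 * pi / L%:R : R) in
  [set r : 'I_L | (normc (a - z ^+ r) < (2 * L%:R)^-1) || (normc (a - z ^- r) < (2 * L%:R)^-1)].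

Lemma card_bad_residues (R : realType) (L : nat) (a : R[i]) : (0 < L)%N ->
  (#|bad_residues L a| <= 2)%N.
Proof.
move=> L0; rewrite /bad_residues /=.
have := rot_root_prim R L0; have := normc_rot (2 * pi / L%:R : R).
move: (rot _) => z z1 pz.
have pz' : L.-primitive_root z^-1.
  have /andP[_ /forallP hz] := pz; apply/andP; split=> //; apply/forallP => i.
  by rewrite -(eqP (hz i)) !unity_rootE exprVn invr_eq1.
have z1' : normc z^-1 = 1 by rewrite ComplexField.Normc.normcV z1 invr1.
have card1 u : L.-primitive_root u -> normc u = 1 ->
    (#|[set r : 'I_L | (normc (a - u ^+ r) < (2 * L%:R)^-1)%R]%SET| <= 1)%N.
  move=> pu u1; rewrite leqNgt; apply/negP => /card_gt1P[i [j [ii jj /eqP]]]; apply.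
  apply: val_inj; rewrite !inE in ii jj.
  by apply: (normc_dist_eq pu u1 (lexx _) _ _ ii jj).
have := leq_add (card1 _ pz z1) (card1 _ pz' z1').
move=> h; apply: (leq_trans _ h); apply: (leq_trans _ (leq_card_setU _ _).1); apply: subset_leq_card.
by apply/fintype.subsetP => r; rewrite !finset.inE exprVn.
Qed.

Lemma subgrid_ge (R : realType) (y w : R[i]) (N L : nat) (r : 'I_L) :
  (0 < N)%N -> (0 < L)%N -> 1 <= normc w -> w + w^-1 = y + y ->
  r \notin bad_residues L (w ^+ N) ->
  (gauge y / 2) ^+ N / (16 * L%:R ^+ 2) <=
    \prod_(k < N) normc (y - (qnode R (N * L) (r + L * k))%:C%C).
Proof.
move=> N0 L0 w1 ew; rewrite inE negb_or -!leNgt => /andP[h1 h2].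
have w0 : w != 0 by apply/eqP => w0; move: w1; rewrite w0 ComplexField.Normc.normc0; lra.
have := prod_subgrid r N0 L0 w0 ew; rewrite /=.
have L1 : (1:R) <= L%:R by rewrite ler1n.
set P := \prod_(k < N) _ => h.
have wN : 1 <= normc w ^+ N by rewrite exprn_ege1.
(* If |w|^N <= 2, the distance 1/(2L) times 4L gives 2; if |w|^N > 2, the distance to the unit
   circle already exceeds half of |w|^N. *)
have key u : normc u = 1 -> (2 * L%:R)^-1 <= normc (w ^+ N - u) ->
   normc w ^+ N <= 4 * L%:R * normc (w ^+ N - u).
  move=> u1 hu; case: (leP (normc w ^+ N) 2) => h3.
    apply: le_trans h3 _; rewrite -ler_pdivrMl; last lra.
    apply: le_trans hu; rewrite le_eqVlt; apply/orP; left; apply/eqP; field.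
    by rewrite gt_eqF //; lra.
  have := normc_ge_sub (w ^+ N) u; rewrite normcX u1.
  have := normc_ge0 (w ^+ N - u); nra.
have k1 := key _ _ h1; have k2 := key _ _ h2.
have nz : normc (rot (2 * pi / L%:R : R) ^+ r) = 1 by rewrite normcX normc_rot expr1n.
have {k1} := k1 nz; have {k2} := k2 _.
rewrite ComplexField.Normc.normcV nz invr1 => /(_ erefl).
set A := normc (_ - _^-1) in h *; set B := normc (_ - _) in h *.
set g := normc w ^+ N in wN h *.
move=> k2 k1.
have L2 : 0 < 16 * L%:R ^+ 2 :> R by nra.
rewrite (gauge_unique w1 ew) expr_div_n -/g ler_pdivrMr // ler_pdivrMr ?exprn_gt0 //.
have -> : P * (16 * L%:R ^+ 2) * 2 ^+ N = (2 ^+ N * P) * (16 * L%:R ^+ 2) by ring.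
rewrite h mulrAC ler_pdivlMr; last lra.
have -> : B * A * (16 * L%:R ^+ 2) = (4 * L%:R * B) * (4 * L%:R * A) by ring.
by apply: ler_pM => //; lra.
Qed.

Lemma good_residues (R : realType) (ys : seq R[i]) (N L : nat) : (0 < N)%N -> (0 < L)%N ->
  exists2 B : {set 'I_L}, (#|B| <= 2 * size ys)%N &
  forall r : 'I_L, r \notin B -> forall y, y \in ys ->
    (gauge y / 2) ^+ N / (16 * L%:R ^+ 2) <=
      \prod_(k < N) normc (y - (qnode R (N * L) (r + L * k))%:C%C).
Proof.
move=> N0 L0; elim: ys => [|y ys [B hB IH]].
  by exists finset.set0 => //; rewrite cards0.
have [w [_ w1 ew]] := gaugeP y.
exists (bad_residues L (w ^+ N) :|: B)%SET.
  apply: leq_trans (leq_card_setU _ _).1 _; rewrite /= mulnS leq_add // card_bad_residues //.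
move=> r; rewrite finset.in_setU negb_or => /andP[r1 r2] x; rewrite inE => /orP[/eqP ->|].
  exact: (subgrid_ge N0 L0 w1 ew r1).
exact: IH.
Qed.

(** * Discrete logarithmic potentials *)

Arguments ComplexField.Normc.normc : simpl never.

Definition hg (R : realType) (y : R) : R := ln (gauge (y%:C)%C).

Lemma hg_ge0 (R : realType) (y : R) : 0 <= hg y.
Proof. exact: ln_ge0 (gauge_ge1 _). Qed.

Lemma gauge_gt0 (R : realType) (y : R[i]) : 0 < gauge y.
Proof. exact: lt_le_trans ltr01 (gauge_ge1 _). Qed.

Lemma expR_hg (R : realType) (y : R) : expR (hg y) = gauge (y%:C)%C.
Proof. by rewrite /hg lnK // posrE gauge_gt0. Qed.

Lemma hg_le1 (R : realType) (y : R) : `|y| <= 1 -> hg y = 0.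
Proof. by move=> h; rewrite /hg gauge_real_le1 // ln1. Qed.

Lemma hg_mono (R : realType) (x y : R) : `|x| <= `|y| -> hg x <= hg y.
Proof.
move=> xy; case: (leP `|x| 1) => x1; first by rewrite hg_le1 ?hg_ge0.
have y1 : 1 <= `|y| by apply: ltW; apply: lt_le_trans xy.
rewrite /hg ler_ln ?posrE ?gauge_gt0 // !gauge_real_gt1 //; last exact: ltW.
have h : x ^+ 2 <= y ^+ 2.
  by rewrite -(real_normK (num_real x)) -(real_normK (num_real y)); have := normr_ge0 x; nra.
apply: lerD => //; apply: ler_wsqrtr; lra.
Qed.

Lemma hg_le_ln (R : realType) (y : R) : 1 <= `|y| -> hg y <= ln (2 * `|y|).
Proof.
move=> y1; rewrite /hg ler_ln ?posrE ?gauge_gt0 //; last by lra.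
rewrite gauge_real_gt1 // mulr_natl mulr2n lerD2l.
rewrite -[leRHS]ger0_norm // -sqrtr_sqr; apply: ler_wsqrtr.
by rewrite (real_normK (num_real y)); lra.
Qed.

(** Discards an additive error that does not grow with N. It lets the size of an auxiliary grid tend
    to infinity inside inequalities between finite sums. *)
Lemma le_of_le_divn (R : realType) (x y z : R) :
  (forall N : nat, (0 < N)%N -> N%:R * x <= N%:R * y + z) -> x <= y.
Proof.
move=> h; rewrite leNgt; apply/negP => xy.
pose N := (Num.truncn (z / (x - y))).+1.
have := h N isT; apply/negP; rewrite -ltNge.
have : z / (x - y) < N%:R := truncnS_gt _.
rewrite ltr_pdivrMr; last lra.
by rewrite mulrBr; lra.
Qed.

Lemma qnode_le1 (R : realType) M j : `|qnode R M j| <= 1.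
Proof. by rewrite ler_norml cos_geN1 cos_le1. Qed.

Lemma ln_prod (R : realType) (I : Type) (s : seq I) (P : pred I) (f : I -> R) :
  (forall i, 0 < f i) ->
  ln (\prod_(i <- s | P i) f i) = \sum_(i <- s | P i) ln (f i).
Proof.
move=> f0; suff : 0 < \prod_(i <- s | P i) f i /\
   ln (\prod_(i <- s | P i) f i) = \sum_(i <- s | P i) ln (f i) by case.
elim/big_rec2: _ => [|i x y _ [y0 ey]]; first by rewrite ln1.
by rewrite lnM ?posrE // ey mulr_gt0.
Qed.

(* Discrete form of the fact that the arcsine measure of [-1,1] has potential at least that
   of [-sig,sig]: the double product over the two grids is bounded in both orders. *)
Lemma sum_hg_le (R : realType) (M : nat) (sig : R) : (0 < M)%N -> 0 < sig -> sig <= 1 ->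
  \sum_(j < M) hg (qnode R M j / sig) <= M%:R * ln sig^-1 + ln 4.
Proof.
move=> M0 s0 s1.
(* M points spoil at most 2M residues, so 2M + 1 classes leave a good one. *)
set L := M.*2.+1; set S := \sum_(j < M) _.
apply: (@le_of_le_divn R _ _ (M%:R * ln (16 * L%:R ^+ 2))) => N N0.
pose y (j : nat) : R[i] := ((qnode R M j / sig)%:C)%C.
have [B hB hgood] := good_residues [seq y j | j <- iota 0 M] N0 (ltn0Sn M.*2).
have [r rB] : exists r : 'I_L, r \notin B.
  apply/existsP; rewrite -negb_forall; apply/negP => /forallP h.
  have : (#|B| = L)%N by rewrite -[RHS]card_ord; apply: eq_card => x; rewrite h.
  by move=> eB; move: hB; rewrite eB size_map size_iota /L mul2n ltnn.
have L1 : (1:R) <= L%:R by rewrite ler1n.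
have L16 : 0 < 16 * L%:R ^+ 2 :> R by nra.
pose v k := qnode R (N * L) (r + L * k).
have lo : \prod_(j < M) ((gauge (y j) / 2) ^+ N / (16 * L%:R ^+ 2)) <=
    \prod_(j < M) \prod_(k < N) normc (y j - ((v k)%:C)%C).
  apply: ler_prod => j _; apply/andP; split.
    by rewrite divr_ge0 ?exprn_ge0 ?divr_ge0 ?(ltW (gauge_gt0 _)) ?ltW.
  apply: hgood => //; apply/mapP; exists (j : nat) => //.
  by rewrite mem_iota /= add0n.
(* Taken over j first, the inner product is a full M-grid evaluated at sig * v k, a point of [-1,1]
   where the gauge is 1; the factor sig^-M comes from the rescaling. *)
have up : \prod_(j < M) \prod_(k < N) normc (y j - ((v k)%:C)%C) <=
    \prod_(k < N) (sig^-1 ^+ M * (4 * 2^-1 ^+ M)).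
  rewrite exchange_big; apply: ler_prod => k _; apply/andP; split.
    by apply: prodr_ge0 => j _; exact: normc_ge0.
  have e (j : 'I_M) : normc (y j - ((v k)%:C)%C) =
      sig^-1 * normc (((sig * v k)%:C)%C - ((qnode R M j)%:C)%C).
    have -> : y j - ((v k)%:C)%C = ((qnode R M j / sig - v k)%:C)%C.
      by apply/eqP; rewrite eq_complex /= subr0 !eqxx.
    have -> : ((sig * v k)%:C)%C - ((qnode R M j)%:C)%C = ((sig * v k - qnode R M j)%:C)%C.
      by apply/eqP; rewrite eq_complex /= subr0 !eqxx.
    rewrite !normc_real -[in RHS](@ger0_norm _ sig^-1) ?invr_ge0 ?ltW // -normrM -normrN.
    by congr (`|_|); field; rewrite gt_eqF.
  rewrite (eq_bigr _ (fun j _ => e j)) big_split /= prodr_const card_ord.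
  rewrite ler_wpM2l ?exprn_ge0 ?invr_ge0 ?(ltW s0) //.
  have := prod_grid_le (((sig * v k)%:C)%C) M0.
  rewrite gauge_real_le1 ?div1r //.
  by rewrite normrM (ger0_norm (ltW s0)); have := qnode_le1 R (N * L) (r + L * k); rewrite -/(v k);
     have := normr_ge0 (v k); nra.
have {lo up} := le_trans lo up.
rewrite -ler_ln ?posrE; first last.
- by apply: prodr_gt0 => k _; rewrite !mulr_gt0 ?invr_gt0 ?exprn_gt0 ?invr_gt0.
- by apply: prodr_gt0 => k _; rewrite divr_gt0 // exprn_gt0 // divr_gt0 ?gauge_gt0.
rewrite !ln_prod => [|j|j]; first last.
- by rewrite divr_gt0 // exprn_gt0 // divr_gt0 ?gauge_gt0.
- by rewrite !mulr_gt0 ?invr_gt0 ?exprn_gt0 ?invr_gt0.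
have e (j : 'I_M) : ln ((gauge (y j) / 2) ^+ N / (16 * L%:R ^+ 2)) =
   N%:R * hg (qnode R M j / sig) - (N%:R * ln 2 + ln (16 * L%:R ^+ 2)).
  rewrite ln_div ?posrE ?exprn_gt0 ?divr_gt0 ?gauge_gt0 // lnXn ?divr_gt0 ?gauge_gt0 //.
  by rewrite ln_div ?posrE ?gauge_gt0 // -/(hg _) -[_ *+ N]mulr_natl; ring.
have e2 : ln (sig^-1 ^+ M * (4 * 2^-1 ^+ M)) = M%:R * ln sig^-1 + (ln 4 - M%:R * ln 2).
  have s2 : 0 < sig^-1 by rewrite invr_gt0.
  have t2 : 0 < 2^-1 :> R by rewrite invr_gt0.
  rewrite lnM ?posrE ?exprn_gt0 // ?mulr_gt0 ?exprn_gt0 // lnXn // -[_ *+ M]mulr_natl.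
  congr (_ + _); rewrite lnM ?posrE ?exprn_gt0 // lnXn // lnV ?posrE //.
  by rewrite mulNrn -[_ *+ M]mulr_natl.
rewrite (eq_bigr _ (fun j _ => e j)) sumrB -mulr_sumr -/S !sumr_const !card_ord e2.
rewrite -[_ *+ M]mulr_natl -[_ *+ N]mulr_natl; lra.
Qed.

(** This is B ln B - B <= ln B!, by induction with ln (1 + 1/b) <= 1/b. With the companion
    [sum_ln_le] it says that -ln u has mean about 1 over the points u = i/B, and hence that -ln
    u^(1/alpha) has mean about 1/alpha: the source of every 1/alpha in the rates. *)
Lemma sum_ln_ge (R : realType) (B : nat) : (0 < B)%N ->
  \sum_(i < B) ln (B%:R / i.+1%:R) <= B%:R :> R.
Proof.
move=> B0.
have e : \sum_(i < B) ln (B%:R / i.+1%:R) = B%:R * ln B%:R - \sum_(i < B) ln (i.+1%:R) :> R.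
  under eq_bigr => i _ do rewrite ln_div ?posrE ?ltr0n //.
  by rewrite sumrB sumr_const card_ord mulr_natl.
suff : B%:R * ln B%:R - B%:R <= \sum_(i < B) ln (i.+1%:R) :> R by rewrite e; lra.
elim: B B0 {e} => [//|[|B] IH _]; first by rewrite big_ord1 ln1; lra.
rewrite big_ord_recr /=; have := IH isT.
set S := \sum_(i < _) _ => h.
set b : R := B.+1%:R in h *.
have b0 : 0 < b by rewrite ltr0n.
have -> : B.+2%:R = b + 1 :> R by rewrite natr1.
have h2 : ln (b + 1) - ln b <= b^-1.
  rewrite -ln_div ?posrE //; last lra.
  have -> : (b + 1) / b = 1 + b^-1 by field; rewrite gt_eqF.
  by apply: le_ln1Dx; rewrite (lt_le_trans (_ : -1 < 0)) ?invr_ge0 ?ltW //; lra.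
have : b * (ln (b + 1) - ln b) <= 1.
  by rewrite -ler_pdivlMl // mulr1.
lra.
Qed.

Lemma sum_ln_le (R : realType) (B : nat) : (0 < B)%N ->
  \sum_(i < B) ln (i.+1%:R / B%:R) <= 1 + ln B%:R - B%:R :> R.
Proof.
move=> B0.
have e : \sum_(i < B) ln (i.+1%:R / B%:R) = \sum_(i < B) ln (i.+1%:R) - B%:R * ln B%:R :> R.
  under eq_bigr => i _ do rewrite ln_div ?posrE ?ltr0n //.
  by rewrite sumrB sumr_const card_ord mulr_natl.
suff : \sum_(i < B) ln (i.+1%:R) <= B%:R * ln B%:R - B%:R + 1 + ln B%:R :> R by rewrite e; lra.
elim: B B0 {e} => [//|[|B] IH _]; first by rewrite big_ord1 ln1; lra.
rewrite big_ord_recr /=; have := IH isT.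
set S := \sum_(i < _) _ => h.
set b : R := B.+1%:R in h *.
have b0 : 0 < b by rewrite ltr0n.
have -> : B.+2%:R = b + 1 :> R by rewrite natr1.
have h2 : ln b - ln (b + 1) <= - (b + 1)^-1.
  rewrite -ln_div ?posrE //; last lra.
  have -> : b / (b + 1) = 1 + - (b + 1)^-1 by field; rewrite gt_eqF //; lra.
  apply: le_ln1Dx; rewrite ltrN2 invf_lt1; lra.
have : 1 <= (b + 1) * (ln (b + 1) - ln b).
  by rewrite -ler_pdivrMl ?mulr1; lra.
lra.
Qed.

(* With s = B t^alpha this is B times the potential at t, normalised to vanish on the inner
   interval, of the mixture of the arcsine laws of [-(i/B)^(1/alpha), (i/B)^(1/alpha)], i <= B. *)
Definition hsum (R : realType) (alpha : R) (B : nat) (s : R) : R :=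
  \sum_(i < B) hg ((s / i.+1%:R) `^ alpha^-1).

Lemma normr_powR (R : realType) (x r : R) : `|x `^ r| = x `^ r.
Proof. by rewrite ger0_norm // powR_ge0. Qed.

Lemma powR_le1 (R : realType) (x r : R) : 0 <= x -> x <= 1 -> 0 <= r -> x `^ r <= 1.
Proof.
move=> x0 x1 r0; have h1 : (1 : R) `^ r = 1 by rewrite powR1.
rewrite -h1.
by apply: ge0_ler_powR => //; rewrite nnegrE.
Qed.

Lemma powR_invl (R : realType) (x r : R) : 0 <= x -> x^-1 `^ r = (x `^ r)^-1.
Proof. by move=> x0; rewrite -(powR_inv1 x0) -powRrM mulN1r powRN. Qed.

Lemma hg_powR_mono (R : realType) (alpha x y : R) : 0 < alpha -> 0 <= x -> x <= y ->
  hg (x `^ alpha^-1) <= hg (y `^ alpha^-1).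
Proof.
move=> a0 x0 xy; apply: hg_mono; rewrite !normr_powR.
apply: ge0_ler_powR; rewrite ?nnegrE ?invr_ge0 //; first exact: ltW.
exact: le_trans xy.
Qed.

Lemma hsum_ge0 (R : realType) (alpha : R) (B : nat) (s : R) : 0 <= hsum alpha B s.
Proof. by apply: sumr_ge0 => i _; exact: hg_ge0. Qed.

(** Summands with index at least k vanish at k, since the argument of [hg] is then at most 1; so B
    disappears from the bound. *)
Lemma hsum_le (R : realType) (alpha s : R) (B k : nat) : 0 < alpha -> 0 <= s -> s <= k%:R ->
  hsum alpha B s <= hsum alpha k k%:R.
Proof.
move=> a0 s0 sk.
apply: (@le_trans _ _ (hsum alpha B k%:R)).
  apply: ler_sum => i _; apply: hg_powR_mono => //; first by rewrite divr_ge0.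
  by rewrite ler_wpM2r // invr_ge0.
rewrite /hsum -!(big_mkord xpredT (fun i => hg ((k%:R / i.+1%:R) `^ alpha^-1))).
case: (leqP B k) => Bk.
  rewrite (@big_cat_nat _ _ _ B 0 k) //= lerDl; apply: sumr_ge0 => i _; exact: hg_ge0.
rewrite (@big_cat_nat _ _ _ k 0 B) ?(ltnW Bk) //= gerDl big_nat.
rewrite big1 // => i /andP[ki _]; apply: hg_le1; rewrite normr_powR.
apply: powR_le1; rewrite ?divr_ge0 ?invr_ge0 ?(ltW a0) //.
by rewrite ler_pdivrMr // mul1r ler_nat leqW.
Qed.

Lemma sum_blocks (R : realType) (f : nat -> R) (k l : nat) :
  \sum_(i < k * l) f i = \sum_(j < k) \sum_(i < l) f (j * l + i)%N.
Proof.
elim: k => [|k IH]; first by rewrite mul0n !big_ord0.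
rewrite big_ord_recr /= -IH -!(big_mkord xpredT f) mulSn addnC.
rewrite (@big_cat_nat _ _ _ (k * l)%N) ?leq_addr //=; congr (_ + _).
by rewrite -{1}[(k * l)%N]add0n big_addn addKn big_mkord; apply: eq_bigr => i _; rewrite addnC.
Qed.

(** A discrete homogeneity: each of the k blocks of l consecutive summands is compared with l copies
    of one summand of the coarser sum. *)
Lemma hsum_ge (R : realType) (alpha s : R) (B k l : nat) : 0 < alpha -> s <= B%:R ->
  (k * l)%:R <= s -> l%:R * hsum alpha k k%:R <= hsum alpha B s.
Proof.
move=> a0 sB ls.
have klB : (k * l <= B)%N by rewrite -(ler_nat R); exact: le_trans sB.
apply: (@le_trans _ _ (\sum_(i < k * l) hg ((s / i.+1%:R) `^ alpha^-1))); last first.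
  rewrite /hsum -!(big_mkord xpredT (fun i => hg ((s / i.+1%:R) `^ alpha^-1))).
  rewrite (@big_cat_nat _ _ _ (k * l)%N 0 B) //= lerDl; apply: sumr_ge0 => i _; exact: hg_ge0.
rewrite (sum_blocks (fun i => hg ((s / i.+1%:R) `^ alpha^-1))) /hsum mulr_sumr.
apply: ler_sum => j _.
rewrite mulr_natl -[X in _ *+ X]card_ord -sumr_const; apply: ler_sum => i _.
apply: hg_powR_mono => //.
rewrite ler_pdivrMr ?ltr0n // mulrAC ler_pdivlMr ?ltr0n //.
apply: (@le_trans _ _ ((k * l)%:R * j.+1%:R)); last by rewrite ler_wpM2r.
rewrite -!natrM ler_nat -mulnA leq_mul2l; apply/orP; right.
by rewrite mulnS mulnC -addnS addnC leq_add2r.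
Qed.

Definition node_mean (R : realType) (M : nat) (f : R -> R) : R :=
  M%:R^-1 * \sum_(j < M) f (qnode R M j).

(** Averaged over the arcsine nodes, the potential with B components is at most about B/alpha, by
    [sum_hg_le] and [sum_ln_ge]. By [hsum_ge] its value at a node x is at least about B |x|^alpha E
    / k. Dividing by B and letting B grow determines the constant without evaluating an integral. *)
Lemma hsum_mean_le (R : realType) (alpha : R) (k M : nat) : 0 < alpha -> (0 < k)%N -> (0 < M)%N ->
  hsum alpha k k%:R * node_mean M (fun x => `|x| `^ alpha) <= k%:R * (alpha^-1 + ln 4 / M%:R).
Proof.
move=> a0 k0 M0; set m := node_mean _ _; set E := hsum alpha k k%:R.
have k0' : (0 : R) < k%:R by rewrite ltr0n.
have M0' : (0 : R) < M%:R by rewrite ltr0n.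
have mE : \sum_(j < M) `|qnode R M j| `^ alpha = M%:R * m by rewrite /m /node_mean mulVKf // gt_eqF.
apply: (@le_of_le_divn R _ _ (k%:R * E)) => B B0.
have B0' : (0 : R) < B%:R by rewrite ltr0n.
have up : \sum_(j < M) hsum alpha B (B%:R * `|qnode R M j| `^ alpha) <=
    M%:R * (B%:R / alpha) + B%:R * ln 4.
  rewrite /hsum exchange_big /=.
  have hi (i : 'I_B) : \sum_(j < M) hg ((B%:R * `|qnode R M j| `^ alpha / i.+1%:R) `^ alpha^-1) <=
     M%:R * (alpha^-1 * ln (B%:R / i.+1%:R)) + ln 4.
    have i0 : (0 : R) < i.+1%:R by rewrite ltr0n.
    pose sig : R := (i.+1%:R / B%:R) `^ alpha^-1.
    have s0 : 0 < sig by rewrite powR_gt0 // divr_gt0.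
    have s1 : sig <= 1.
      apply: powR_le1; rewrite ?divr_ge0 ?invr_ge0 ?(ltW a0) //.
      by rewrite ler_pdivrMr // mul1r ler_nat.
    have -> : alpha^-1 * ln (B%:R / i.+1%:R) = ln sig^-1.
      by rewrite lnV ?posrE // ln_powR -[B%:R / _]invf_div lnV ?posrE ?divr_gt0 // mulrN.
    apply: le_trans (sum_hg_le M0 s0 s1); apply: ler_sum => j _; apply: hg_mono.
    rewrite normr_powR normrM (@ger0_norm _ sig^-1) ?invr_ge0 ?(ltW s0) //.
    rewrite mulrAC powRM ?divr_ge0 ?powR_ge0 // -powRrM mulfV ?gt_eqF // powRr1 //.
    rewrite mulrC ler_wpM2l // le_eqVlt; apply/orP; left; apply/eqP.
    by rewrite /sig -[B%:R / _]invf_div powR_invl ?divr_ge0.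
  apply: le_trans (ler_sum _ (fun i _ => hi i)) _.
  rewrite big_split /= -!mulr_sumr sumr_const card_ord -[X in _ + X]mulr_natl lerD2r.
  rewrite ler_wpM2l // [leRHS]mulrC ler_wpM2l ?invr_ge0 ?(ltW a0) //.
  exact: sum_ln_ge.
have lo : \sum_(j < M) ((B%:R * `|qnode R M j| `^ alpha / k%:R - 1) * E) <=
   \sum_(j < M) hsum alpha B (B%:R * `|qnode R M j| `^ alpha).
  apply: ler_sum => j _; set s := B%:R * _.
  have s0 : 0 <= s by rewrite mulr_ge0 ?powR_ge0.
  pose l := Num.truncn (s / k%:R).
  have h := truncn_itv (divr_ge0 s0 (ltW k0')).
  have {h} /andP[h1 h2] := h.
  apply: (@le_trans _ _ (l%:R * E)).
    by rewrite ler_wpM2r ?hsum_ge0 // lerBlDr natr1 ltW.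
  apply: hsum_ge => //.
    rewrite /s ger_pMr //; apply: powR_le1; rewrite ?(ltW a0) //; exact: qnode_le1.
  by rewrite natrM mulrC -ler_pdivlMr.
have := le_trans lo up; rewrite -mulr_suml sumrB -mulr_suml -mulr_sumr mE sumr_const card_ord.
rewrite -[1 *+ M]mulr_natl mulr1 => h.
have : (M%:R * (B%:R * (E * m))) <= M%:R * (B%:R * (k%:R * (alpha^-1 + ln 4 / M%:R)) + k%:R * E).
  have -> : M%:R * (B%:R * (E * m)) = k%:R * ((B%:R * (M%:R * m) / k%:R - M%:R) * E) + M%:R * k%:R * E.
    by field; rewrite gt_eqF.
  have -> : M%:R * (B%:R * (k%:R * (alpha^-1 + ln 4 / M%:R)) + k%:R * E) =
     k%:R * (M%:R * (B%:R / alpha) + B%:R * ln 4) + M%:R * k%:R * E.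
    by field; rewrite !gt_eqF.
  by rewrite lerD2r ler_wpM2l // ltW.
by rewrite ler_pM2l.
Qed.

(** * Quadrature for the arcsine density *)

Notation mu := lebesgue_measure.

Definition arcden (R : realType) (t : R) : R := (Num.sqrt (1 - t ^+ 2))^-1.

Lemma arcden_ge0 (R : realType) (t : R) : 0 <= arcden t.
Proof. by rewrite invr_ge0 sqrtr_ge0. Qed.

Lemma sqrt_onesub_gt0 (R : realType) (t : R) : -1 < t < 1 -> 0 < Num.sqrt (1 - t ^+ 2).
Proof. by move=> /andP[t0 t1]; rewrite sqrtr_gt0; nra. Qed.

Lemma continuous_arcden (R : realType) (t : R) : -1 < t < 1 -> {for t, continuous (@arcden R)}.
Proof.
move=> ht; apply: continuousV; first by rewrite gt_eqF // sqrt_onesub_gt0.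
apply: continuous_comp; last exact: sqrt_continuous.
by apply: cvgB; [exact: cvg_cst|exact: exprn_continuous].
Qed.

Lemma measurable_arcden (R : realType) : measurable_fun (`](-1), 1[%classic : set R) (@arcden R).
Proof.
apply: open_continuous_measurable_fun; first exact: interval_open.
by move=> t; rewrite inE /= in_itv /= => ht; exact: continuous_arcden.
Qed.

Lemma integral_arcden (R : realType) (a b : R) : 0 <= a -> a < b -> b < 1 ->
  (\int[mu]_(x in `[a, b]) (arcden x)%:E = (asin b - asin a)%:E)%E.
Proof.
move=> a0 ab b1.
rewrite EFinB (@continuous_FTC2 R (@arcden R) asin a b) //.
- apply: continuous_in_subspaceT => x; rewrite inE /= in_itv /= => /andP[x1 x2].
  by apply: continuous_arcden; lra.
- split.
  + move=> x; rewrite in_itv /= => /andP[x1 x2].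
    have h : -1 < x < 1 by lra.
    by have [] := is_derive1_asin h.
  + by apply: cvg_at_right_filter; apply: continuous_asin; lra.
  + by apply: cvg_at_left_filter; apply: continuous_asin; lra.
- move=> x; rewrite in_itv /= => /andP[x1 x2].
  have h : -1 < x < 1 by lra.
  by rewrite derive1E; have [_ ->] := is_derive1_asin h.
Qed.

Lemma integral_arcden_o (R : realType) (a b : R) : 0 <= a -> a < b -> b < 1 ->
  (\int[mu]_(x in `[a, b[) (arcden x)%:E = (asin b - asin a)%:E)%E.
Proof.
move=> a0 ab b1; rewrite -integral_arcden // integral_itv_bndo_bndc //.
apply/measurable_EFinP; apply: measurable_funS (@measurable_arcden R) => //.
move=> x /=; rewrite !in_itv /=; lra.
Qed.

Lemma asin_le (R : realType) (x : R) : 0 <= x -> x < 1 -> asin x <= pi / 2.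
Proof. by move=> x0 x1; apply: asin_lepi2; lra. Qed.

(** The density is singular at 1, so the interval is exhausted by [a, u n[ and the bound passes to
    the limit by monotone convergence. *)
Lemma integral_arcden_1 (R : realType) (a : R) : 0 <= a -> a < 1 ->
  (\int[mu]_(x in `[a, 1%R[) (arcden x)%:E <= (pi / 2 - asin a)%:E)%E.
Proof.
move=> a0 a1.
pose u (n : nat) : R := 1 - (1 - a) / n.+2%:R.
have u1 n : a < u n < 1.
  have h : 0 < n.+2%:R^-1 :> R by rewrite invr_gt0 ltr0n.
  have h1 : n.+2%:R^-1 < 1 :> R by rewrite invf_lt1 ?ltr0n // ltr1n.
  rewrite /u; move: (n.+2%:R^-1) h h1 => i i0 i1.
  have : (1 - a) * i < (1 - a) * 1 by rewrite ltr_pM2l //; lra.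
  have : 0 < (1 - a) * i by rewrite mulr_gt0 //; lra.
  lra.
have e : `[a, 1%R[%classic = \bigcup_n `[a, u n[%classic.
  apply/seteqP; split => x /=; rewrite ?in_itv /=.
    move=> /andP[ax x1].
    have hd : 0 < (1 - x) / (1 - a) by rewrite divr_gt0; lra.
    exists (Num.truncn ((1 - x) / (1 - a))^-1) => //=; rewrite in_itv /= ax /= /u.
    set m := Num.truncn _.
    have h : ((1 - x) / (1 - a))^-1 < m.+2%:R.
      by apply: lt_trans (truncnS_gt _) _; rewrite ltr_nat.
    have m0 : (0 : R) < m.+2%:R by rewrite ltr0n.
    rewrite ltrBrDr -ltrBrDl ltr_pdivrMr // mulrC -ltr_pdivrMr; last lra.
    by move: h; rewrite invf_div.
  by move=> [n _] /=; rewrite in_itv /= => /andP[-> h] /=; have := u1 n; lra.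
rewrite e; apply: (@cvge_le _ \oo _ _ (fun n => (\int[mu]_(x in `[a, u n[) (arcden x)%:E)%E)).
  near=> n; rewrite integral_arcden_o ?lee_fin //; try by have := u1 n; lra.
  by rewrite lerD2r asin_le //; have := u1 n; lra.
apply: ge0_nondecreasing_set_cvg_integral.
- move=> m n mn; apply/subsetPset => x /=; rewrite !in_itv /= => /andP[-> h] /=.
  apply: lt_le_trans h _; rewrite /u lerD2l lerN2 ler_wpM2l //; first lra.
  by rewrite lef_pV2 ?posrE ?ltr0n // ler_nat.
- by move=> i; exact: measurable_itv.
- move=> i; apply/measurable_EFinP; apply: measurable_funS (@measurable_arcden R) => //.
  by move=> x /=; rewrite !in_itv /=; have := u1 i; lra.
- by move=> i x _; rewrite lee_fin arcden_ge0.
Unshelve. all: by end_near. Qed.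

Lemma measurable_arcmul (R : realType) (f : R -> R) (A : set R) : continuous f -> measurable A ->
  A `<=` `](-1), 1[ -> measurable_fun A (fun t => (f t * arcden t)%:E).
Proof.
move=> cf mA hA; apply/measurable_EFinP; apply: measurable_funM.
  by apply: measurable_funTS; apply: continuous_measurable_fun.
exact: measurable_funS (@measurable_arcden R).
Qed.

Lemma in_pihalf (R : realType) (x : R) : 0 <= x -> x <= pi / 2 -> x \in `[- (pi / 2), pi / 2].
Proof. by move=> x0 x1; rewrite in_itv /=; have := pi_gt0 R; lra. Qed.

Lemma sin_lt (R : realType) (x y : R) : 0 <= x -> x < y -> y <= pi / 2 -> sin x < sin y.
Proof. by move=> x0 xy y1; rewrite ltr_sin ?in_pihalf //; lra. Qed.

Lemma sin_le (R : realType) (x y : R) : 0 <= x -> x <= y -> y <= pi / 2 -> sin x <= sin y.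
Proof.
move=> x0; rewrite le_eqVlt => /orP[/eqP -> //|xy] y1; exact/ltW/sin_lt.
Qed.

Lemma arc_le (R : realType) (f : R -> R) (x y c : R) : continuous f ->
  0 <= x -> x < y -> y <= pi / 2 ->
  (forall t, sin x <= t -> t <= sin y -> 0 <= f t <= c) ->
  (\int[mu]_(t in `[sin x, sin y[) (f t * arcden t)%:E <= (c * (y - x))%:E)%E.
Proof.
move=> cf x0 xy y1 hf.
have sx0 : 0 <= sin x by have := sin_le (lexx 0) x0 (ltW (lt_le_trans xy y1)); rewrite sin0.
have sxy := sin_lt x0 xy y1.
have sy1 : sin y <= 1 := sin_le1 _.
have sub : `[sin x, sin y[ `<=` (`](-1), 1[%classic : set R).
  by move=> t /=; rewrite !in_itv /=; lra.
have c0 : 0 <= c by have := hf (sin x) (lexx _) (ltW sxy); lra.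
have mA : measurable_fun `[sin x, sin y[ (@arcden R).
  exact: measurable_funS (@measurable_arcden R).
apply: (@le_trans _ _ (\int[mu]_(t in `[sin x, sin y[) (c%:E * (arcden t)%:E)%E)%E).
  apply: ge0_le_integral => //.
  - move=> t /=; rewrite in_itv /= => /andP[t1 t2]; rewrite lee_fin mulr_ge0 ?arcden_ge0 //.
    by have := hf t t1 (ltW t2); lra.
  - exact: measurable_arcmul.
  - by apply/measurable_EFinP; apply: measurable_funM => //; apply: measurable_cst.
  - move=> t /=; rewrite in_itv /= => /andP[t1 t2]; rewrite lee_fin ler_wpM2r ?arcden_ge0 //.
    by have := hf t t1 (ltW t2); lra.
rewrite ge0_integralZl //; last first.
- by move=> t _; rewrite lee_fin arcden_ge0.
- exact/measurable_EFinP.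
rewrite EFinM lee_wpmul2l ?lee_fin //.
have ax : asin (sin x) = x by rewrite sinK // in_pihalf //; lra.
have [sy|sy] : sin y = 1 \/ sin y < 1 by have := sy1; rewrite le_eqVlt => /orP[/eqP|]; auto.
  have yE : y = pi / 2.
    have hp : asin (sin (pi / 2)) = pi / 2 :> R.
      by apply/sinK/in_pihalf => //; have := pi_gt0 R; lra.
    have hy := sinK (in_pihalf (le_trans x0 (ltW xy)) y1).
    by rewrite -hy sy -hp sin_pihalf.
  rewrite sy yE -[X in (_ <= (_ - X)%:E)%E]ax; apply: integral_arcden_1 => //; lra.
rewrite integral_arcden_o // ax sinK // in_pihalf //; lra.
Qed.

Lemma arc_ge (R : realType) (f : R -> R) (x y c : R) : continuous f ->
  0 <= x -> x < y -> y < pi / 2 -> 0 <= c ->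
  (forall t, sin x <= t -> t <= sin y -> c <= f t) ->
  ((c * (y - x))%:E <= \int[mu]_(t in `[sin x, sin y[) (f t * arcden t)%:E)%E.
Proof.
move=> cf x0 xy y1 c0 hf.
have sx0 : 0 <= sin x by have := sin_le (lexx 0) x0 (ltW (lt_trans xy y1)); rewrite sin0.
have sxy := sin_lt x0 xy (ltW y1).
have sy1 : sin y < 1.
  by rewrite -sin_pihalf; apply: sin_lt => //; lra.
have sub : `[sin x, sin y[ `<=` (`](-1), 1[%classic : set R).
  by move=> t /=; rewrite !in_itv /=; lra.
have mA : measurable_fun `[sin x, sin y[ (@arcden R).
  exact: measurable_funS (@measurable_arcden R).
have -> : (c * (y - x))%:E = (\int[mu]_(t in `[sin x, sin y[) (c%:E * (arcden t)%:E)%E)%E.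
  rewrite ge0_integralZl //; last first.
  - by move=> t _; rewrite lee_fin arcden_ge0.
  - exact/measurable_EFinP.
  by rewrite integral_arcden_o // !sinK ?in_pihalf ?EFinM //; lra.
apply: ge0_le_integral => //.
- by move=> t _; rewrite lee_fin mulr_ge0 ?arcden_ge0.
- by apply/measurable_EFinP; apply: measurable_funM => //; apply: measurable_cst.
- exact: measurable_arcmul.
- move=> t /=; rewrite in_itv /= => /andP[t1 t2]; rewrite lee_fin ler_wpM2r ?arcden_ge0 //.
  exact: hf (ltW t2).
Qed.

Definition qangle (R : realType) (m k : nat) : R := pi / 2 * (k%:R / m%:R).

Lemma qangle_ge0 (R : realType) m k : 0 <= qangle R m k.
Proof. by rewrite mulr_ge0 ?divr_ge0 ?pi_ge0. Qed.

Lemma qangle_lt (R : realType) m j k : (0 < m)%N -> (j < k)%N -> qangle R m j < qangle R m k.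
Proof.
move=> m0 jk; rewrite ltr_pM2l ?divr_gt0 ?pi_gt0 // ltr_pM2r ?invr_gt0 ?ltr0n //.
by rewrite ltr_nat.
Qed.

Lemma qangle_m (R : realType) m : (0 < m)%N -> qangle R m m = pi / 2.
Proof. by move=> m0; rewrite /qangle divff ?mulr1 // gt_eqF // ltr0n. Qed.

Lemma qangle_le (R : realType) m k : (0 < m)%N -> (k <= m)%N -> qangle R m k <= pi / 2.
Proof.
move=> m0; rewrite leq_eqVlt => /orP[/eqP ->|h]; first by rewrite qangle_m.
by rewrite -(qangle_m R m0) ltW // qangle_lt.
Qed.

Lemma qangle_step (R : realType) m k : qangle R m k.+1 - qangle R m k = pi / 2 / m%:R.
Proof. by rewrite /qangle -natr1; ring. Qed.

Lemma setU_itvco (R : realType) (a b c : R) : a <= b -> b <= c ->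
  `[a, c[%classic = `[a, b[%classic `|` `[b, c[%classic.
Proof.
move=> ab bc; apply/seteqP; split => x /=; rewrite !in_itv /=.
  by move=> /andP[h1 h2]; case: (ltP x b) => h; [left|right]; lra.
by move=> [|]; lra.
Qed.

Section arc_sums.
Variables (R : realType) (f : R -> R) (m : nat).
Hypotheses (m0 : (0 < m)%N) (cf : continuous f) (f0 : forall t, 0 <= t -> 0 <= f t)
  (fm : forall s t, 0 <= s -> s <= t -> f s <= f t).

Let s k := sin (qangle R m k).
Let I k := (\int[mu]_(t in `[0%R, s k[) (f t * arcden t)%:E)%E.

Let s_ge0 k : (k <= m)%N -> 0 <= s k.
Proof.
move=> km; have := sin_le (lexx 0) (qangle_ge0 R m k) (qangle_le R m0 km).
by rewrite sin0.
Qed.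

Let s_le k : (k < m)%N -> s k <= s k.+1.
Proof. by move=> km; apply: sin_le; rewrite ?qangle_ge0 ?qangle_le // ltW // qangle_lt. Qed.

Let sub k : `[0, s k[ `<=` (`](-1), 1[%classic : set R).
Proof. by move=> t /=; rewrite !in_itv /=; have : s k <= 1 := sin_le1 _; lra. Qed.

Let I_step k : (k < m)%N ->
  I k.+1 = (I k + \int[mu]_(t in `[s k, s k.+1[) (f t * arcden t)%:E)%E.
Proof.
move=> km; rewrite /I (setU_itvco (s_ge0 (ltnW km)) (s_le km)) ge0_integral_setU //.
- by apply: measurable_arcmul => //; rewrite -setU_itvco ?s_le ?s_ge0 ?(ltnW km) //; exact: sub.
- rewrite -setU_itvco ?s_le ?s_ge0 ?(ltnW km) // => t /=; rewrite in_itv /= => /andP[t0 _].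
  by rewrite lee_fin mulr_ge0 ?f0 ?arcden_ge0.
- by apply/disj_setPS => t /=; rewrite !in_itv /=; lra.
Qed.

Let I0 : I 0 = 0%E.
Proof. by rewrite /I /s /qangle mul0r mulr0 sin0 set_itvco0 integral_set0. Qed.

Lemma arc_sum_le k : (k <= m)%N ->
  (I k <= ((\sum_(i < k) f (s i.+1)) * (pi / 2 / m%:R))%:E)%E.
Proof.
elim: k => [|k IH] km; first by rewrite I0 big_ord0 mul0r.
rewrite I_step // big_ord_recr /= mulrDl EFinD; apply: leeD; first exact: IH (ltnW km).
rewrite -(qangle_step R m k); apply: arc_le; rewrite ?qangle_ge0 ?qangle_lt ?qangle_le //.
move=> t t1 t2; have t0 : 0 <= t by apply: le_trans t1; apply: s_ge0; exact: ltnW.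
by rewrite f0 // fm.
Qed.

(** Left endpoints, against right endpoints in [arc_sum_le]. Stopping before m keeps away from the
    singularity at 1; the omitted arc is part of the error in [quadrature]. *)
Lemma arc_sum_ge k : (k < m)%N ->
  (((\sum_(i < k) f (s i)) * (pi / 2 / m%:R))%:E <= I k)%E.
Proof.
elim: k => [|k IH] km; first by rewrite I0 big_ord0 mul0r.
rewrite I_step ?(ltnW km) // big_ord_recr /= mulrDl EFinD; apply: leeD; first exact: IH (ltnW km).
have sk0 : 0 <= s k by apply: s_ge0; lia.
rewrite -(qangle_step R m k); apply: arc_ge; rewrite ?qangle_ge0 ?qangle_lt ?f0 //.
  by rewrite -(qangle_m R m0) qangle_lt.
by move=> t t1 t2; apply: fm.
Qed.

End arc_sums.

(** The 4m nodes are split by quadrant. Up to sign, two quadrants run through the sines of the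
    angles 1, ..., m and the other two through those of 0, ..., m - 1. *)
Lemma sum_qnode (R : realType) (f : R -> R) (m : nat) : (0 < m)%N ->
  \sum_(j < 4 * m) f `|qnode R (4 * m) j| =
  2 * (\sum_(i < m) f (sin (qangle R m i)) + \sum_(i < m) f (sin (qangle R m i.+1))).
Proof.
move=> m0; have m0' : (0 : R) < m%:R by rewrite ltr0n.
rewrite (sum_blocks (fun j => f `|qnode R (4 * m) j|)).
have e c i : 2 * pi * (c * m + i)%:R / (4 * m)%:R = qangle R m i + c%:R * (pi / 2) :> R.
  by rewrite /qangle natrD !natrM; field; rewrite gt_eqF.
have cE (i : 'I_m) : `|cos (qangle R m i)| = sin (qangle R m (m - i)).
  have -> : qangle R m (m - i) = pi / 2 - qangle R m i.
    by rewrite /qangle natrB ?(ltnW (ltn_ord i)) //; field; rewrite gt_eqF.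
  have -> : pi / 2 - qangle R m i = - (qangle R m i - pi / 2) by ring.
  rewrite sinN sinBpihalf opprK ger0_norm // cos_ge0_pihalf //.
  by have := qangle_ge0 R m i; have := qangle_le R m0 (ltnW (ltn_ord i)); have := pi_ge0 R; lra.
have sE (i : 'I_m) : `|sin (qangle R m i)| = sin (qangle R m i).
  rewrite ger0_norm //; have := sin_le (lexx 0) (qangle_ge0 R m i) (qangle_le R m0 (ltnW (ltn_ord i))).
  by rewrite sin0.
have rE : \sum_(i < m) f (sin (qangle R m (m - i))) = \sum_(i < m) f (sin (qangle R m i.+1)).
  rewrite (reindex_inj rev_ord_inj) /=; apply: eq_bigr => i _.
  by rewrite subKn.
rewrite !big_ord_recl big_ord0 /= /bump /=.
rewrite /qnode.
under eq_bigr => i _ do rewrite e mul0r addr0 cE.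
under [X in _ + (X + _)]eq_bigr => i _ do rewrite e mul1r cosDpihalf normrN sE.
under [X in _ + (_ + (X + _))]eq_bigr => i _ do rewrite e mulr_natl -mulr_natr divfK ?pnatr_eq0 // cosDpi normrN cE.
under [X in _ + (_ + (_ + (X + _)))]eq_bigr => i _.
  rewrite e (_ : 3 * (pi / 2) = pi / 2 + pi :> R); last by field.
  rewrite addrA cosDpi cosDpihalf !normrN sE.
  over.
rewrite rE; ring.
Qed.

(** By [sum_qnode] the node mean is the average of the left and right Riemann sums in the angle. For
    nondecreasing f these bracket x up to a term of size f 1 / m. *)
Lemma quadrature (R : realType) (f : R -> R) (m : nat) (x : R) :
  (0 < m)%N -> continuous f -> (forall t, 0 <= t -> 0 <= f t) ->
  (forall s t, 0 <= s -> s <= t -> f s <= f t) ->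
  (x%:E = (2 / pi)%:E * \int[mu]_(t in `[0%R, 1%R]) (f t / Num.sqrt (1 - t ^+ 2))%:E)%E ->
  `|node_mean (4 * m) (fun t => f `|t|) - x| <= 2 * f 1 / m%:R.
Proof.
move=> m0 cf f0 fm hx; have m0' : (0 : R) < m%:R by rewrite ltr0n.
pose s k := sin (qangle R m k).
have sm : s m = 1 by rewrite /s qangle_m // sin_pihalf.
pose I k := (\int[mu]_(t in `[0%R, s k[) (f t * arcden t)%:E)%E.
have Im : (x%:E = (2 / pi)%:E * I m)%E.
  rewrite hx /I sm -integral_itv_bndo_bndc //.
  by apply: measurable_arcmul => // t /=; rewrite !in_itv /=; lra.
have up := arc_sum_le m0 cf f0 fm (leqnn m).
have lo : (((\sum_(i < m.-1) f (s i)) * (pi / 2 / m%:R))%:E <= I m)%E.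
  apply: (le_trans (arc_sum_ge m0 cf f0 fm (_ : m.-1 < m)%N)); first by rewrite prednK.
  apply: ge0_subset_integral => //.
  - apply: measurable_arcmul => // t /=; rewrite !in_itv /= sm; lra.
  - by move=> t /=; rewrite in_itv /= => /andP[t0 _]; rewrite lee_fin mulr_ge0 ?f0 ?arcden_ge0.
  - move=> t /=; rewrite !in_itv /= => /andP[-> h] /=; apply: lt_le_trans h _.
    by rewrite sin_le ?qangle_ge0 ?qangle_le // ltW // qangle_lt // prednK.
have p0 := pi_gt0 R.
have c0 : (0%:E <= (2 / pi : R)%:E)%E by rewrite lee_fin divr_ge0 // ltW.
have e S : 2 / pi * (S * (pi / 2 / m%:R)) = S / m%:R :> R.
  by rewrite mulrCA; congr (_ * _); rewrite mulrA mulrA divfK ?gt_eqF // mulfV ?mul1r.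
have up1 : x <= (\sum_(i < m) f (s i.+1)) / m%:R.
  rewrite -lee_fin Im; apply: le_trans (lee_wpmul2l c0 up) _.
  by rewrite -EFinM e.
have lo1 : (\sum_(i < m.-1) f (s i)) / m%:R <= x.
  rewrite -lee_fin Im; apply: le_trans (lee_wpmul2l c0 lo).
  by rewrite -EFinM e.
have s_ge k : (k <= m)%N -> 0 <= s k.
  by move=> km; have := sin_le (lexx 0) (qangle_ge0 R m k) (qangle_le R m0 km); rewrite sin0.
have f1 k : (k <= m)%N -> 0 <= f (s k) <= f 1.
  by move=> km; rewrite f0 ?s_ge // fm ?s_ge // sin_le1.
have AB : \sum_(i < m) f (s i) + f 1 = f 0 + \sum_(i < m) f (s i.+1).
  transitivity (\sum_(i < m.+1) f (s i)); first by rewrite big_ord_recr /= sm.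
  rewrite big_ord_recl /=; congr (f _ + _).
  by rewrite /s /qangle mul0r mulr0 sin0.
have B1 : \sum_(i < m) f (s i) = \sum_(i < m.-1) f (s i) + f (s m.-1).
  by rewrite -!(big_mkord xpredT (fun i => f (s i))) -big_nat_recr //= prednK.
have h1 : 0 <= f (s m.-1) <= f 1 by apply: f1; exact: leq_pred.
have h0 : 0 <= f 0 <= f 1 by rewrite f0 // fm.
have -> : node_mean (4 * m) (fun t => f `|t|) =
   (\sum_(i < m) f (s i) + \sum_(i < m) f (s i.+1)) / 2 / m%:R.
  by rewrite /node_mean sum_qnode // natrM; field; rewrite gt_eqF.
move: up1 lo1; rewrite ler_pdivlMr // ler_pdivrMr // => up1 lo1.
move: AB B1 h1 h0 up1 lo1 m0'; move: (\sum_(i < m) f (s i)) (\sum_(i < m) f (s i.+1)) (\sum_(i < m.-1) f (s i)).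
move: (f (s m.-1)) (f 1) (f 0) (m%:R : R) => {hx up lo f1 e s sm I Im s_ge} d e1 e0 n A B C.
move=> AB B1 h1 h0 up1 lo1 n0.
rewrite ler_norml; apply/andP; split; rewrite -(ler_pM2r n0) ?mulNr mulrBl !divfK ?gt_eqF //; lra.
Qed.

(** * Regular variation of the external field *)

Lemma le_of_derive_ge0 (R : realType) (f df : R -> R) (a b : R) : a <= b ->
  (forall x, a <= x -> x <= b -> is_derive x 1 f (df x)) ->
  (forall x, a <= x -> x <= b -> 0 <= df x) -> f a <= f b.
Proof.
move=> ab hd h0.
have [] := @MVT_segment R f df a b ab.
- by move=> x; rewrite in_itv /= => /andP[x1 x2]; apply: hd; exact: ltW.
- apply: derivable_within_continuous => x; rewrite in_itv /= => /andP[x1 x2].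
  by have [] := hd x x1 x2.
move=> c; rewrite in_itv /= => /andP[c1 c2] e; rewrite -subr_ge0 e mulr_ge0 ?h0 //; lra.
Qed.

Lemma onesub_powR_le (R : realType) (t e : R) : 0 < t -> 1 - t `^ e <= e * ln t^-1.
Proof.
move=> t0; have := expR_ge1Dx (e * ln t); rewrite lnV ?posrE // /powR gt_eqF //; lra.
Qed.

Lemma ln_inv_le_powR (R : realType) (t e : R) : 0 < t -> 0 < e -> t `^ e * ln t^-1 <= e^-1.
Proof.
move=> t0 e0; have h := expR_ge1Dx (e * ln t^-1).
have -> : ln t^-1 = e^-1 * (e * ln t^-1) by rewrite mulKf // gt_eqF.
have -> : t `^ e = (expR (e * ln t^-1))^-1.
  by rewrite lnV ?posrE // /powR gt_eqF // -expRN mulrN opprK.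
have E0 := expR_gt0 (e * ln t^-1).
rewrite mulrC ler_pdivrMr // ler_pM2l ?invr_gt0 //; lra.
Qed.

Lemma powR_sub_le (R : realType) (t a e : R) : 0 < t -> 0 < a -> 0 <= e ->
  t `^ a - t `^ (a + e) <= e / a.
Proof.
move=> t0 a0 e0; rewrite powRD ?(gt_eqF t0) ?implybT //.
have h1 := onesub_powR_le e t0; have h2 := ln_inv_le_powR t0 a0.
have h3 := powR_ge0 t a.
have -> : t `^ a - t `^ a * t `^ e = t `^ a * (1 - t `^ e) by ring.
apply: (@le_trans _ _ (t `^ a * (e * ln t^-1))); first by rewrite ler_wpM2l.
by rewrite mulrCA ler_wpM2l.
Qed.

Lemma powR_close (R : realType) (alpha A del : R) : 1 < alpha -> 1 <= A -> 0 < del ->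
  exists2 eta, 0 < eta & eta < alpha - 1 /\
   forall t r s, 0 < t -> t <= A -> alpha - eta <= r -> r <= alpha + eta ->
     alpha - eta <= s -> s <= alpha + eta -> t `^ r - t `^ s <= del.
Proof.
move=> a1 A1 d0.
have A0 : 0 < A by lra.
pose K := 1 + ln A.
have lA : 0 <= ln A by rewrite ln_ge0.
pose e0 := A `^ (2 * alpha) * ln A.
have e00 : 0 <= e0 by rewrite mulr_ge0 ?powR_ge0.
(* The first bound keeps the exponents above 1. The second serves t <= 1, where t^r - t^s <= (s -
   r)/r. The third serves 1 < t <= A, where [e0] bounds t^r ln t. *)
pose eta := Num.min ((alpha - 1) / 2) (Num.min (del / 2) (del / (2 * (e0 + 1)))).
have h1 : eta <= (alpha - 1) / 2 by rewrite /eta ge_min lexx.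
have h2 : eta <= del / 2 by rewrite /eta !ge_min lexx !orbT.
have h3 : eta <= del / (2 * (e0 + 1)) by rewrite /eta !ge_min lexx !orbT.
have eta0 : 0 < eta by rewrite /eta !lt_min !divr_gt0 ?mulr_gt0 //; lra.
move: eta h1 h2 h3 eta0 => eta h1 h2 h3 eta0.
exists eta => //; split; first lra.
move=> t r s t0 tA r1 r2 s1 s2.
case: (leP t 1) => t1.
  case: (leP s r) => sr.
    have : t `^ r <= t `^ s.
      by rewrite /powR gt_eqF // ler_expR; have : ln t <= 0 := ln_le0 t1; nra.
    lra.
  have -> : s = r + (s - r) by ring.
  apply: le_trans (powR_sub_le t0 _ _) _; try lra.
  rewrite ler_pdivrMr; last lra.
  nra.
have t1' : 1 <= t := ltW t1.
have lt0 : 0 <= ln t by rewrite ln_ge0.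
have ltA : ln t <= ln A by rewrite ler_ln ?posrE.
case: (leP r s) => sr.
  have : t `^ r <= t `^ s by rewrite ler_powR.
  lra.
have : t `^ r - t `^ s <= t `^ r * ((r - s) * ln t).
  have -> : s = r + (s - r) by ring.
  rewrite powRD ?(gt_eqF t0) ?implybT //.
  have := onesub_powR_le (s - r) t0; rewrite lnV ?posrE //.
  have := powR_ge0 t r; nra.
move=> h; apply: le_trans h _.
have tr : t `^ r <= A `^ (2 * alpha).
  apply: (@le_trans _ _ (t `^ (2 * alpha))); first by apply: ler_powR => //; lra.
  by apply: ge0_ler_powR; rewrite ?nnegrE; lra.
have : (r - s) * ln t <= (2 * eta) * ln A by apply: ler_pM; lra.
move=> h; apply: (@le_trans _ _ (A `^ (2 * alpha) * ((2 * eta) * ln A))).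
  apply: ler_pM => //; rewrite ?powR_ge0 //; apply: mulr_ge0; lra.
rewrite [X in X <= _](_ : _ = 2 * eta * e0); last by rewrite /e0; ring.
move: h3; rewrite ler_pdivlMr; last lra.
clear -eta0 e00 d0; nra.
Qed.

(** Two growth rates: T tends to [alpha] at infinity, which yields regular variation, and T >= [Lam]
    > 1 away from 0, which yields crude bounds valid at all arguments. *)
Record regular_weight (R : realType) (Q : R -> R) (alpha Lam : R) : Prop := RegularWeight {
  rw_derivable : forall x, derivable Q x 1;
  rw_continuous : continuous (derive1 Q);
  rw_Q0 : Q 0 = 0;
  rw_homo : {homo (derive1 Q) : x y / x <= y};
  rw_ge0 : forall x, 0 <= Q x;
  rw_even : forall x, Q (- x) = Q x;
  rw_Lam : 1 < Lam;
  rw_T_ge : forall x, x != 0 -> Lam <= Tfun Q x;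
  rw_T_cvg : Tfun Q x @[x --> +oo] --> alpha;
  rw_alpha : 1 < alpha }.

Lemma Q_gt0 (R : realType) (Q : R -> R) (alpha Lam : R) (W : regular_weight Q alpha Lam) (x : R) : 0 < x -> 0 < Q x.
Proof.
move=> x0; rewrite lt_neqAle (rw_ge0 W) andbT eq_sym; apply/eqP => e.
have := rw_T_ge W (negbT (gt_eqF x0)); rewrite /Tfun e invr0 mulr0 => h.
by have := rw_Lam W; lra.
Qed.

Lemma TQ (R : realType) (Q : R -> R) (alpha Lam : R) (W : regular_weight Q alpha Lam) (x : R) : 0 < x -> x * derive1 Q x = Tfun Q x * Q x.
Proof. by move=> x0; rewrite /Tfun divfK // gt_eqF // (Q_gt0 W). Qed.

Lemma Q_derive (R : realType) (Q : R -> R) (alpha Lam : R) (W : regular_weight Q alpha Lam) (x : R) : is_derive x 1 Q (derive1 Q x).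
Proof. by rewrite derive1E; exact/derivableP/(rw_derivable W). Qed.

(** T is the derivative of ln Q with respect to ln t. Bounds on T therefore become power bounds on
    Q, through the monotonicity of ln Q - l ln t. *)
Lemma lnQ_derive (R : realType) (Q : R -> R) (alpha Lam : R) (W : regular_weight Q alpha Lam) (l x : R) : 0 < x ->
  is_derive x 1 (fun t => ln (Q t) - l * ln t) ((Tfun Q x - l) / x).
Proof.
move=> x0; have q0 := Q_gt0 W x0.
have h1 := is_derive1_comp (is_derive1_ln q0) (Q_derive W x).
have h2 := is_deriveZ l (is_derive1_ln x0).
have h3 := is_deriveB h1 h2.
have e : (Q x)^-1 * derive1 Q x - l *: x^-1 = (Tfun Q x - l) / x.
  by rewrite /Tfun /GRing.scale /=; field; rewrite !gt_eqF.
by rewrite -e; exact: h3.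
Qed.

Lemma Q_power_ge (R : realType) (Q : R -> R) (alpha Lam : R) (W : regular_weight Q alpha Lam) (l x y : R) : 0 < x -> x <= y ->
  (forall t, x <= t -> t <= y -> l <= Tfun Q t) -> (y / x) `^ l * Q x <= Q y.
Proof.
move=> x0 xy hl.
have y0 : 0 < y := lt_le_trans x0 xy.
have := @le_of_derive_ge0 R (fun t => ln (Q t) - l * ln t) (fun x => (Tfun Q x - l) / x) x y xy.
have := Q_gt0 W x0; have := Q_gt0 W y0 => qy qx h.
have {h} : ln (Q x) - l * ln x <= ln (Q y) - l * ln y.
  apply: h => t t1 t2; first by apply: (lnQ_derive W); lra.
  by rewrite divr_ge0 ?subr_ge0 ?hl //; lra.
move=> h; rewrite -ler_ln ?posrE ?mulr_gt0 ?powR_gt0 ?divr_gt0 //.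
by rewrite lnM ?posrE ?powR_gt0 ?divr_gt0 // ln_powR ln_div ?posrE //; lra.
Qed.

Lemma Q_power_le (R : realType) (Q : R -> R) (alpha Lam : R) (W : regular_weight Q alpha Lam) (u x y : R) : 0 < x -> x <= y ->
  (forall t, x <= t -> t <= y -> Tfun Q t <= u) -> Q y <= (y / x) `^ u * Q x.
Proof.
move=> x0 xy hl.
have y0 : 0 < y := lt_le_trans x0 xy.
have := @le_of_derive_ge0 R (fun t => - (ln (Q t) - u * ln t)) (fun x => - ((Tfun Q x - u) / x)) x y xy.
have := Q_gt0 W x0; have := Q_gt0 W y0 => qy qx h.
have {h} : - (ln (Q x) - u * ln x) <= - (ln (Q y) - u * ln y).
  apply: h => t t1 t2; first by apply: is_deriveN; apply: (lnQ_derive W); lra.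
  by rewrite -mulNr divr_ge0 ?opprB ?subr_ge0 ?hl //; lra.
move=> h; rewrite -ler_ln ?posrE ?mulr_gt0 ?powR_gt0 ?divr_gt0 //.
by rewrite lnM ?posrE ?powR_gt0 ?divr_gt0 // ln_powR ln_div ?posrE //; lra.
Qed.

Lemma Q'_ge0 (R : realType) (Q : R -> R) (alpha Lam : R) (W : regular_weight Q alpha Lam) (t : R) : 0 <= t -> 0 <= derive1 Q t.
Proof.
move=> t0; suff h s : 0 < s -> 0 <= derive1 Q s.
  move: t0; rewrite le_eqVlt => /orP[/eqP <-|]; last exact: h.
  rewrite leNgt; apply/negP => neg.
  have /(_ (0 : R)) /cvgr_dist_lt /(_ (- derive1 Q 0)) := rw_continuous W.
  rewrite oppr_gt0 => /(_ neg) /nbhs_ballP[e /= e0 he].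
  have := he (e / 2) _; rewrite /ball /= sub0r normrN ger0_norm; last lra.
  have e2 : 0 < e / 2 by lra.
  have hh := h _ e2; have e3 : e / 2 < e by lra.
  move=> /(_ e3).
  by rewrite ltr_norml => /andP[h1 h2]; lra.
move=> s0; have := TQ W s0; have := rw_T_ge W (negbT (gt_eqF s0)) => h1 h2.
have : 0 <= s * derive1 Q s by rewrite h2 mulr_ge0 ?(rw_ge0 W) //; have := rw_Lam W; lra.
by rewrite pmulr_rge0.
Qed.

Lemma Q_le (R : realType) (Q : R -> R) (alpha Lam : R) (W : regular_weight Q alpha Lam) (x y : R) : 0 <= x -> x <= y -> Q x <= Q y.
Proof.
move=> x0 xy; apply: (le_of_derive_ge0 xy) => t t1 t2; first exact: (Q_derive W).
by apply: (Q'_ge0 W); exact: le_trans t1.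
Qed.

Lemma T_near_alpha (R : realType) (Q : R -> R) (alpha Lam eta : R) :
  regular_weight Q alpha Lam -> 0 < eta ->
  exists2 X, 0 < X & forall t, X <= t -> `|Tfun Q t - alpha| <= eta.
Proof.
move=> W e0; have /cvgr_dist_le /(_ _ e0) [M [_ hM]] := rw_T_cvg W.
exists (Num.max 1 (M + 1)); first by rewrite lt_max ltr01.
by move=> t; rewrite ge_max => /andP[t1 t2]; rewrite distrC; apply: hM; lra.
Qed.

(** Regular variation of Q with index alpha, uniform down to t = 0. The second estimate concerns x
    Q'(x), the quantity in the integral that defines a_n. *)
Lemma Q_ratio (R : realType) (Q : R -> R) (alpha Lam A del : R) :
  regular_weight Q alpha Lam -> 1 <= A -> 0 < del ->
  exists2 X, 0 < X & forall a t, X <= a -> 0 <= t -> t <= A ->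
    `|Q (a * t) - Q a * t `^ alpha| <= del * Q a /\
    (t <= 1 -> `|a * t * derive1 Q (a * t) - alpha * (Q a * t `^ alpha)| <= del * Q a).
Proof.
move=> W A1 d0; have al1 := rw_alpha W.
pose d1 := del / (4 * alpha).
have d10 : 0 < d1 by rewrite divr_gt0 //; lra.
have d1E : 4 * alpha * d1 = del by rewrite /d1; field; rewrite gt_eqF //; lra.
have d1del : d1 <= del by rewrite -d1E; nra.
have [eta' eta'0 [eta'1 hpow']] := powR_close al1 A1 d10.
pose eta := Num.min eta' (del / 2).
have eta0 : 0 < eta by rewrite /eta lt_min eta'0 divr_gt0.
have etal : eta <= eta' by rewrite /eta ge_min lexx.
have etad : eta <= del / 2 by rewrite /eta ge_min lexx orbT.
have hpow r s t : 0 < t -> t <= A -> alpha - eta <= r -> r <= alpha + eta ->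
    alpha - eta <= s -> s <= alpha + eta -> t `^ r - t `^ s <= d1.
  by move=> *; apply: hpow'; lra.
have eta1 : eta < alpha - 1 by lra.
move: eta eta0 etal etad hpow eta1 => eta eta0 _ etad hpow eta1.
have [X X0 hX] := T_near_alpha W eta0.
pose tau := Num.min 1 d1.
have tau0 : 0 < tau by rewrite /tau lt_min ltr01.
have tau1 : tau <= 1 by rewrite /tau ge_min lexx.
have taud : tau <= d1 by rewrite /tau ge_min lexx orbT.
move: tau tau0 tau1 taud => tau tau0 tau1 taud.
exists (X / tau); first by rewrite divr_gt0.
move=> a t; rewrite ler_pdivrMr // => Xa t0 tA.
have a0 : 0 < a by nra.
have Xa1 : X <= a by nra.
have qa := Q_gt0 W a0.
have Tup s : X <= s -> Tfun Q s <= alpha + eta.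
  by move=> /hX; rewrite ler_norml; lra.
have Tlo s : X <= s -> alpha - eta <= Tfun Q s.
  by move=> /hX; rewrite ler_norml; lra.
have lo1 s : 0 < s -> X <= a * s -> s <= 1 ->
    s `^ (alpha + eta) * Q a <= Q (a * s) <= s `^ (alpha - eta) * Q a.
  move=> s0 Xs s1.
  have as0 : 0 < a * s by rewrite mulr_gt0.
  have asa : a * s <= a by nra.
  have e : a / (a * s) = s^-1 by field; rewrite !gt_eqF.
  have h1 := Q_power_ge W as0 asa (fun t h _ => Tlo t (le_trans Xs h)).
  have h2 := Q_power_le W as0 asa (fun t h _ => Tup t (le_trans Xs h)).
  move: h1 h2; rewrite e !powR_invl ?(ltW s0) // => h1 h2.
  apply/andP; split; first by rewrite mulrC -ler_pdivlMr ?powR_gt0 // mulrC.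
  by rewrite -ler_pdivrMl ?powR_gt0.
have lo2 s : X <= a * s -> 1 <= s ->
    s `^ (alpha - eta) * Q a <= Q (a * s) <= s `^ (alpha + eta) * Q a.
  move=> Xs s1.
  have asa : a <= a * s by nra.
  have e : a * s / a = s by field; rewrite !gt_eqF.
  have h1 := Q_power_ge W a0 asa (fun t h _ => Tlo t (le_trans Xa1 h)).
  have h2 := Q_power_le W a0 asa (fun t h _ => Tup t (le_trans Xa1 h)).
  by move: h1 h2; rewrite e => -> ->.
have tauX : X <= a * tau by [].
have /andP[_ qtau] := lo1 _ tau0 tauX tau1.
have ptau s : 1 <= s -> tau `^ s <= tau.
  move=> s1; rewrite -[leRHS]powRr1 ?(ltW tau0) //.
  by rewrite /powR gt_eqF // ler_expR; have := ln_le0 tau1; nra.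
have qtau' : Q (a * tau) <= tau * Q a.
  by apply: le_trans qtau _; rewrite ler_wpM2r ?(ltW qa) // ptau; lra.
(* Below [tau] the argument a * t may be too small for T to be near alpha. There Q and x Q'(x) are
   bounded by their values at a * tau, which are already small compared with Q a. *)
have [tt|tt] := ltP t tau.
  have ta : t `^ alpha <= tau.
    apply: le_trans (ptau alpha (ltW al1)).
    by apply: ge0_ler_powR; rewrite ?nnegrE; lra.
  have ta0 := powR_ge0 t alpha.
  have at0 : 0 <= a * t by rewrite mulr_ge0 // ltW.
  have atau : a * t <= a * tau by rewrite ler_wpM2l ?ltW.
  have q1 : Q (a * t) <= Q (a * tau) by apply: (Q_le W).
  have q0 := rw_ge0 W (a * t).
  have h3 : 0 <= Q a * t `^ alpha by rewrite mulr_ge0 // ltW.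
  have h4 : Q a * t `^ alpha <= tau * Q a by rewrite mulrC ler_wpM2r // ltW.
  have h5 : tau * Q a <= d1 * Q a by rewrite ler_wpM2r // ltW.
  have h6 : d1 * Q a <= del * Q a by rewrite ler_wpM2r // ltW.
  split; first by rewrite ler_norml; lra.
  move=> _.
  have f0 : 0 <= a * t * derive1 Q (a * t) by rewrite mulr_ge0 // (Q'_ge0 W).
  have f1 : a * t * derive1 Q (a * t) <= a * tau * derive1 Q (a * tau).
    by apply: ler_pM => //; rewrite ?(Q'_ge0 W) // (rw_homo W).
  have f2 : a * tau * derive1 Q (a * tau) <= (2 * alpha) * (d1 * Q a).
    rewrite (TQ W) ?mulr_gt0 //; apply: ler_pM; rewrite ?(rw_ge0 W) //; last lra.
      have := rw_T_ge W (negbT (gt_eqF (mulr_gt0 a0 tau0))); have := rw_Lam W; lra.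
    have := Tup _ tauX; lra.
  have h7 : alpha * (Q a * t `^ alpha) <= alpha * (d1 * Q a) by rewrite ler_wpM2l //; lra.
  have h8 : 0 <= alpha * (Q a * t `^ alpha) by rewrite mulr_ge0 //; lra.
  have h9 : 2 * alpha * (d1 * Q a) <= del * Q a.
    by rewrite mulrA ler_wpM2r ?(ltW qa) // -d1E; nra.
  have h10 : alpha * (d1 * Q a) <= del * Q a by nra.
  by rewrite ler_norml; apply/andP; split; lra.
have t0' : 0 < t by lra.
have Xt : X <= a * t by nra.
have main : `|Q (a * t) - Q a * t `^ alpha| <= d1 * Q a.
  have d2 r s : alpha - eta <= r -> r <= alpha + eta ->
     alpha - eta <= s -> s <= alpha + eta -> t `^ r * Q a - t `^ s * Q a <= d1 * Q a.
    by move=> *; rewrite -mulrBl ler_wpM2r ?(ltW qa) // hpow.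
  have p1 : t `^ (alpha - eta) * Q a - t `^ alpha * Q a <= d1 * Q a by apply: d2; clear -eta0; lra.
  have p2 : t `^ (alpha + eta) * Q a - t `^ alpha * Q a <= d1 * Q a by apply: d2; clear -eta0; lra.
  have p3 : t `^ alpha * Q a - t `^ (alpha - eta) * Q a <= d1 * Q a by apply: d2; clear -eta0; lra.
  have p4 : t `^ alpha * Q a - t `^ (alpha + eta) * Q a <= d1 * Q a by apply: d2; clear -eta0; lra.
  rewrite ler_norml [Q a * _]mulrC; case: (leP t 1) => t1.
    by have /andP[l1 l2] := lo1 _ t0' Xt t1; clear -l1 l2 p1 p2 p3 p4; apply/andP; split; lra.
  by have /andP[l1 l2] := lo2 _ Xt (ltW t1); clear -l1 l2 p1 p2 p3 p4; apply/andP; split; lra.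
split; first by apply: le_trans main _; rewrite ler_wpM2r // ltW.
move=> t1; rewrite (TQ W) ?mulr_gt0 //.
have q1 : Q (a * t) <= Q a by apply: (Q_le W); nra.
have q0 := rw_ge0 W (a * t).
have -> : Tfun Q (a * t) * Q (a * t) - alpha * (Q a * t `^ alpha) =
   (Tfun Q (a * t) - alpha) * Q (a * t) + alpha * (Q (a * t) - Q a * t `^ alpha) by ring.
apply: le_trans (ler_normD _ _) _; rewrite !normrM (ger0_norm q0) (ger0_norm (ltW (lt_trans ltr01 al1))).
have : `|Tfun Q (a * t) - alpha| * Q (a * t) <= (del / 2) * Q a.
  by apply: ler_pM => //; apply: le_trans etad; exact: hX.
have : alpha * `|Q (a * t) - Q a * t `^ alpha| <= alpha * (d1 * Q a).
  by rewrite ler_wpM2l //; lra.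
have -> : alpha * (d1 * Q a) = del * Q a / 4 by rewrite -d1E; field.
nra.
Qed.

(** * Mhaskar--Rakhmanov--Saff numbers *)

Lemma node_mean_le (R : realType) M (f g : R -> R) :
  (forall j, f (qnode R M j) <= g (qnode R M j)) -> node_mean M f <= node_mean M g.
Proof. by move=> h; rewrite ler_wpM2l ?invr_ge0 // ler_sum. Qed.

Lemma node_mean_cst (R : realType) M (c : R) : (0 < M)%N -> node_mean M (fun=> c) = c.
Proof.
by move=> M0; rewrite /node_mean sumr_const card_ord -[c *+ M]mulr_natl mulKf // gt_eqF // ltr0n.
Qed.

Lemma node_meanB (R : realType) M (f g : R -> R) :
  node_mean M f - node_mean M g = node_mean M (fun x => f x - g x).
Proof. by rewrite /node_mean -mulrBr sumrB. Qed.

Lemma node_meanZ (R : realType) M (c : R) (f : R -> R) :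
  node_mean M (fun x => c * f x) = c * node_mean M f.
Proof. by rewrite /node_mean -mulr_sumr mulrCA. Qed.

Lemma node_mean_norm (R : realType) M (f : R -> R) (c : R) : (0 < M)%N ->
  (forall j, `|f (qnode R M j)| <= c) -> `|node_mean M f| <= c.
Proof.
move=> M0 h; rewrite ler_norml -(node_mean_cst (- c) M0) -{2}(node_mean_cst c M0).
by apply/andP; split; apply: node_mean_le => j; have := h j; rewrite ler_norml => /andP[].
Qed.

Lemma node_mean_powR_le1 (R : realType) M (al : R) : (0 < M)%N -> 0 <= al ->
  node_mean M (fun x => `|x| `^ al) <= 1.
Proof.
move=> M0 a0; rewrite -[leRHS](node_mean_cst (1 : R) M0); apply: node_mean_le => j.
by apply: powR_le1 => //; exact: qnode_le1.
Qed.

Lemma node_mean_powR_ge (R : realType) m (al : R) : (0 < m)%N -> 0 <= al ->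
  2^-1 `^ al / 2 <= node_mean (4 * m) (fun x => `|x| `^ al).
Proof.
move=> m0 a0; have m0' : (0 : R) < m%:R by rewrite ltr0n.
rewrite /node_mean (sum_qnode (fun x => x `^ al) m0).
have -> : \sum_(i < m) sin (qangle R m i.+1) `^ al = \sum_(i < m) cos (qangle R m i) `^ al.
  rewrite (reindex_inj rev_ord_inj) /=; apply: eq_bigr => i _.
  rewrite subnSK // -(opprK (cos _)) -sinBpihalf -sinN opprB; congr (sin _ `^ _).
  by rewrite /qangle natrB ?(ltnW (ltn_ord i)) //; field; rewrite gt_eqF.
rewrite -big_split /=.
have : \sum_(i < m) 2^-1 `^ al <= \sum_(i < m) (sin (qangle R m i) `^ al + cos (qangle R m i) `^ al).
  apply: ler_sum => i _; have q0 := qangle_ge0 R m i; have q1 := qangle_le R m0 (ltnW (ltn_ord i)).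
  set th := qangle R m i in q0 q1 *.
  have s0 : 0 <= sin th by have := sin_le (lexx 0) q0 q1; rewrite sin0.
  have c0 : 0 <= cos th by rewrite cos_ge0_pihalf //; have := pi_ge0 R; lra.
  have h := cos2Dsin2 th.
  have mono x : 2^-1 <= x -> 2^-1 `^ al <= x `^ al.
    by move=> hx; apply: ge0_ler_powR; rewrite ?nnegrE //; lra.
  case: (leP 2^-1 (sin th)) => h1.
    by apply: le_trans (mono _ h1) _; rewrite lerDl powR_ge0.
  have h2 : 2^-1 <= cos th by nra.
  by apply: le_trans (mono _ h2) _; rewrite lerDr powR_ge0.
rewrite sumr_const card_ord -[_ *+ _]mulr_natl => h.
by rewrite natrM ler_pdivlMl ?mulr_gt0 //; lra.
Qed.

Section sequences.
Variables (R : realType) (Q : R -> R) (alpha Lam : R) (a : nat -> R).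
Hypotheses (W : regular_weight Q alpha Lam) (MRS : MRS_numbers Q a).

Let Fc (n : nat) t := a n * t * derive1 Q (a n * t).

Lemma MRS_gt0 n : (0 < n)%N -> 0 < a n.
Proof. by move=> /MRS[]. Qed.

Lemma MRS_quadrature n m : (0 < n)%N -> (0 < m)%N ->
  `|node_mean (4 * m) (fun t => Fc n `|t|) - n%:R| <= 2 * (a n * derive1 Q (a n)) / m%:R.
Proof.
move=> n0 m0; have [a0 hn] := MRS n0.
have -> : a n * derive1 Q (a n) = Fc n 1 by rewrite /Fc !mulr1.
apply: quadrature => //.
- move=> t; apply: continuousM; first by apply: continuousM => //; exact: cst_continuous.
  apply: continuous_comp; first by apply: continuousM => //; exact: cst_continuous.
  exact: (rw_continuous W).
- by move=> t t0; rewrite /Fc mulr_ge0 ?(Q'_ge0 W) ?mulr_ge0 // ltW.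
- move=> s t s0 st; have a0' := ltW a0.
  have h : a n * s <= a n * t by rewrite ler_wpM2l.
  by rewrite /Fc; apply: ler_pM => //; rewrite ?(Q'_ge0 W) ?mulr_ge0 // (rw_homo W).
Qed.

(** If a_n < X, the four-node quadrature bounds n by 3 X Q'(X), which fails for large n. *)
Lemma MRS_cvg_pinfty (X : R) : \forall n \near \oo, X <= a n.
Proof.
have W' := W.
wlog X0 : X / 0 < X.
  move=> h; have := h (Num.max 1 X); rewrite lt_max ltr01 => /(_ isT).
  by apply: filterS => n; rewrite ge_max => /andP[].
near=> n.
have n0 : (0 < n)%N by near: n; exact: nbhs_infty_gt.
rewrite leNgt; apply/negP => aX.
have a0 := MRS_gt0 n0.
have := MRS_quadrature n0 (ltn0Sn 0); rewrite divr1 ler_norml => /andP[h _].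
have : node_mean (4 * 1) (fun t => Fc n `|t|) <= a n * derive1 Q (a n).
  rewrite -[leRHS](node_mean_cst _ (_ : 0 < 4 * 1)%N) //; apply: node_mean_le => j.
  have h1 := qnode_le1 R (4 * 1) j.
  have h2 : a n * `|qnode R (4 * 1) j| <= a n by rewrite ger_pMr.
  by rewrite /Fc; apply: ler_pM => //; rewrite ?(Q'_ge0 W) ?(rw_homo W) ?mulr_ge0 // ltW.
have : a n * derive1 Q (a n) <= X * derive1 Q X.
  by apply: ler_pM; rewrite ?(Q'_ge0 W) ?(rw_homo W) // ltW.
have : 3 * (X * derive1 Q X) < n%:R by near: n; exact: nbhs_infty_gtr.
lra.
Unshelve. all: by end_near. Qed.

Lemma Q_div_gt0 n : (0 < n)%N -> 0 < Q (a n) / n%:R.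
Proof. by move=> n0; rewrite divr_gt0 ?ltr0n // (Q_gt0 W) // MRS_gt0. Qed.

(** Half of the error is that of the quadrature with m >= n, the other half comes from replacing x
    Q'(x) by alpha Q(a_n) |x|^alpha at the nodes. *)
Lemma mean_close (del : R) : 0 < del ->
  \forall n \near \oo, forall m, (n <= m)%N ->
   `|n%:R - alpha * Q (a n) * node_mean (4 * m) (fun x => `|x| `^ alpha)| <= del * Q (a n).
Proof.
have W' := W; move=> d0; have al1 := rw_alpha W.
have d2 : 0 < del / 2 by rewrite divr_gt0.
have [X X0 hX] := Q_ratio W (lexx 1) d2.
have [Y Y0 hY] := T_near_alpha W (lt_trans ltr01 al1).
have XY := MRS_cvg_pinfty (Num.max X Y).
near=> n => m nm.
have n0 : (0 < n)%N by near: n; exact: nbhs_infty_gt.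
have m0 : (0 < m)%N := leq_trans n0 nm.
have [aX aY] : X <= a n /\ Y <= a n.
  by apply/andP; rewrite -ge_max; near: n.
have a0 := MRS_gt0 n0; have q0 := Q_gt0 W a0.
have h1 := MRS_quadrature n0 m0.
set P := node_mean (4 * m) _ in h1.
have h2 : `|P - alpha * Q (a n) * node_mean (4 * m) (fun x => `|x| `^ alpha)| <= del / 2 * Q (a n).
  rewrite -node_meanZ /P node_meanB; apply: node_mean_norm; first by rewrite muln_gt0.
  move=> j; have [_ h] := hX _ _ aX (normr_ge0 (qnode R (4 * m) j)) (qnode_le1 _ _ _).
  by rewrite -mulrA; apply: h; exact: qnode_le1.
have h3 : 2 * (a n * derive1 Q (a n)) / m%:R <= del / 2 * Q (a n).
  rewrite (TQ W a0) mulrA mulrAC ler_wpM2r ?(ltW q0) // ler_pdivrMr ?ltr0n //.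
  have : Tfun Q (a n) <= 2 * alpha by have := hY _ aY; rewrite ler_norml; lra.
  have : 8 * alpha / del < n%:R by near: n; exact: nbhs_infty_gtr.
  rewrite ltr_pdivrMr //.
  have : (n%:R : R) <= m%:R by rewrite ler_nat.
  move=> h4 h5 h6; have : n%:R * del <= m%:R * del by rewrite ler_wpM2r // ltW.
  lra.
move: h1 h2 h3; rewrite !ler_norml => /andP[h1 h1'] /andP[h2 h2'] h3.
by apply/andP; split; lra.
Unshelve. all: by end_near. Qed.

Lemma Q_div_bounded : exists2 C : R, 0 < C & \forall n \near \oo, Q (a n) / n%:R <= C.
Proof.
have W' := W; have al1 := rw_alpha W; have al0 : 0 <= alpha by lra.
pose mu0 : R := 2^-1 `^ alpha / 2.
have mu00 : 0 < mu0 by rewrite divr_gt0 // powR_gt0 // invr_gt0.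
have d0 : 0 < alpha * mu0 / 2 by rewrite !divr_gt0 ?mulr_gt0 //; lra.
exists (alpha * mu0 / 2)^-1; first by rewrite invr_gt0.
have := mean_close d0; apply: filterS2 (nbhs_infty_gt 0) => n n0 /(_ n (leqnn n)).
have hm := node_mean_powR_ge n0 al0; rewrite -/mu0 in hm.
have q0 := Q_gt0 W (MRS_gt0 n0).
rewrite ler_norml => /andP[h _].
rewrite ler_pdivrMr ?ltr0n // -ler_pdivrMl ?invr_gt0 // invrK.
have : alpha * Q (a n) * mu0 <= alpha * Q (a n) * node_mean (4 * n) (fun x => `|x| `^ alpha).
  by rewrite ler_wpM2l // mulr_ge0 // ltW.
lra.
Qed.

(** The normalisation of a_n in its working form. Later estimates use this product, so neither
    Q(a_n)/n nor the mean of |x|^alpha has to be evaluated. *)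
Lemma power_mean_asymp (eta : R) : 0 < eta ->
  \forall n \near \oo, forall m, (n <= m)%N ->
   `|alpha * (Q (a n) / n%:R) * node_mean (4 * m) (fun x => `|x| `^ alpha) - 1| <= eta.
Proof.
have W' := W; move=> e0; have [C C0 hC] := Q_div_bounded.
have d0 : 0 < eta / C by rewrite divr_gt0.
have h := mean_close d0; near=> n => m nm.
have n0 : (0 < n)%N by near: n; exact: nbhs_infty_gt.
have n0' : (0 : R) < n%:R by rewrite ltr0n.
have hc : Q (a n) / n%:R <= C by near: n.
have q0 := Q_gt0 W (MRS_gt0 n0).
have hn : forall m, (n <= m)%N ->
   `|n%:R - alpha * Q (a n) * node_mean (4 * m) (fun x => `|x| `^ alpha)| <= eta / C * Q (a n).
  by near: n; exact: h.
move: (hn m nm); set P := node_mean _ _ => hP.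
have -> : alpha * (Q (a n) / n%:R) * P - 1 = (alpha * Q (a n) * P - n%:R) / n%:R.
  by rewrite mulrBl divff ?gt_eqF //; ring.
rewrite normrM (ger0_norm (_ : 0 <= n%:R^-1)) ?invr_ge0 ?(ltW n0') // distrC.
apply: (@le_trans _ _ (eta / C * Q (a n) / n%:R)).
  by rewrite ler_wpM2r // invr_ge0 ltW.
have e : eta / C * C = eta by rewrite divfK // gt_eqF.
by rewrite -mulrA -[leRHS]e ler_wpM2l // ltW.
Unshelve. all: by end_near. Qed.

Lemma Q_unif (A eta : R) : 1 <= A -> 0 < eta ->
  \forall n \near \oo, forall t, `|t| <= A ->
   `|Q (a n * t) / n%:R - Q (a n) / n%:R * `|t| `^ alpha| <= eta.
Proof.
have W' := W; move=> A1 e0; have [C C0 hC] := Q_div_bounded.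
have d0 : 0 < eta / C by rewrite divr_gt0.
have [X X0 hX] := Q_ratio W A1 d0.
have XY := MRS_cvg_pinfty X.
near=> n => t tA.
have n0 : (0 < n)%N by near: n; exact: nbhs_infty_gt.
have n0' : (0 : R) < n%:R by rewrite ltr0n.
have aX : X <= a n by near: n.
have hc : Q (a n) / n%:R <= C by near: n.
have [h _] := hX _ _ aX (normr_ge0 t) tA.
have -> : Q (a n * t) = Q (a n * `|t|).
  by case: (leP 0 t) => t0; [rewrite ger0_norm|rewrite ltr0_norm // mulrN (rw_even W)].
rewrite mulrAC -mulrBl normrM (ger0_norm (_ : 0 <= n%:R^-1)) ?invr_ge0 ?(ltW n0') //.
apply: (@le_trans _ _ (eta / C * Q (a n) / n%:R)); first by rewrite ler_wpM2r // invr_ge0 ltW.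
have e : eta / C * C = eta by rewrite divfK // gt_eqF.
by rewrite -mulrA -[leRHS]e ler_wpM2l // ltW.
Unshelve. all: by end_near. Qed.

Lemma Q_tail n t : (0 < n)%N -> 1 <= t -> t `^ Lam * Q (a n) <= Q (a n * t).
Proof.
have W' := W; move=> n0 t1; have a0 := MRS_gt0 n0.
have h : a n <= a n * t by rewrite ler_peMr // ltW.
have e : a n * t / a n = t by rewrite mulrAC mulfV ?mul1r // gt_eqF.
have := Q_power_ge W a0 h (l := Lam); rewrite e; apply => s s1 _.
by apply: (rw_T_ge W); rewrite gt_eqF //; lra.
Qed.

(** Since T >= Lam > 1, Q(a_n) >= a_n Q(1) once a_n >= 1, while Q(a_n) = O(n). This keeps the powers
    of a_n from rescaling the line subexponential. *)
Lemma MRS_le_linear : exists2 C : R, 0 < C & \forall n \near \oo, a n <= C * n%:R.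
Proof.
have W' := W; have [C C0 hC] := Q_div_bounded; have q1 := Q_gt0 W (@ltr01 R).
have L1 := rw_Lam W.
exists (C / Q 1); first by rewrite divr_gt0.
have a1 := MRS_cvg_pinfty 1.
near=> n.
have n0 : (0 < n)%N by near: n; exact: nbhs_infty_gt.
have n0' : (0 : R) < n%:R by rewrite ltr0n.
have an1 : 1 <= a n by near: n.
have hc : Q (a n) / n%:R <= C by near: n.
rewrite mulrAC ler_pdivlMr //; apply: (@le_trans _ _ (Q (a n))); last by rewrite -ler_pdivrMr.
have := Q_power_ge W (@ltr01 R) an1 (l := Lam); rewrite divr1 => h.
apply: (@le_trans _ _ (a n `^ Lam * Q 1)); last first.
  by apply: h => t t1 _; apply: (rw_T_ge W); rewrite gt_eqF //; lra.
by rewrite ler_wpM2r ?(ltW q1) // le1r_powR // ltW.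
Unshelve. all: by end_near. Qed.

End sequences.

(** * Equilibrium potential and weighted monic polynomials *)

Definition sig (R : realType) (alpha : R) (B i : nat) : R := (i.+1%:R / B%:R) `^ alpha^-1.

Lemma sig_gt0 (R : realType) (alpha : R) (B i : nat) : (0 < B)%N -> 0 < sig alpha B i.
Proof. by move=> B0; rewrite powR_gt0 // divr_gt0 ?ltr0n. Qed.

Lemma sig_le1 (R : realType) (alpha : R) (B i : nat) : 0 < alpha -> (i < B)%N -> sig alpha B i <= 1.
Proof.
move=> a0 iB; have B0 : (0 < B)%N by apply: leq_trans iB.
apply: powR_le1; rewrite ?divr_ge0 ?invr_ge0 ?(ltW a0) //.
by rewrite ler_pdivrMr ?ltr0n // mul1r ler_nat.
Qed.

Lemma ln_sig (R : realType) (alpha : R) (B i : nat) : ln (sig alpha B i) = alpha^-1 * ln (i.+1%:R / B%:R).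
Proof. by rewrite ln_powR. Qed.

(** By [upotE] it is the mean over i of the Green functions of the complements of [-sig i, sig i]:
    the potential of the discretised equilibrium measure up to a constant. *)
Definition upot (R : realType) (alpha : R) (B : nat) (t : R) : R :=
  B%:R^-1 * hsum alpha B (B%:R * `|t| `^ alpha).

Lemma upotE (R : realType) (alpha : R) (B : nat) (t : R) : 0 < alpha -> (0 < B)%N ->
  upot alpha B t = B%:R^-1 * \sum_(i < B) hg (t / sig alpha B i).
Proof.
move=> a0 B0; congr (_ * _); apply: eq_bigr => i _.
have B0' : (0 : R) < B%:R by rewrite ltr0n.
have s0 := sig_gt0 alpha i B0.
have e : (B%:R * `|t| `^ alpha / i.+1%:R) `^ alpha^-1 = `|t / sig alpha B i|.
  rewrite normrM (ger0_norm (_ : 0 <= (sig alpha B i)^-1)) ?invr_ge0 ?(ltW s0) //.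
  rewrite mulrAC powRM ?divr_ge0 ?powR_ge0 // -powRrM mulfV ?gt_eqF // powRr1 //.
  by rewrite mulrC /sig -[B%:R / _]invf_div powR_invl ?divr_ge0.
by rewrite e; apply/eqP; rewrite eq_le !hg_mono // normr_id.
Qed.

Lemma upot_ge0 (R : realType) (alpha : R) (B : nat) (t : R) : 0 <= upot alpha B t.
Proof. by rewrite mulr_ge0 ?invr_ge0 // hsum_ge0. Qed.

Lemma upot_mean_le (R : realType) (alpha : R) (B M : nat) (t : R) : 0 < alpha -> (0 < B)%N ->
  (0 < M)%N ->
  upot alpha B t * node_mean M (fun x => `|x| `^ alpha) <=
    (`|t| `^ alpha + B%:R^-1) * (alpha^-1 + ln 4 / M%:R).
Proof.
move=> a0 B0 M0; have B0' : (0 : R) < B%:R by rewrite ltr0n.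
set mu0 := node_mean _ _; set s := B%:R * `|t| `^ alpha.
have mu1 : 0 <= mu0 by rewrite mulr_ge0 ?invr_ge0 // sumr_ge0 // => j _; rewrite powR_ge0.
have s0 : 0 <= s by rewrite mulr_ge0 ?powR_ge0.
pose k := (Num.truncn s).+1.
have sk : s <= k%:R by rewrite ltW // truncnS_gt.
have ks : k%:R <= s + 1 by rewrite /k -natr1 lerD2r truncn_le.
have h1 := hsum_le B a0 s0 sk; have h2 := hsum_mean_le a0 (ltn0Sn (Num.truncn s)) M0.
have c0 : 0 <= alpha^-1 + ln 4 / M%:R.
  by rewrite addr_ge0 ?invr_ge0 ?(ltW a0) // divr_ge0 // ln_ge0 // ler1n.
rewrite /upot -/s -mulrA ler_pdivrMl //.
apply: (@le_trans _ _ (k%:R * (alpha^-1 + ln 4 / M%:R))).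
  by apply: le_trans h2; rewrite ler_wpM2r.
rewrite mulrA ler_wpM2r //; apply: le_trans ks _.
by rewrite /s mulrDr mulfV // gt_eqF.
Qed.

Lemma upot_le_ln (R : realType) (alpha : R) (B : nat) (t : R) : 0 < alpha -> (0 < B)%N ->
  1 <= `|t| -> upot alpha B t <= ln (2 * `|t|) + alpha^-1.
Proof.
move=> a0 B0 t1; have B0' : (0 : R) < B%:R by rewrite ltr0n.
rewrite upotE // ler_pdivrMl //.
have h (i : 'I_B) : hg (t / sig alpha B i) <= ln (2 * `|t|) + alpha^-1 * ln (B%:R / i.+1%:R).
  have s0 := sig_gt0 alpha i B0; have s1 := sig_le1 a0 (ltn_ord i).
  have i1 : 1 <= (sig alpha B i)^-1 by rewrite invf_ge1.
  have e : `|t / sig alpha B i| = `|t| * (sig alpha B i)^-1.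
    by rewrite normrM (ger0_norm (_ : 0 <= (sig alpha B i)^-1)) // ltW // invr_gt0.
  apply: le_trans (hg_le_ln _) _; first by rewrite e; nra.
  rewrite e mulrA lnM ?posrE ?invr_gt0 ?mulr_gt0 //; last by lra.
  rewrite lerD2l lnV ?posrE // ln_sig -[B%:R / _]invf_div lnV ?posrE ?divr_gt0 ?ltr0n //.
  by rewrite mulrN.
apply: le_trans (ler_sum _ (fun i _ => h i)) _.
rewrite big_split /= sumr_const card_ord -[_ *+ B]mulr_natl mulrDr lerD2l -mulr_sumr [leRHS]mulrC.
by rewrite ler_wpM2l ?invr_ge0 ?(ltW a0) // sum_ln_ge.
Qed.

(** Beyond this threshold the external field dominates the logarithmic growth of the potential: the
    left side is linear in ln t, while t^Lam >= t >= (ln t)^2 / 4. *)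
Lemma two_ln_le_powR (R : realType) (alpha Lam t : R) : 1 < alpha -> 1 < Lam ->
  expR (24 * alpha + 2) <= t -> ln (2 * t) + alpha^-1 + ln t <= t `^ Lam / (2 * alpha).
Proof.
move=> a1 L1 ht.
have t0 : 0 < t := lt_le_trans (expR_gt0 _) ht.
have lt : 24 * alpha + 2 <= ln t by rewrite -[leLHS]expRK ler_ln ?posrE ?expR_gt0.
have t1 : 1 <= t by apply: le_trans ht; have := expR_ge1Dx (24 * alpha + 2); lra.
have tL : t <= t `^ Lam by rewrite le1r_powR // ltW.
have ia : alpha^-1 <= 1 by rewrite invf_le1 //; lra.
have l2 : ln (2 : R) <= 1.
  have h : ln (1 + 1 : R) <= 1 by apply: le_ln1Dx; lra.
  by apply: le_trans h.
have sq : (ln t / 2) ^+ 2 <= t.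
  have e : t = expR (ln t / 2) ^+ 2.
    by rewrite expr2 -expRD -[X in expR X](_ : ln t = _) ?lnK ?posrE //; field.
  rewrite [leRHS]e; have := expR_ge1Dx (ln t / 2); nra.
rewrite lnM ?posrE // ler_pdivlMr; last lra.
apply: le_trans tL; apply: le_trans sq.
rewrite [leRHS](_ : _ = ln t * ln t / 4); last by field.
nra.
Qed.



(** The potential lies below the external field. One divides [upot_mean_le] by the node mean, which
    is bounded below by [mu0], and replaces 1/alpha by Q(a_n)/n times that mean. *)
Lemma upot_le_c (R : realType) (Q : R -> R) (alpha Lam : R) (a : nat -> R) (eta : R) :
  regular_weight Q alpha Lam -> MRS_numbers Q a -> 0 < eta ->
  \forall n \near \oo, forall B t, (0 < B)%N ->
    upot alpha B t <= (`|t| `^ alpha + B%:R^-1) * (Q (a n) / n%:R + eta).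
Proof.
move=> W HM e0; have al1 := rw_alpha W; have al0 : 0 < alpha by lra.
pose mu0 : R := 2^-1 `^ alpha / 2.
have mu00 : 0 < mu0 by rewrite divr_gt0 // powR_gt0 // invr_gt0.
pose e2 := eta * mu0 / 2.
have e20 : 0 < e2 by rewrite divr_gt0 // mulr_gt0.
have hl : \forall n \near \oo, ln 4 / (4 * e2) < n%:R by exact: nbhs_infty_gtr.
have hm := power_mean_asymp W HM e20.
apply: filterS3 (nbhs_infty_gt 0) hl hm => n n0 hl' /(_ n (leqnn n)).
have n0' : (0 : R) < n%:R by rewrite ltr0n.
have M0 : (0 < 4 * n)%N by rewrite muln_gt0.
have := node_mean_powR_ge n0 (ltW al0); rewrite -/mu0.
set mu1 := node_mean _ _; set c := _ / _ => hmu h B t B0.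
have B0' : (0 : R) < B%:R by rewrite ltr0n.
have := upot_mean_le t al0 B0 M0; rewrite -/mu1.
set s := `|t| `^ alpha + _ => hu.
have s0 : 0 <= s by rewrite addr_ge0 ?powR_ge0 ?invr_ge0.
have m0 : 0 < mu1 by lra.
have h4 : ln 4 / (4 * n)%:R <= e2.
  rewrite natrM ler_pdivrMr ?mulr_gt0 //.
  by move: hl'; rewrite ltr_pdivrMr ?mulr_gt0 //; lra.
have h5 : alpha^-1 <= c * mu1 + e2.
  rewrite -div1r ler_pdivrMr //; move: h; rewrite ler_norml => /andP[h _]; nra.
rewrite -(ler_pM2r m0); apply: le_trans hu _; rewrite -mulrA ler_wpM2l //.
have : e2 + e2 <= eta * mu1 by rewrite /e2 -splitr ler_pM2l.
by rewrite mulrDl; lra.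
Qed.

Lemma exists_mesh (R : realType) (C eta : R) : 0 < C -> 0 < eta ->
  exists2 B : nat, (0 < B)%N & C / B%:R <= eta /\ (1 + ln B%:R) / B%:R <= eta.
Proof.
move=> C0 e0; pose N := (Num.truncn ((C + 3) / eta)).+1.
have N0 : (0 : R) < N%:R by rewrite ltr0n.
have N1 : (1 : R) <= N%:R by rewrite ler1n.
have hN : (C + 3) / eta < N%:R := truncnS_gt _.
rewrite ltr_pdivrMr // in hN.
exists (N ^ 2)%N; first by rewrite expn_gt0.
rewrite natrX; split.
  rewrite ler_pdivrMr ?exprn_gt0 //; nra.
have hl : ln (N%:R : R) <= N%:R.
  have h0 : -1 < N%:R - 1 :> R by lra.
  by have := le_ln1Dx h0; rewrite addrC subrK; lra.
rewrite ler_pdivrMr ?exprn_gt0 // lnXn // -[_ *+ 2]mulr_natl; nra.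
Qed.

Lemma Q_norm (R : realType) (Q : R -> R) (alpha Lam x t : R) : regular_weight Q alpha Lam ->
  Q (x * t) = Q (x * `|t|).
Proof.
move=> W; case: (leP 0 t) => t0; first by rewrite ger0_norm.
by rewrite ltr0_norm // mulrN (rw_even W).
Qed.

Lemma Q_div_ge (R : realType) (Q : R -> R) (alpha Lam : R) (a : nat -> R) :
  regular_weight Q alpha Lam -> MRS_numbers Q a ->
  \forall n \near \oo, (2 * alpha)^-1 <= Q (a n) / n%:R.
Proof.
move=> W HM; have al1 := rw_alpha W; have al0 : 0 < alpha by lra.
have half0 : (0 : R) < 2^-1 by rewrite invr_gt0.
apply: filterS2 (nbhs_infty_gt 0) (power_mean_asymp W HM half0) => n n0 /(_ n (leqnn n)).
have M0 : (0 < 4 * n)%N by rewrite muln_gt0.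
have := node_mean_powR_le1 M0 (ltW al0); have := node_mean_powR_ge n0 (ltW al0).
have : 0 < (2^-1 : R) `^ alpha by rewrite powR_gt0.
have := Q_div_gt0 W HM n0.
set mu1 := node_mean _ _; set c := _ / _; rewrite ler_norml => c0 p0 m0 m1 /andP[h _].
rewrite -div1r ler_pdivrMr ?mulr_gt0 //.
have : alpha * c * mu1 <= alpha * c * 1 by apply: ler_wpM2l => //; apply: mulr_ge0; exact: ltW.
lra.
Qed.

(** On |t| <= A this is [upot_le_c] with uniform regular variation; beyond A the field grows at
    least like |t|^Lam and absorbs all logarithms. The term with [e], of order 1/n in the
    application, pays for polynomial factors of fixed degree. *)
Lemma upot_weight (R : realType) (Q : R -> R) (alpha Lam : R) (a : nat -> R) :
  regular_weight Q alpha Lam -> MRS_numbers Q a ->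
  exists2 A : R, 1 <= A & forall eta, 0 < eta ->
   exists2 B : nat, (0 < B)%N & (1 + ln B%:R) / B%:R <= eta /\
    \forall n \near \oo, forall t e, 0 <= e -> e <= 1 ->
      upot alpha B t + e * ln (Num.max 1 `|t|) <= Q (a n * t) / n%:R + eta + e * ln A.
Proof.
move=> W HM; have al1 := rw_alpha W; have al0 : 0 < alpha by lra.
pose A := expR (24 * alpha + 2).
have A1 : 1 <= A by have := expR_ge1Dx (24 * alpha + 2); rewrite -/A; lra.
exists A => // eta e0.
have lA : 0 <= ln A by rewrite ln_ge0.
have [C C0 hC] := Q_div_bounded W HM.
pose Aa := A `^ alpha.
have Aa1 : 1 <= Aa by exact: le_trans A1 (le1r_powR A1 (ltW al1)).
pose e1 := Num.min 1 (eta / (4 * Aa)).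
have e10 : 0 < e1 by rewrite lt_min ltr01 divr_gt0 // mulr_gt0 //; lra.
have e11 : e1 <= 1 by rewrite ge_min lexx.
have e12 : e1 * Aa <= eta / 4.
  have : e1 <= eta / (4 * Aa) by rewrite ge_min lexx orbT.
  by rewrite ler_pdivlMr; [lra|apply: mulr_gt0; lra].
move: e1 e10 e11 e12 => e1 e10 e11 e12.
have C1 : 0 < 4 * (C + 1) by lra.
have [B B0 [B1 B2]] := exists_mesh C1 e0.
exists B => //; split => //.
have hu := upot_le_c W HM e10.
have e4 : 0 < eta / 4 by rewrite divr_gt0.
have hq := Q_unif W HM A1 e4.
have hm := Q_div_ge W HM.
apply: filterS3 (filterI (nbhs_infty_gt 0) hC) (filterI hu hq) hm => n [n0 hc] [hun hqn] c0 t e ee0 ee1.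
have n0' : (0 : R) < n%:R by rewrite ltr0n.
have [tA|tA] := leP `|t| A.
  have hu' := hun B t B0; have hq' := hqn t tA.
  have tAa : `|t| `^ alpha <= Aa.
    by apply: ge0_ler_powR; rewrite ?nnegrE //; lra.
  have l1 : e * ln (Num.max 1 `|t|) <= e * ln A.
    rewrite ler_wpM2l // ler_ln ?posrE ?lt_max ?ltr01 //; last lra.
    by rewrite ge_max A1.
  move: hq'; rewrite ler_norml => /andP[hq' _].
  have iB : 0 < B%:R^-1 :> R by rewrite invr_gt0 ltr0n.
  have h1 : `|t| `^ alpha * e1 <= eta / 4.
    by apply: le_trans e12; rewrite mulrC ler_wpM2l // ltW.
  have h2 : B%:R^-1 * (Q (a n) / n%:R + e1) <= eta / 4.
    apply: (@le_trans _ _ (B%:R^-1 * (C + 1))); first by rewrite ler_wpM2l ?(ltW iB) //; lra.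
    by move: B1; rewrite [_ / B%:R]mulrC; lra.
  by move: hu'; rewrite mulrDl mulrDr; lra.
have t1 : 1 <= `|t| by lra.
have hl := two_ln_le_powR al1 (rw_Lam W) (ltW tA).
have hp := upot_le_ln al0 B0 t1.
have ht := Q_tail W HM n0 t1.
rewrite (Q_norm (a n) t W).
have mx : Num.max 1 `|t| = `|t| by apply/max_idPr.
have lt0 : 0 <= ln `|t| by rewrite ln_ge0.
have el : e * ln `|t| <= ln `|t| by rewrite ler_piMl.
have h3 : `|t| `^ Lam * (2 * alpha)^-1 <= Q (a n * `|t|) / n%:R.
  apply: (@le_trans _ _ (`|t| `^ Lam * (Q (a n) / n%:R))); first by rewrite ler_wpM2l ?powR_ge0.
  by rewrite mulrA ler_wpM2r ?invr_ge0 ?(ltW n0').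
have h4 : 0 <= e * ln A by rewrite mulr_ge0.
by rewrite mx; lra.
Qed.

(** * Nodes distributed along the discretised equilibrium measure *)

Definition mesh_nodes (R : realType) (alpha : R) (B d : nat) : seq R :=
  [seq sig alpha B (nat_of_ord i) * qnode R d (nat_of_ord k) | i <- enum 'I_B, k <- enum 'I_d].

Lemma size_mesh_nodes (R : realType) (alpha : R) (B d : nat) :
  size (mesh_nodes alpha B d) = (B * d)%N.
Proof. by rewrite size_allpairs !size_enum_ord. Qed.

Lemma mesh_nodes_le1 (R : realType) (alpha : R) (B d : nat) v : 0 < alpha ->
  v \in mesh_nodes alpha B d -> `|v| <= 1.
Proof.
move=> a0 /allpairsP[[i k] [_ _ ->]] /=.
have B0 : (0 < B)%N by apply: leq_trans (ltn_ord i).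
rewrite normrM (ger0_norm (ltW (sig_gt0 alpha i B0))).
have := sig_le1 a0 (ltn_ord i); have := sig_gt0 alpha i B0; have := qnode_le1 R d k.
by have := normr_ge0 (qnode R d k); nra.
Qed.

(** One application of [prod_grid_le] per component. Each scaling contributes d ln (sig i), and
    these add up to about -B d / alpha: hence the -1/alpha in the rate, next to the -ln 2 from the
    capacity of [-1,1]. *)
Lemma mesh_prod_le (R : realType) (alpha : R) (B d : nat) (t : R) : 0 < alpha ->
  (0 < B)%N -> (0 < d)%N ->
  `|\prod_(v <- mesh_nodes alpha B d) (t - v)| <=
   expR (d%:R / alpha * (1 + ln B%:R - B%:R) + B%:R * ln 4 + (B * d)%:R * (upot alpha B t - ln 2)).
Proof.
move=> a0 B0 d0; have B0' : (0 : R) < B%:R by rewrite ltr0n.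
rewrite big_allpairs_dep big_enum normr_prod /=.
have hi (i : 'I_B) : `|\prod_(k <- enum 'I_d) (t - sig alpha B i * qnode R d k)| <=
    expR (d%:R * (ln (sig alpha B i) + hg (t / sig alpha B i) - ln 2) + ln 4).
  have s0 := sig_gt0 alpha i B0; set s := sig alpha B i in s0 *.
  rewrite big_enum normr_prod /=.
  have e (k : 'I_d) : `|t - s * qnode R d k| = s * normc (((t / s)%:C)%C - ((qnode R d k)%:C)%C).
    have -> : ((t / s)%:C)%C - ((qnode R d k)%:C)%C = ((t / s - qnode R d k)%:C)%C.
      by apply/eqP; rewrite eq_complex /= subr0 !eqxx.
    rewrite normc_real -{2}(ger0_norm (ltW s0)) -normrM mulrBr mulrCA mulfV ?mulr1 //.
    by rewrite gt_eqF.
  rewrite (eq_bigr _ (fun k _ => e k)) big_split /= prodr_const card_ord.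
  apply: le_trans (ler_wpM2l (exprn_ge0 _ (ltW s0)) (prod_grid_le (((t / s)%:C)%C) d0)) _.
  rewrite -expR_hg le_eqVlt; apply/orP; left; apply/eqP.
  rewrite expRD lnK ?posrE // mulrCA [RHS]mulrC; congr (_ * _).
  have -> : expR (d%:R * (ln s + hg (t / s) - ln 2)) = (s * (expR (hg (t / s)) / 2)) ^+ d.
    have es : expR (ln s) = s by rewrite lnK ?posrE.
    have e2 : expR (ln 2) = 2 :> R by rewrite lnK ?posrE.
    by rewrite expRM_natl expRB expRD es e2 mulrA.
  by rewrite [RHS]exprMn.
apply: (@le_trans _ _ (\prod_(i < B) expR (d%:R * (ln (sig alpha B i) + hg (t / sig alpha B i) - ln 2) + ln 4))).
  by apply: ler_prod => i _; rewrite normr_ge0 hi.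
rewrite -expR_sum ler_expR big_split /= -mulr_sumr sumrB big_split /= !sumr_const card_ord.
have -> : \sum_(i < B) hg (t / sig alpha B i) = B%:R * upot alpha B t.
  by rewrite upotE // mulVKf // gt_eqF.
under eq_bigr => i _ do rewrite ln_sig.
rewrite -mulr_sumr -[ln 2 *+ B]mulr_natl -[ln 4 *+ B]mulr_natl natrM.
have := @sum_ln_le R B B0; set S := \sum_(i < B) _ => hS.
have : d%:R / alpha * S <= d%:R / alpha * (1 + ln B%:R - B%:R).
  by rewrite ler_wpM2l // divr_ge0 // ltW.
rewrite [d%:R / alpha]mulrC; lra.
Qed.

Lemma mesh_divn (B K n : nat) : (0 < B)%N -> (K + B + B < n)%N ->
  let d := ((n - K) %/ B)%N in
  [/\ (0 < d)%N, (B * d + K <= n)%N & (n <= B * d + (K + B))%N].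
Proof.
move=> B0 nK d.
have dB : (B * d <= n - K)%N by rewrite mulnC leq_trunc_div.
have dB2 : (n - K < B * d + B)%N by rewrite mulnC addnC; have := ltn_ceil (n - K) B0; rewrite mulSn.
split; [by rewrite divn_gt0 //; lia|lia|lia].
Qed.

(* The factors in t leave room for a cofactor of degree K1 and for integration over the line. *)
Lemma weighted_nodes (R : realType) (Q : R -> R) (alpha Lam : R) (a : nat -> R) (eta : R) (K : nat) :
  regular_weight Q alpha Lam -> MRS_numbers Q a -> 0 < eta ->
  exists K1 : nat, \forall n \near \oo, exists nu : seq R,
   [/\ (size nu + K <= n)%N, (n <= size nu + K1)%N, (forall v, v \in nu -> `|v| <= 1) &
     forall t, (1 + t ^+ 2) * Num.max 1 `|t| ^+ (2 * K1) *
       (`|\prod_(v <- nu) (t - v)| * expR (- Q (a n * t))) ^+ 2 <=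
       expR (2 * n%:R * (eta - ln 2 - alpha^-1))].
Proof.
move=> W HM e0; have al1 := rw_alpha W; have al0 : 0 < alpha by lra.
have ia : 0 <= alpha^-1 by rewrite invr_ge0 ltW.
have ia1 : alpha^-1 <= 1 by rewrite invf_le1 //; lra.
have [A A1 hA] := upot_weight W HM.
have e3 : 0 < eta / 3 by rewrite divr_gt0.
have [B B0 [B1 hB]] := hA _ e3.
have B0' : (0 : R) < B%:R by rewrite ltr0n.
(* The degree falls short of n by K, for the window of coefficients, and by less than B from
   rounding (n - K)/B down. *)
exists (K + B)%N; set K1 := (K + B)%N.
pose cst : R := K1%:R * (alpha^-1 + ln 2) + B%:R * ln 4 + ln 2 + K1.+1%:R * ln A.
have hc : \forall n \near \oo, cst / (eta / 3) < n%:R by exact: nbhs_infty_gtr.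
apply: filterS3 (nbhs_infty_gt (K1 + B)%N) hc hB => n nK hcn hn.
have [d0 dB dB2] := mesh_divn B0 nK.
have n0 : (0 < n)%N by apply: leq_ltn_trans nK.
have K1n : (K1 < n)%N by apply: leq_ltn_trans nK; rewrite leq_addr.
set d := (_ %/ _)%N in d0 dB dB2.
have n0' : (0 : R) < n%:R by rewrite ltr0n.
exists (mesh_nodes alpha B d); rewrite size_mesh_nodes; split => //.
- by move=> v; apply: mesh_nodes_le1.
move=> t; set L := ln (Num.max 1 `|t|).
have mx1 : 1 <= Num.max 1 `|t| by rewrite le_max lexx.
have mx0 : 0 < Num.max 1 `|t| by lra.
have mxE : Num.max 1 `|t| = expR L by rewrite lnK.
have L0 : 0 <= L by rewrite ln_ge0.
have t2 : 1 + t ^+ 2 <= expR (ln 2 + 2 * L).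
  rewrite expRD lnK ?posrE // expRM_natl -mxE.
  have : `|t| <= Num.max 1 `|t| by rewrite le_max lexx orbT.
  rewrite -(real_normK (num_real t)); have := normr_ge0 t; nra.
(* K1 units pay for the power of max(1, |t|) and one more for 1 + t^2. *)
have {hn} := hn t (K1.+1%:R / n%:R).
rewrite divr_ge0 // ler_pdivrMr // mul1r ler_nat => /(_ isT).
move=> /(_ K1n) hu.
have {hu} hu : n%:R * upot alpha B t + K1.+1%:R * L <= Q (a n * t) + n%:R * (eta / 3) + K1.+1%:R * ln A.
  have := hu; rewrite -(ler_pM2l n0') !mulrDr ![n%:R * (_ / n%:R * _)]mulrA ![n%:R * (_ / n%:R)]mulrC.
  by rewrite !divfK ?gt_eqF.
have hm := mesh_prod_le t al0 B0 d0.
set E := _ + _ + _ in hm.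
have md : (B * d)%:R <= n%:R :> R by rewrite ler_nat (leq_trans (leq_addr K _)).
have md2 : n%:R <= (B * d)%:R + K1%:R :> R by rewrite -natrD ler_nat.
have hE : E <= n%:R * (eta / 3) + (K1%:R - n%:R) * (alpha^-1 + ln 2) + B%:R * ln 4 + n%:R * upot alpha B t.
  have u0 := upot_ge0 alpha B t.
  have h1 : (B * d)%:R * upot alpha B t <= n%:R * upot alpha B t by rewrite ler_wpM2r.
  have h2 : d%:R / alpha * (1 + ln B%:R) <= n%:R * (eta / 3).
    have : 1 + ln B%:R <= eta / 3 * B%:R by rewrite -ler_pdivrMr.
    have l0 : 0 <= ln (B%:R : R) by rewrite ln_ge0 // ler1n.
    have da : d%:R / alpha <= d%:R by rewrite ler_pdivrMr // ler_peMr // ltW.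
    have da0 : 0 <= d%:R / alpha by rewrite divr_ge0 // ltW.
    move=> h; apply: (@le_trans _ _ (d%:R * (eta / 3 * B%:R))); first by apply: ler_pM => //; lra.
    by move: md; rewrite natrM => md; nra.
  have h3 : (B * d)%:R * (alpha^-1 + ln 2) >= (n%:R - K1%:R) * (alpha^-1 + ln 2).
    rewrite ler_wpM2r //; last by lra.
    by rewrite addr_ge0 // ln_ge0 // ler1n.
  have h4 : d%:R / alpha * B%:R = (B * d)%:R * alpha^-1 by rewrite natrM; ring.
  rewrite /E mulrBr h4; lra.
rewrite exprM mxE -!expRM_natl.
apply: (@le_trans _ _ (expR (ln 2 + 2 * L) * expR (K1%:R * (2%:R * L)) * expR (E - Q (a n * t)) ^+ 2)).
  apply: ler_pM => //; rewrite ?mulr_ge0 ?expR_ge0 ?exprn_ge0 ?addr_ge0 ?sqr_ge0 //.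
  - by rewrite ler_wpM2r ?expR_ge0.
  - rewrite expRD; set p := `|_|.
    have p0 : 0 <= p := normr_ge0 _.
    by rewrite lerXn2r ?nnegrE ?mulr_ge0 ?expR_ge0 // ler_wpM2r ?expR_ge0.
rewrite -expRM_natl -!expRD ler_expR.
have l2 : 0 <= ln (2 : R) by rewrite ln_ge0 // ler1n.
have K1S : K1.+1%:R = K1%:R + 1 :> R by rewrite natr1.
move: hcn; rewrite ltr_pdivrMr // /cst K1S => hcn.
rewrite K1S in hu; lra.
Qed.

(** * A submultiplicative norm on polynomials *)

(** Multiplying by X - z enlarges this norm by at most rho + |z|, and dividing by it shrinks the
    norm by at least rho - |z|. With rho = n, up to n bounded factors of either kind change rho^n
    only by a bounded factor. *)
Definition pnorm (R : realType) (rho : R) (p : {poly R}) : R := \sum_(i < size p) `|p`_i| * rho ^+ i.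

Definition cpnorm (R : realType) (rho : R) (p : {poly R[i]}) : R :=
  \sum_(i < size p) normc p`_i * rho ^+ i.

Notation toC R := (real_complex R).

Lemma normc0 (R : realType) : normc (0 : R[i]) = 0.
Proof. exact: ComplexField.Normc.normc0. Qed.

Lemma pnorm_widen (R : realType) (rho : R) (p : {poly R}) n : (size p <= n)%N ->
  pnorm rho p = \sum_(i < n) `|p`_i| * rho ^+ i.
Proof.
move=> pn; rewrite /pnorm -!(big_mkord xpredT (fun i => `|p`_i| * rho ^+ i)).
rewrite [RHS](big_cat_nat (leq0n (size p)) pn) /= [X in _ + X]big_nat [X in _ + X]big1 ?addr0 //.
by move=> i /andP[h _]; rewrite nth_default // normr0 mul0r.
Qed.

Lemma cpnorm_widen (R : realType) (rho : R) (p : {poly R[i]}) n : (size p <= n)%N ->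
  cpnorm rho p = \sum_(i < n) normc p`_i * rho ^+ i.
Proof.
move=> pn; rewrite /cpnorm -!(big_mkord xpredT (fun i => normc p`_i * rho ^+ i)).
rewrite [RHS](big_cat_nat (leq0n (size p)) pn) /= [X in _ + X]big_nat [X in _ + X]big1 ?addr0 //.
by move=> i /andP[h _]; rewrite nth_default // normc0 mul0r.
Qed.

Lemma cpnorm_map (R : realType) (rho : R) (p : {poly R}) : cpnorm rho (map_poly (toC R) p) = pnorm rho p.
Proof.
rewrite /cpnorm size_map_poly; apply: eq_bigr => i _.
by rewrite coef_map normc_real.
Qed.

Lemma pnorm_ge0 (R : realType) (rho : R) (p : {poly R}) : 0 <= rho -> 0 <= pnorm rho p.
Proof. by move=> r0; apply: sumr_ge0 => i _; rewrite mulr_ge0 ?exprn_ge0. Qed.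

Lemma cpnorm_mul_XsubC (R : realType) (rho : R) (p : {poly R[i]}) z : 0 <= rho ->
  cpnorm rho (('X - z%:P) * p) <= (rho + normc z) * cpnorm rho p.
Proof.
move=> r0; set n := size p.
have sz : (size (('X - z%:P) * p)%R <= n.+1)%N.
  by apply: leq_trans (size_polyMleq _ _) _; rewrite size_XsubC.
rewrite (cpnorm_widen _ sz).
have hi (i : 'I_n.+1) : normc (('X - z%:P) * p)`_i * rho ^+ i <=
    normc ('X * p)`_i * rho ^+ i + normc z * (normc p`_i * rho ^+ i).
  rewrite mulrA -mulrDl ler_wpM2r ?exprn_ge0 // mulrBl coefB coefCM.
  by rewrite -ComplexField.Normc.normcM normc_sub_le.
apply: le_trans (ler_sum _ (fun i _ => hi i)) _.
rewrite big_split /= -mulr_sumr -(cpnorm_widen _ (leqnSn n)) mulrDl lerD2r.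
rewrite big_ord_recl coefXM /= normc0 mul0r add0r /cpnorm mulr_sumr le_eqVlt.
by apply/orP; left; apply/eqP/eq_bigr => i _; rewrite coefXM /= exprS mulrCA.
Qed.

Lemma cpnorm_prod (R : realType) (rho : R) (c : R[i]) (r : seq R[i]) : 0 <= rho ->
  cpnorm rho (c *: \prod_(z <- r) ('X - z%:P)) <= normc c * \prod_(z <- r) (rho + normc z).
Proof.
move=> r0; elim: r c => [|z r IH] c.
  rewrite !big_nil mulr1 alg_polyC (cpnorm_widen _ (size_polyC_leq1 c)) big_ord1.
  by rewrite expr0 mulr1 coefC eqxx.
rewrite !big_cons scalerAr; apply: le_trans (cpnorm_mul_XsubC _ _ r0) _.
by rewrite mulrCA ler_wpM2l ?addr_ge0 ?normc_ge0.
Qed.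

Lemma pnorm_div_XsubC (R : realType) (rho : R) (h : {poly R}) (v c : R) : 0 <= rho ->
  (rho - `|v|) * pnorm rho h <= pnorm rho (h * ('X - v%:P) + c%:P).
Proof.
move=> r0; set p := h * ('X - v%:P) + c%:P; set n := size h.
have sz : (size p <= n.+1)%N.
  apply: leq_trans (size_polyD _ _) _; rewrite geq_max; apply/andP; split.
    by apply: leq_trans (size_polyMleq _ _) _; rewrite size_XsubC addnC.
  by apply: leq_trans (size_polyC_leq1 c) _.
rewrite mulrBl lerBlDr (pnorm_widen _ sz) (pnorm_widen _ (leqnSn n)).
have hi (i : 'I_n.+1) : `|(h * 'X)`_i| * rho ^+ i <=
    `|p`_i| * rho ^+ i + `|v| * (`|h`_i| * rho ^+ i).
  rewrite mulrA -mulrDl ler_wpM2r ?exprn_ge0 // -normrM.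
  case: (nat_of_ord i) => [|j]; first by rewrite coefMX /= normr0 addr_ge0.
  have -> : (h * 'X)`_j.+1 = p`_j.+1 + v * h`_j.+1.
    by rewrite /p coefD mulrBr coefB coefMC coefC /=; ring.
  exact: ler_normD.
rewrite mulr_sumr; apply: le_trans (_ : _ <= \sum_(i < n.+1) (`|(h * 'X)`_i| * rho ^+ i)) _; last first.
  by apply: le_trans (ler_sum _ (fun i _ => hi i)) _; rewrite big_split /= -mulr_sumr.
rewrite [leRHS]big_ord_recl coefMX /= normr0 mul0r add0r.
rewrite [leLHS]big_ord_recr /= nth_default // normr0 mul0r mulr0 addr0 le_eqVlt.
by apply/orP; left; apply/eqP/eq_bigr => i _; rewrite coefMX /= exprS mulrCA.
Qed.

Lemma pnorm_div_prod (R : realType) (rho : R) (nu : seq R) (h r : {poly R}) : 1 <= rho ->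
  (forall v, v \in nu -> `|v| <= 1) -> (size r <= size nu)%N ->
  (rho - 1) ^+ size nu * pnorm rho h <= pnorm rho (h * \prod_(v <- nu) ('X - v%:P) + r).
Proof.
move=> r1; have r0 : 0 <= rho by lra.
elim: nu h r => [|v nu IH] h r hv sr.
  rewrite big_nil mulr1 expr0 mul1r.
  by move: sr; rewrite leqn0 size_poly_eq0 => /eqP ->; rewrite addr0.
rewrite big_cons.
set q := \prod_(_ <- nu) _; pose c := r`_(size nu).
have sq : size q = (size nu).+1 by rewrite size_prod_XsubC.
have mq : q \is monic by apply: monic_prod_XsubC.
have lq : q`_(size nu) = 1 by move/monicP: mq; rewrite /lead_coef sq.
(* The top coefficient of the remainder joins the first linear factor, which leaves a remainder
   small enough for the induction hypothesis. *)
have -> : h * (('X - v%:P) * q) + r = (h * ('X - v%:P) + c%:P) * q + (r - c%:P * q) by ring.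
have sr2 : (size (r - c%:P * q)%R <= size nu)%N.
  apply/leq_sizeP => j; rewrite leq_eqVlt => /orP[/eqP <-|hj].
    by rewrite coefB coefCM lq mulr1 subrr.
  rewrite coefB coefCM !nth_default ?mulr0 ?subrr ?sq //.
  exact: leq_trans sr hj.
apply: le_trans (IH _ _ _ sr2); last by move=> u hu; apply: hv; rewrite inE hu orbT.
rewrite /= exprSr -mulrA ler_wpM2l ?exprn_ge0 //; first lra.
apply: le_trans (pnorm_div_XsubC h v c r0); rewrite ler_wpM2r ?pnorm_ge0 //.
by have := hv v (mem_head _ _); lra.
Qed.

Lemma horner_le_pnorm (R : realType) (rho : R) (p : {poly R}) (k : nat) (t : R) : 1 <= rho ->
  (size p <= k.+1)%N -> `|p.[t]| <= pnorm rho p * Num.max 1 `|t| ^+ k.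
Proof.
move=> r1 sp; rewrite horner_coef /pnorm mulr_suml.
apply: le_trans (ler_norm_sum _ _ _) _; apply: ler_sum => i _.
rewrite normrM normrX -mulrA ler_wpM2l //.
have m1 : 1 <= Num.max 1 `|t| by rewrite le_max lexx.
have ik : (i <= k)%N by rewrite -ltnS (leq_trans (ltn_ord i)).
apply: (@le_trans _ _ (Num.max 1 `|t| ^+ i)).
  by rewrite lerXn2r ?nnegrE ?le_max ?lexx ?orbT ?ler01.
apply: (@le_trans _ _ (Num.max 1 `|t| ^+ k)); first by rewrite ler_weXn2l.
by rewrite ler_peMl ?exprn_ege1 // exprn_ge0 //; lra.
Qed.

Lemma mup_prod_XsubC (F : fieldType) (x : F) (r : seq F) :
  mup x (\prod_(z <- r) ('X - z%:P)) = count_mem x r.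
Proof.
elim: r => [|z r IH]; first by rewrite big_nil mupNroot // root1.
rewrite big_cons mupM ?polyXsubC_eq0 ?monic_neq0 ?monic_prod_XsubC // IH /=; congr (_ + _)%N.
by have := mup_XsubCX 1 x z; rewrite expr1 => ->; case: eqP.
Qed.

Lemma mup_map_le (R : realType) (p : {poly R}) (c : R[i]) (r : seq R[i]) (x : R) : p != 0 ->
  map_poly (toC R) p = c *: \prod_(z <- r) ('X - z%:P) ->
  (mup x p <= count_mem ((x%:C)%C) r)%N.
Proof.
move=> p0 e; rewrite -mup_prod_XsubC mup_geq ?monic_neq0 ?monic_prod_XsubC //.
have c0 : c != 0.
  apply/eqP => c0; move: e; rewrite c0 scale0r => /eqP; rewrite map_poly_eq0.
  by apply/negP.
rewrite -(dvdpZr _ _ c0) -e.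
have -> : ('X - ((x%:C)%C)%:P) ^+ mup x p = map_poly (toC R) (('X - x%:P) ^+ mup x p).
  by rewrite rmorphXn /= map_polyXsubC.
by rewrite dvdp_map -mup_geq.
Qed.

(** A complex root in the list is charged by at most one real x of the duplicate-free list, namely
    its real part. *)
Lemma sum_mup_le (R : realType) (p : {poly R}) (c : R[i]) (r : seq R[i]) (s : seq R) (E : pred R[i]) :
  p != 0 -> map_poly (toC R) p = c *: \prod_(z <- r) ('X - z%:P) ->
  uniq s -> (forall x, x \in s -> E ((x%:C)%C)) ->
  (\sum_(x <- s) mup x p <= count E r)%N.
Proof.
move=> p0 e us hs.
apply: (@leq_trans (\sum_(x <- s) count_mem ((x%:C)%C) r)%N).
  by rewrite !big_seq leq_sum // => x _; exact: mup_map_le e.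
elim: r {e} => [|z r IH] /=; first by rewrite big1.
rewrite big_split /= leq_add // {IH}.
case Ez : (E z); last first.
  rewrite big_seq big1 // => x xs; apply/eqP; rewrite eqb0; apply/eqP => zx.
  by have := hs x xs; rewrite -zx Ez.
apply: (@leq_trans (\sum_(x <- s) (x == complex.Re z))%N).
  rewrite leq_sum // => x _; case: eqP => // ->; by rewrite /= eqxx.
have -> : (\sum_(x <- s) (x == complex.Re z) = count_mem (complex.Re z) s)%N.
  by elim: s {us hs} => [|x s IH]; rewrite ?big_nil // big_cons /= IH.
by rewrite count_uniq_mem //; case: (_ \in _).
Qed.

(** * Orthonormal expansions *)

Lemma continuous_poly (R : realType) (p : {poly R}) : continuous (fun x => p.[x]).
Proof.
elim/poly_ind: p => [|p c IH].
  have -> : (fun x => (0 : {poly R}).[x]) = fun=> 0 by apply/funext => x; rewrite horner0.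
  by move=> x; exact: cst_continuous.
have -> : (fun x => (p * 'X + c%:P).[x]) = (fun x => p.[x] * x + c).
  by apply/funext => x; rewrite hornerD hornerM hornerX hornerC.
by move=> x; apply: cvgD; [apply: cvgM => //; exact: IH|exact: cst_continuous].
Qed.

Definition psum (R : realType) (p : nat -> {poly R}) (n : nat) (u : nat -> R) : {poly R} :=
  \sum_(j < n) u j *: p j.

Section orthonormal.
Variables (R : realType) (W : R -> R) (p : nat -> {poly R}).
Hypothesis (op : orthonormal_polys W p).

Let size_p j : size (p j) = j.+1.
Proof. by have [] := op j j. Qed.

Lemma orth_basis n (q : {poly R}) : (size q <= n)%N -> exists u, q = psum p n u.
Proof.
elim: n q => [|n IH] q sq.
  exists (fun=> 0); rewrite /psum big_ord0.
  by apply/eqP; rewrite -size_poly_eq0 -leqn0.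
have lp : lead_coef (p n) != 0 by have [_ h _ _] := op n n; rewrite gt_eqF.
have pn : (p n)`_n = lead_coef (p n) by rewrite /lead_coef size_p.
pose c := q`_n / lead_coef (p n).
have [|u hu] := IH (q - c *: p n).
  apply/leq_sizeP => j; rewrite leq_eqVlt => /orP[/eqP <-|nj].
    by rewrite coefB coefZ pn divfK // subrr.
  rewrite coefB coefZ !nth_default ?mulr0 ?subrr ?size_p //.
  exact: leq_trans sq nj.
exists (fun j => if j == n then c else u j).
rewrite /psum big_ord_recr /= eqxx -[LHS](subrK (c *: p n)) hu; congr (_ + _).
by apply: eq_bigr => i _; rewrite ltn_eqF.
Qed.

Lemma psum_size_coef n m (u : nat -> R) : (size (psum p n u) <= m)%N ->
  forall j, (m <= j)%N -> (j < n)%N -> u j = 0.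
Proof.
elim: n => [//|n IH] su j mj jn.
have [mn|nm] := leqP m n; last by have := leq_ltn_trans (leq_trans nm mj) jn; rewrite ltnn.
have un0 : u n = 0.
  have lp : lead_coef (p n) != 0 by have [_ h _ _] := op n n; rewrite gt_eqF.
  have : (psum p n.+1 u)`_n = 0 by rewrite nth_default // (leq_trans su).
  rewrite /psum big_ord_recr /= coefD coef_sum big1 ?add0r => [|i _].
    rewrite coefZ; have -> : (p n)`_n = lead_coef (p n) by rewrite /lead_coef size_p.
    by move/eqP; rewrite mulf_eq0 (negbTE lp) orbF => /eqP.
  by rewrite coefZ nth_default ?mulr0 // size_p.
move: jn; rewrite ltnS leq_eqVlt => /orP[/eqP -> //|jn].
apply: IH => //; move: su; rewrite /psum big_ord_recr /= un0 scale0r addr0 //.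
Qed.

Lemma parseval n (u : nat -> R) :
  (\int[mu]_x ((psum p n u).[x] ^+ 2 * W x ^+ 2)%:E = (\sum_(j < n) u j ^+ 2)%:E)%E.
Proof.
have e x : (((psum p n u).[x] ^+ 2 * W x ^+ 2)%:E =
   \sum_(i < n) \sum_(j < n) (u i * u j)%:E * ((p i).[x] * (p j).[x] * W x ^+ 2)%:E)%E.
  under eq_bigr => i _ do (under eq_bigr => j _ do rewrite -EFinM); rewrite /psum.
  under eq_bigr => i _ do rewrite sumEFin; rewrite sumEFin; congr (_%:E)%E.
  rewrite horner_sum expr2 mulr_suml mulr_suml; apply: eq_bigr => i _.
  rewrite mulr_sumr mulr_suml; apply: eq_bigr => j _; rewrite !hornerZ; ring.
under eq_integral do rewrite e.
have int_ij (i j : 'I_n) : (@lebesgue_measure R).-integrable setT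
   (fun x => (u i * u j)%:E * ((p i).[x] * (p j).[x] * W x ^+ 2)%:E)%E.
  by apply: integrableZl => //; have [] := op i j.
rewrite integral_sum //; last by move=> i; exact: integrable_sum.
rewrite -sumEFin; apply: eq_bigr => i _.
rewrite integral_sum // (bigD1 i) //= big1 ?adde0 => [|j ji].
  by have [_ _ ii ei] := op i i; rewrite (integralZl _ ii) // ei eqxx mule1 expr2.
have [_ _ ii ei] := op i j; rewrite (integralZl _ ii) // ei.
by rewrite (_ : (i == j :> nat) = false) ?mule0 //; apply/negbTE; rewrite eq_sym.
Qed.

Lemma coef_sqr_le_integral n m (u : nat -> R) (g r : {poly R}) : psum p n u = g + r ->
  (size g <= n)%N -> (size r <= m)%N ->
  forall j, (m <= j)%N -> (j < n)%N ->
  ((u j ^+ 2)%:E <= \int[mu]_x (g.[x] ^+ 2 * W x ^+ 2)%:E)%E.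
Proof.
move=> e sg sr j mj jn; have [v hv] := orth_basis sg.
have : u j - v j = 0.
  apply: (@psum_size_coef n m (fun j => u j - v j)) => //.
  have -> : psum p n (fun j => u j - v j) = r.
    have -> : psum p n (fun j => u j - v j) = psum p n u - psum p n v.
      by rewrite /psum -sumrB; apply: eq_bigr => i _; rewrite scalerBl.
    by rewrite -hv e addrC addKr.
  exact: sr.
move/subr0_eq => ->; rewrite hv parseval lee_fin (bigD1 (Ordinal jn)) //= lerDl.
by apply: sumr_ge0 => i _; exact: sqr_ge0.
Qed.

(** The diagonal of the Christoffel-Darboux kernel, the reciprocal of the classical Christoffel
    function. *)
Definition christoffel n x := \sum_(j < n) (p j).[x] ^+ 2.

Lemma christoffel_ge0 n x : 0 <= christoffel n x.
Proof. by apply: sumr_ge0 => i _; exact: sqr_ge0. Qed.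

Lemma continuous_christoffel n : continuous (christoffel n).
Proof.
have -> : christoffel n = (fun x => (\sum_(j < n) p j ^+ 2).[x]).
  by apply/funext => x; rewrite horner_sum; apply: eq_bigr => j _; rewrite horner_exp.
exact: continuous_poly.
Qed.

Lemma christoffel_integral n : 
  (\int[mu]_x (christoffel n x * W x ^+ 2)%:E = n%:R%:E)%E.
Proof.
under eq_integral => x _ do rewrite /christoffel mulr_suml -sumEFin.
have ii (i : 'I_n) : (@lebesgue_measure R).-integrable setT (fun x => ((p i).[x] ^+ 2 * W x ^+ 2)%:E).
  by have [] := op i i.
rewrite integral_sum //.
rewrite (eq_bigr (fun=> 1%E)); first by rewrite sumEFin sumr_const card_ord.
by move=> i _; have [_ _ _] := op i i; rewrite eqxx.
Qed.

Lemma psum_le_christoffel n (u : nat -> R) (lam x : R) : 0 <= lam ->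
  (forall j, (j < n)%N -> `|u j| <= lam) ->
  `|(psum p n u).[x]| <= n%:R * lam * Num.sqrt (christoffel n x).
Proof.
move=> l0 hu; rewrite /psum horner_sum; apply: le_trans (ler_norm_sum _ _ _) _.
rewrite -mulrA mulr_natl -[X in _ *+ X]card_ord -sumr_const; apply: ler_sum => i _.
rewrite hornerZ normrM; apply: ler_pM => //; first exact: hu.
rewrite -sqrtr_sqr; apply: ler_wsqrtr; rewrite /christoffel (bigD1 i) //= lerDl.
by apply: sumr_ge0 => j _; exact: sqr_ge0.
Qed.

End orthonormal.

(** * A common translate of finitely many points *)

Lemma integral_translate (R : realType) (f : R -> R) (b h : R) : continuous f -> 0 < h ->
  (\int[mu]_(x in `[0%R, h]) (f (b + x))%:E = \int[mu]_(x in `[b, (b + h)%R]) (f x)%:E)%E.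
Proof.
move=> cf h0; pose F x := b + x.
have dF (x : R) : is_derive x 1 F (1 : R).
  have := is_deriveD (is_derive_cst b x 1) (is_derive_id x 1).
  by rewrite add0r; exact.
have F1 : F^`()%classic = fun=> 1.
  by apply/funext => x; rewrite derive1E; have [_ ->] := dF x.
have cF : continuous F.
  by move=> x; apply: differentiable_continuous; apply/derivable1_diffP; have [] := dF x.
have := @integration_by_substitution_increasing R F f 0 h (ltW h0).
rewrite /F addr0 => -> //.
- by apply: eq_integral => x _; rewrite /= -/F F1 /= mulr1.
- by move=> x y _ _ xy; rewrite ltrD2l.
- by rewrite -/F F1 => x _; exact: cst_continuous.
- by rewrite -/F F1; exact: is_cvg_cst.
- by rewrite -/F F1; exact: is_cvg_cst.
- split.
  + by move=> x _; have [] := dF x.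
  + by apply: cvg_at_right_filter; exact: cF.
  + by apply: cvg_at_left_filter; exact: cF.
- by apply: continuous_subspaceT.
Qed.

(** Integrated over tau in [0, h], the sum of f over the M translated points is at most M S. If
    every shift had a point with f > c, the integral would be at least c h. One shift thus serves
    all points at once. *)
Lemma exists_good_shift (R : realType) (f : R -> R) (S : R) (M : nat) (b : nat -> R) (h c : R) :
  continuous f -> (forall x, 0 <= f x) -> (\int[mu]_x (f x)%:E = S%:E)%E ->
  0 < h -> 0 <= c -> M%:R * S < c * h ->
  exists tau, [/\ 0 <= tau, tau <= h & forall j, (j < M)%N -> f (b j + tau) <= c].
Proof.
move=> cf f0 fS h0 c0 hc; apply: contrapT => hn.
have mf : measurable_fun setT f by apply: continuous_measurable_fun.
have mfb j : measurable_fun setT (fun x : R => f (b j + x)).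
  apply: continuous_measurable_fun => x; apply: continuous_comp; last exact: cf.
  by apply: cvgD; [exact: cvg_cst|exact: cvg_id].
have ge_c tau : 0 <= tau -> tau <= h -> c <= \sum_(j < M) f (b j + tau).
  move=> t0 th; rewrite leNgt; apply/negP => lt_c; apply: hn.
  exists tau; split => // j jM; apply: le_trans (ltW lt_c).
  by rewrite (bigD1 (Ordinal jM)) //= lerDl sumr_ge0.
have : ((c * h)%:E <= (M%:R * S)%:E)%E; last by rewrite lee_fin; lra.
apply: (@le_trans _ _ (\int[mu]_(x in `[0%R, h]) (\sum_(j < M) (f (b j + x))%:E))%E).
  have -> : (c * h)%:E = (\int[mu]_(x in `[0%R, h]) c%:E)%E.
    by rewrite integral_cst //= lebesgue_measure_itv /= lte_fin h0 oppr0 adde0.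
  apply: ge0_le_integral => //.
  - by apply: emeasurable_sum => j; apply/measurable_EFinP; exact: (measurable_funTS (mfb j)).
  - by move=> x /=; rewrite in_itv /= => /andP[x0 xh]; rewrite sumEFin lee_fin ge_c.
rewrite ge0_integral_sum //; first last.
- by move=> j x _; rewrite lee_fin.
- by move=> j; apply/measurable_EFinP; exact: (measurable_funTS (mfb j)).
rewrite mulr_natl -[X in _ *+ X]card_ord -sumr_const -sumEFin; apply: lee_sum => j _.
rewrite integral_translate // -fS; apply: ge0_subset_integral => //.
  exact/measurable_EFinP.
by move=> x _; rewrite lee_fin.
Qed.

(** * Upper and lower bounds from the roots *)

Definition root_weight (R : realType) (tau s : R) (z : R[i]) : R :=
  gauge ((z - (tau%:C)%C) / (s%:C)%C).

Lemma toC_neq0 (R : realType) (s : R) : s != 0 -> (s%:C)%C != 0.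
Proof. by move=> s0; apply/eqP => -[] /eqP; rewrite (negbTE s0). Qed.

Lemma horner_roots (R : realType) (P : {poly R}) (c : R[i]) (r : seq R[i]) (t : R) :
  map_poly (toC R) P = c *: \prod_(z <- r) ('X - z%:P) ->
  `|P.[t]| = normc c * \prod_(z <- r) normc ((t%:C)%C - z).
Proof.
move=> e; rewrite -normc_real -horner_map e hornerZ ComplexField.Normc.normcM horner_prod.
by rewrite normc_prod; congr (_ * _); apply: eq_bigr => z _; rewrite hornerXsubC.
Qed.

Lemma nodes_prod_ge (R : realType) (P : {poly R}) (c : R[i]) (r : seq R[i]) (tau s : R) (N L : nat) :
  map_poly (toC R) P = c *: \prod_(z <- r) ('X - z%:P) -> 0 < s -> (0 < N)%N -> (0 < L)%N ->
  exists2 B : {set 'I_L}, (#|B| <= 2 * size r)%N & forall i : 'I_L, i \notin B ->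
    (normc c * (\prod_(z <- r) root_weight tau s z) * (s / 2) ^+ size r) ^+ N /
       (16 * L%:R ^+ 2) ^+ size r <=
    \prod_(k < N) `|P.[tau + s * qnode R (N * L) (i + L * k)]|.
Proof.
move=> e s0 N0 L0.
pose y z := (z - (tau%:C)%C) / (s%:C)%C.
have [B hB hgood] := good_residues [seq y z | z <- r] N0 L0.
rewrite size_map in hB; exists B => // i iB.
have L1 : (1:R) <= L%:R by rewrite ler1n.
have L16 : 0 < 16 * L%:R ^+ 2 :> R by nra.
under [leRHS]eq_bigr => k _ do rewrite (horner_roots _ e).
rewrite big_split /= prodr_const card_ord exchange_big /=.
have hz z : z \in r -> (root_weight tau s z * (s / 2)) ^+ N / (16 * L%:R ^+ 2) <=
    \prod_(k < N) normc (((tau + s * qnode R (N * L) (i + L * k))%:C)%C - z).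
  move=> zr; have /(_ (y z)) := hgood i iB; rewrite map_f // => /(_ isT) h.
  have e1 (k : 'I_N) : normc (((tau + s * qnode R (N * L) (i + L * k))%:C)%C - z) =
     s * normc (y z - ((qnode R (N * L) (i + L * k))%:C)%C).
    set x := qnode _ _ _.
    rewrite -{2}(ger0_norm (ltW s0)) -normc_real -ComplexField.Normc.normcM normc_distC.
    have sC : (s%:C)%C != 0 by apply: toC_neq0; rewrite gt_eqF.
    have -> : ((tau + s * x)%:C)%C = (tau%:C)%C + (s%:C)%C * (x%:C)%C.
      by apply/eqP; rewrite eq_complex /=; apply/andP; split; apply/eqP; ring.
    by congr (normc _); rewrite /y; field.
  rewrite (eq_bigr _ (fun k _ => e1 k)) big_split /= prodr_const card_ord.
  have -> : (root_weight tau s z * (s / 2)) ^+ N / (16 * L%:R ^+ 2) =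
     s ^+ N * ((gauge (y z) / 2) ^+ N / (16 * L%:R ^+ 2)).
    by rewrite [RHS]mulrA -exprMn /root_weight -/(y z); congr (_ ^+ _ / _); ring.
  by rewrite ler_wpM2l // exprn_ge0 // ltW.
apply: (@le_trans _ _ (normc c ^+ N * \prod_(z <- r) ((root_weight tau s z * (s / 2)) ^+ N / (16 * L%:R ^+ 2)))).
  have -> : \prod_(z <- r) ((root_weight tau s z * (s / 2)) ^+ N / (16 * L%:R ^+ 2)) =
     ((\prod_(z <- r) root_weight tau s z) * (s / 2) ^+ size r) ^+ N / (16 * L%:R ^+ 2) ^+ size r.
    have : 16 * L%:R ^+ 2 != 0 :> R by rewrite gt_eqF.
    move: (16 * L%:R ^+ 2) => q q0; elim: (r) => [|z r' IH]; first by rewrite !big_nil mul1r !expr0 expr1n divr1.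
    rewrite !big_cons IH /= !exprS !exprMn; field.
    by rewrite expf_neq0 q0.
  by rewrite [leRHS]mulrA -exprMn [normc c * (_ * _)]mulrA.
rewrite ler_wpM2l ?exprn_ge0 ?normc_ge0 //.
rewrite big_seq [leRHS]big_seq; apply: ler_prod => z zr; apply/andP; split; last exact: hz.
by rewrite divr_ge0 ?exprn_ge0 ?mulr_ge0 ?divr_ge0 ?(ltW s0) ?(ltW L16) ?(ltW (gauge_gt0 _)).
Qed.

(** Pigeonhole over the classes outside B: their sums add up to at most the total because f >= 0, so
    one of them is at most the mean. *)
Lemma exists_good_residue (R : realType) (f : nat -> R) (N L : nat) (B : {set 'I_L}) :
  (forall j, 0 <= f j) -> (#|B| < L)%N ->
  exists2 i : 'I_L, i \notin B &
   (L%:R - #|B|%:R) * (\sum_(k < N) f (i + L * k)%N) <= \sum_(j < N * L) f j.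
Proof.
move=> f0 BL.
have tot : \sum_(j < N * L) f j = \sum_(i < L) \sum_(k < N) f (i + L * k)%N.
  rewrite sum_blocks exchange_big /=; apply: eq_bigr => i _; apply: eq_bigr => k _.
  by rewrite addnC mulnC.
apply: contrapT => hn.
have hlt (i : 'I_L) : i \notin B ->
    \sum_(j < N * L) f j < (L%:R - #|B|%:R) * (\sum_(k < N) f (i + L * k)%N).
  by move=> iB; rewrite ltNge; apply/negP => h; apply: hn; exists i.
have cB : (#|~: B| = L - #|B|)%N by rewrite cardsCs finset.setCK card_ord.
set S := \sum_(j < N * L) f j in tot hlt.
have [i0 i0B] : exists i0, i0 \in (~: B)%SET.
  by apply/set0Pn; rewrite -card_gt0 cB subn_gt0.
have BL0 : 0 < L%:R - #|B|%:R :> R by rewrite subr_gt0 ltr_nat.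
have : \sum_(i in (~: B)%SET) S <
    \sum_(i in (~: B)%SET) ((L%:R - #|B|%:R) * (\sum_(k < N) f (i + L * k)%N)).
  rewrite (bigD1 i0) //= [ltRHS](bigD1 i0) //=; apply: ltr_leD.
    by apply: hlt; move: i0B; rewrite finset.inE.
  by apply: ler_sum => i /andP[iB _]; apply/ltW/hlt; move: iB; rewrite finset.inE.
rewrite sumr_const cB -mulr_sumr -[_ *+ _]mulr_natl natrB ?(ltnW BL) // ltr_pM2l //.
apply/negP; rewrite -leNgt tot [leRHS](bigID (fun i => i \in (~: B)%SET)) /= lerDl.
by apply: sumr_ge0 => i _; apply: sumr_ge0 => k _.
Qed.

(** At most 2n of the L classes are bad, a proportion of 1/(2(n + 1)), so restricting to a good
    class costs only the factor 1 + 1/n in the mean. The factor 4 in L fits the quadrature. Taking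
    the n-th root leaves a polynomial factor. *)
Lemma root_weight_le (R : realType) (P : {poly R}) (c : R[i]) (r : seq R[i]) (tau s G : R)
  (F : R -> R) (n : nat) :
  let L := (4 * (n * n.+1))%N in
  map_poly (toC R) P = c *: \prod_(z <- r) ('X - z%:P) -> 0 < s -> (0 < n)%N -> (size r <= n)%N ->
  1 <= G -> (forall t, 0 <= F t) ->
  (forall j, (j < n * L)%N -> `|P.[tau + s * qnode R (n * L) j]| <=
       G * expR (F (tau + s * qnode R (n * L) j))) ->
  normc c * (\prod_(z <- r) root_weight tau s z) * (s / 2) ^+ size r <=
   16 * L%:R ^+ 2 * G * expR ((1 + n%:R^-1) * node_mean (n * L) (fun x => F (tau + s * x))).
Proof.
move=> L e s0 n0 rn G1 F0 hP.
have L0 : (0 < L)%N by rewrite !muln_gt0 n0.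
have L1 : (1:R) <= L%:R by rewrite ler1n.
have L16 : 1 <= 16 * L%:R ^+ 2 :> R by nra.
have n0' : (0 : R) < n%:R by rewrite ltr0n.
have [B hB hgood] := nodes_prod_ge tau e s0 n0 L0.
have B2n : (#|B| <= 2 * n)%N by apply: leq_trans hB _; rewrite leq_mul2l rn orbT.
have BL : (#|B| < L)%N by apply: leq_ltn_trans B2n _; rewrite /L; nia.
pose t j := tau + s * qnode R (n * L) j.
have [i iB hi] := @exists_good_residue R (fun j => F (t j)) n L B (fun j => F0 _) BL.
have := hgood i iB; set X := _ * (s / 2) ^+ size r => hX.
have X0 : 0 <= X.
  rewrite mulr_ge0 ?exprn_ge0 ?divr_ge0 ?(ltW s0) // mulr_ge0 ?normc_ge0 //.
  by apply: prodr_ge0 => z _; exact: ltW (gauge_gt0 _).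
have kn (k : 'I_n) : (i + L * k < n * L)%N.
  have h1 : (k.+1 * L <= n * L)%N by rewrite leq_mul2r (ltn_ord k) orbT.
  apply: leq_trans h1; rewrite mulSn [(L * k)%N]mulnC ltn_add2r; exact: ltn_ord.
set SF := \sum_(k < n) F (t (i + L * k)%N) in hi.
have up : X ^+ n <= (16 * L%:R ^+ 2) ^+ n * (G ^+ n * expR SF).
  have h1 : X ^+ n <= (16 * L%:R ^+ 2) ^+ size r * \prod_(k < n) `|P.[t (i + L * k)%N]|.
    by rewrite mulrC -ler_pdivrMr // exprn_gt0 //; lra.
  apply: le_trans h1 _; apply: ler_pM.
  - by rewrite exprn_ge0 //; lra.
  - by apply: prodr_ge0 => k _; exact: normr_ge0.
  - by rewrite ler_weXn2l.
  - apply: (@le_trans _ _ (\prod_(k < n) (G * expR (F (t (i + L * k)%N))))).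
      by apply: ler_prod => k _; rewrite normr_ge0 hP.
    by rewrite big_split /= prodr_const card_ord expR_sum.
have eSF : expR SF = expR (SF / n%:R) ^+ n by rewrite -expRM_natl mulrCA mulfV ?mulr1 // gt_eqF.
rewrite eSF mulrA -!exprMn in up.
have {up} up : X <= 16 * L%:R ^+ 2 * G * expR (SF / n%:R).
  move: up; rewrite ler_pXn2r ?nnegrE // !mulr_ge0 ?expR_ge0 //; lra.
apply: le_trans up _; rewrite ler_wpM2l //; first by apply: mulr_ge0; lra.
rewrite ler_expR /node_mean natrM.
have SF0 : 0 <= SF by apply: sumr_ge0.
have B2 : (#|B|%:R : R) <= 2 * n%:R by rewrite -natrM ler_nat.
have LE : L%:R = 4 * (n%:R * (n%:R + 1)) :> R by rewrite /L !natrM natr1.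
set TT := \sum_(j < n * L) _; rewrite -/TT in hi.
have iE : n%:R^-1 * n%:R = 1 :> R by rewrite mulVf // gt_eqF.
have i0 : 0 < n%:R^-1 :> R by rewrite invr_gt0.
have h1 : L%:R <= (L%:R - #|B|%:R) * (1 + n%:R^-1) :> R.
  have h2 : (L%:R - 2 * n%:R) * (1 + n%:R^-1) <= (L%:R - #|B|%:R) * (1 + n%:R^-1) :> R.
    by rewrite ler_wpM2r //; lra.
  apply: le_trans h2; rewrite LE.
  have -> : (4 * (n%:R * (n%:R + 1)) - 2 * n%:R) * (1 + n%:R^-1) =
    4 * (n%:R * (n%:R + 1)) - 2 * n%:R + (4 * (n%:R + 1) - 2) * (n%:R^-1 * n%:R) :> R by ring.
  rewrite iE; lra.
have L0' : (0 : R) < L%:R by lra.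
have h3 : SF * L%:R <= (1 + n%:R^-1) * TT.
  apply: (@le_trans _ _ (SF * ((L%:R - #|B|%:R) * (1 + n%:R^-1)))); first by rewrite ler_wpM2l.
  have -> : SF * ((L%:R - #|B|%:R) * (1 + n%:R^-1)) = (1 + n%:R^-1) * ((L%:R - #|B|%:R) * SF) by ring.
  by rewrite ler_wpM2l //; lra.
rewrite invfM [(1 + _) * _]mulrCA -mulrA [leLHS]mulrC ler_wpM2l ?(ltW i0) //.
by rewrite ler_pdivlMl // mulrC.
Qed.

Lemma normc_root_le (R : realType) (tau s x : R) (z : R[i]) : 0 < s -> s <= 1 -> 0 <= tau -> tau <= 1 ->
  normc z <= 2 * root_weight tau s z.
Proof.
move=> s0 s1 t0 t1.
have sC : (s%:C)%C != 0 by apply: toC_neq0; rewrite gt_eqF.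
have -> : z = (s%:C)%C * ((z - (tau%:C)%C) / (s%:C)%C) + (tau%:C)%C by field.
rewrite /root_weight addrK mulrAC mulfV // mul1r; set y := _ / _.
have g1 := gauge_ge1 y; have yg := normc_le_gauge y.
apply: le_trans (normc_le_add _ _) _; rewrite ComplexField.Normc.normcM !normc_real.
rewrite !ger0_norm // ?(ltW s0) //; have := normc_ge0 y; nra.
Qed.

(** A root of weight w >= 1 contributes at most rho + 2w <= (rho + 2) w. For w >= W0 this last step
    is wasteful by the factor 1/w + 2/rho <= theta, and the waste is what counts the roots of large
    gauge. *)
Lemma pnorm_roots_le (R : realType) (P : {poly R}) (c : R[i]) (r : seq R[i]) (tau s rho W0 theta : R) :
  map_poly (toC R) P = c *: \prod_(z <- r) ('X - z%:P) ->
  0 < s -> s <= 1 -> 0 <= tau -> tau <= 1 -> 0 < rho -> 0 < W0 -> W0^-1 + 2 / rho <= theta ->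
  theta <= 1 ->
  pnorm rho P <= (rho + 2) ^+ size r * (normc c * \prod_(z <- r) root_weight tau s z) *
    theta ^+ count (fun z => W0 <= root_weight tau s z) r.
Proof.
move=> e s0 s1 t0 t1 rho0 W00 hth th1.
have ir0 : 0 < rho^-1 by rewrite invr_gt0.
have rE : rho * rho^-1 = 1 by rewrite mulfV // gt_eqF.
have iW0 : 0 < W0^-1 by rewrite invr_gt0.
have th0 : 0 < theta by lra.
rewrite -cpnorm_map e; apply: le_trans (cpnorm_prod _ _ (ltW rho0)) _.
rewrite mulrCA -!mulrA ler_wpM2l ?normc_ge0 // {e}.
elim: r => [|z r IH]; first by rewrite !big_nil !expr0 !mulr1.
rewrite !big_cons /= exprS exprD; set w := root_weight tau s z.
have g1 : 1 <= w := gauge_ge1 _.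
have h : rho + normc z <= (rho + 2) * w * theta ^+ (W0 <= w)%R.
  have hz := normc_root_le 0 z s0 s1 t0 t1; rewrite -/w in hz.
  case: (leP W0 w) => hw; rewrite ?expr1 ?expr0; last by nra.
  have h1 : w^-1 <= W0^-1 by rewrite lef_pV2 ?posrE //; lra.
  have wE : w * w^-1 = 1 by rewrite mulfV // gt_eqF //; lra.
  have h2 : rho + 2 * w = rho * w * (w^-1 + 2 / rho).
    have -> : rho * w * (w^-1 + 2 / rho) = rho * (w * w^-1) + 2 * w * (rho * rho^-1) by ring.
    by rewrite wE rE !mulr1.
  have h3 : rho * w * (w^-1 + 2 / rho) <= rho * w * theta by rewrite ler_wpM2l ?mulr_ge0 //; lra.
  have h4 : 0 <= w * theta by rewrite mulr_ge0; lra.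
  have -> : (rho + 2) * w * theta = rho * w * theta + 2 * (w * theta) by ring.
  lra.
have -> : (rho + 2) * (rho + 2) ^+ size r * (w * \prod_(j <- r) root_weight tau s j *
    (theta ^+ (W0 <= w)%R * theta ^+ count (fun z0 => W0 <= root_weight tau s z0) r)) =
   ((rho + 2) * w * theta ^+ (W0 <= w)%R) * ((rho + 2) ^+ size r * (\prod_(j <- r) root_weight tau s j *
    theta ^+ count (fun z0 => W0 <= root_weight tau s z0) r)) by ring.
apply: ler_pM => //; first by rewrite addr_ge0 ?normc_ge0 // ltW.
by apply: prodr_ge0 => u _; rewrite addr_ge0 ?normc_ge0 // ltW.
Qed.

Lemma pow_le_exp (R : realType) (C eta : R) (k : nat) : 0 < eta ->
  \forall n \near \oo, C * n%:R ^+ k <= expR (eta * n%:R).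
Proof.
move=> e0; have k0 : (0 : R) < k.+1%:R by rewrite ltr0n.
pose q := eta / k.+1%:R.
have q0 : 0 < q by rewrite divr_gt0.
have hc : \forall n \near \oo, C / q ^+ k.+1 < n%:R by exact: nbhs_infty_gtr.
apply: filterS hc => n; rewrite ltr_pdivrMr ?exprn_gt0 // => hn.
have -> : eta * n%:R = k.+1%:R * (q * n%:R) by rewrite mulrA mulrC [k.+1%:R * q]mulrC divfK ?gt_eqF // mulrC.
rewrite expRM_natl.
have h : (q * n%:R) ^+ k.+1 <= expR (q * n%:R) ^+ k.+1.
  have h1 : 0 <= q * n%:R by rewrite mulr_ge0 // ltW.
  have h2 : q * n%:R <= expR (q * n%:R) by have := expR_ge1Dx (q * n%:R); lra.
  by rewrite lerXn2r // nnegrE // expR_ge0.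
apply: le_trans h; rewrite exprMn [n%:R ^+ k.+1]exprS mulrA ler_wpM2r ?exprn_ge0 //.
by rewrite mulrC ltW.
Qed.

(** Bernoulli's inequality with an integer exponent m >= alpha, applied to the ratio u / (u + h). *)
Lemma powR_shift_le (R : realType) (alpha u h : R) : 1 < alpha -> 0 <= u -> u <= 1 -> 0 <= h -> h <= 1 ->
  (u + h) `^ alpha <= u `^ alpha + (Num.truncn alpha).+1%:R * 2 `^ alpha * h.
Proof.
move=> a1 u0 u1 h0 h1; set m := (Num.truncn alpha).+1.
have am : alpha <= m%:R by rewrite ltW // truncnS_gt.
have a0 : alpha != 0 by rewrite gt_eqF //; lra.
have [v0|v0] := leP (u + h) 0.
  have -> : u + h = 0 by lra.
  by rewrite powR0 // addr_ge0 ?powR_ge0 // !mulr_ge0 ?powR_ge0.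
set v := u + h in v0 *; pose x := u / v.
have x0 : 0 <= x by rewrite divr_ge0 // ltW.
have x1 : x <= 1 by rewrite ler_pdivrMr // mul1r /v; lra.
have uE : u = x * v by rewrite /x divfK // gt_eqF.
have bern k : 1 - x ^+ k <= k%:R * (1 - x).
  elim: k => [|k IH]; first by rewrite expr0 mul0r subrr.
  have := exprn_ile1 k x0 x1; rewrite exprS -natr1; nra.
have xa : x ^+ m <= x `^ alpha.
  have [x00|xpos] := leP x 0.
    have xz : x = 0 by apply/eqP; rewrite eq_le x00 x0.
    by rewrite xz expr0n /= powR0.
  rewrite -powR_mulrn // /powR gt_eqF // ler_expR.
  have := ln_le0 x1; nra.
have vp := powR_ge0 v alpha.
have hb := bern m.
have vE : v `^ alpha = v * v `^ (alpha - 1) by rewrite mulr_powRB1 //; lra.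
have xv : v * (1 - x) = h by rewrite mulrBr mulr1 [v * x]mulrC -uE /v; ring.
have v2 : v `^ (alpha - 1) <= 2 `^ alpha.
  apply: (@le_trans _ _ (2 `^ (alpha - 1))).
    by apply: ge0_ler_powR; rewrite ?nnegrE /v; lra.
  by apply: ler_powR; lra.
have vp' := powR_ge0 v (alpha - 1).
have -> : u `^ alpha = x `^ alpha * v `^ alpha by rewrite {1}uE powRM // ltW.
have m0 : (0 : R) <= m%:R by [].
have : v `^ alpha * (1 - x `^ alpha) <= v `^ alpha * (m%:R * (1 - x)).
  by rewrite ler_wpM2l //; lra.
have -> : v `^ alpha * (m%:R * (1 - x)) = m%:R * v `^ (alpha - 1) * h by rewrite vE -xv; ring.
have : m%:R * v `^ (alpha - 1) * h <= m%:R * 2 `^ alpha * h by rewrite ler_wpM2r // ler_wpM2l.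
lra.
Qed.

(** By regular variation the mean is about Q(a_n) s^alpha times the mean of |x|^alpha, which
    [power_mean_asymp] turns into n s^alpha / alpha. A shift of at most 1/n enters through
    [powR_shift_le]. *)
Lemma mean_shift_le (R : realType) (Q : R -> R) (alpha Lam : R) (a : nat -> R) (eta : R) :
  regular_weight Q alpha Lam -> MRS_numbers Q a -> 0 < eta ->
  \forall n \near \oo, forall m tau s, (n <= m)%N -> 0 < s -> s <= 1 -> 0 <= tau -> tau <= n%:R^-1 ->
    node_mean (4 * m) (fun x => Q (a n * (tau + s * x))) <= n%:R * (s `^ alpha / alpha + eta).
Proof.
move=> W HM e0; have al1 := rw_alpha W; have al0 : 0 < alpha by lra.
have [C C0 hC] := Q_div_bounded W HM.
have e3 : 0 < eta / 3 by rewrite divr_gt0.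
have two1 : (1 : R) <= 2 by lra.
have hq := Q_unif W HM two1 e3.
have hm := power_mean_asymp W HM e3.
pose D := (Num.truncn alpha).+1%:R * 2 `^ alpha.
have D0 : 0 <= D by rewrite mulr_ge0 ?powR_ge0.
have hD : \forall n \near \oo, C * D / (eta / 3) < n%:R by exact: nbhs_infty_gtr.
apply: filterS3 (filterI (nbhs_infty_gt 0) hC) (filterI hq hm) hD.
move=> n [n0 hc] [hqn hmn] hDn m tau s nm s0 s1 t0 t1.
have n0' : (0 : R) < n%:R by rewrite ltr0n.
have n1 : n%:R^-1 <= 1 :> R by rewrite invf_le1 // ler1n.
have M0 : (0 < 4 * m)%N by rewrite muln_gt0 /=; exact: leq_trans n0 nm.
have c0 := Q_div_gt0 W HM n0.
set c := Q (a n) / n%:R in hqn hmn hc c0.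
have := hmn _ nm; set mu1 := node_mean _ _ => hmu.
have pt j : let x := qnode R (4 * m) j in
    Q (a n * (tau + s * x)) <= n%:R * (c * s `^ alpha) * `|x| `^ alpha + n%:R * (c * D * n%:R^-1 + eta / 3).
  move=> x; have x1 : `|x| <= 1 := qnode_le1 _ _ _.
  have ux : `|tau + s * x| <= s * `|x| + n%:R^-1.
    apply: le_trans (ler_normD _ _) _; rewrite (ger0_norm t0) normrM (ger0_norm (ltW s0)); lra.
  have sx0 : 0 <= s * `|x| by rewrite mulr_ge0 ?(ltW s0).
  have sx1 : s * `|x| <= 1 by have := normr_ge0 x; nra.
  have u2 : `|tau + s * x| <= 2 by lra.
  have i0 : 0 <= n%:R^-1 :> R by rewrite invr_ge0 ltW.
  have := hqn _ u2; rewrite ler_norml => /andP[_ h].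
  have h1 : Q (a n * (tau + s * x)) = n%:R * (Q (a n * (tau + s * x)) / n%:R).
    by rewrite mulrCA mulfV ?mulr1 // gt_eqF.
  have h2 : `|tau + s * x| `^ alpha <= s `^ alpha * `|x| `^ alpha + D * n%:R^-1.
    apply: (@le_trans _ _ ((s * `|x| + n%:R^-1) `^ alpha)).
      by apply: ge0_ler_powR; rewrite ?nnegrE ?addr_ge0 ?(ltW al0).
    by rewrite -powRM ?(ltW s0) // powR_shift_le.
  rewrite h1 -[n%:R * (c * _) * _]mulrA -mulrDr ler_wpM2l ?(ltW n0') //.
  have : c * `|tau + s * x| `^ alpha <= c * (s `^ alpha * `|x| `^ alpha + D * n%:R^-1).
    by rewrite ler_wpM2l // ltW.
  lra.
apply: (@le_trans _ _ (node_mean (4 * m) (fun x => n%:R * (c * s `^ alpha) * `|x| `^ alpha + n%:R * (c * D * n%:R^-1 + eta / 3)))).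
  exact: node_mean_le pt.
have -> : node_mean (4 * m) (fun x => n%:R * (c * s `^ alpha) * `|x| `^ alpha + n%:R * (c * D * n%:R^-1 + eta / 3)) =
   n%:R * (c * s `^ alpha) * mu1 + n%:R * (c * D * n%:R^-1 + eta / 3).
  rewrite -node_meanZ -[X in _ = _ + X](node_mean_cst _ M0) /node_mean -mulrDr -big_split //.
have -> : n%:R * (c * s `^ alpha) * mu1 = n%:R * (s `^ alpha * (c * mu1)) by ring.
rewrite -mulrDr ler_wpM2l ?(ltW n0') //.
have sp := powR_ge0 s alpha.
have sp1 : s `^ alpha <= 1 by apply: powR_le1; lra.
have h1 : c * mu1 <= alpha^-1 + eta / 3.
  move: hmu; rewrite ler_norml => /andP[_ hmu].
  have : c * mu1 <= (1 + eta / 3) / alpha by rewrite ler_pdivlMr //; lra.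
  have : eta / 3 / alpha <= eta / 3 by rewrite ler_pdivrMr // ler_peMr ?ltW.
  rewrite [(1 + _) / _]mulrDl mul1r; lra.
have h2 : s `^ alpha * (c * mu1) <= s `^ alpha * (alpha^-1 + eta / 3) by rewrite ler_wpM2l.
have h3 : c * D * n%:R^-1 <= eta / 3.
  rewrite ler_pdivrMr //; move: hDn; rewrite ltr_pdivrMr //.
  have : c * D <= C * D by rewrite ler_wpM2r.
  lra.
have h4 : s `^ alpha * (eta / 3) <= eta / 3 by rewrite ler_piMl // ltW.
lra.
Qed.

(** * Bounds for the random polynomial with controlled coefficients *)

Lemma rand_polyE (R : realType) (p : nat -> {poly R}) (a : nat -> R) (c : nat -> R) (n : nat) :
  rand_poly p a c n = psum p n.+1 c \Po (a n *: 'X).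
Proof.
rewrite /rand_poly /psum raddf_sum /=; apply: eq_bigr => j _.
by rewrite comp_polyZ mul_polyC.
Qed.

Lemma size_rand_poly (R : realType) (W : R -> R) (p : nat -> {poly R}) (a : nat -> R) (c : nat -> R) (n : nat) :
  orthonormal_polys W p -> (size (rand_poly p a c n) <= n.+1)%N.
Proof.
move=> op; rewrite /rand_poly (leq_trans (size_sum _ _ _)) //; apply/bigmax_leqP => j _.
rewrite mul_polyC (leq_trans (size_scale_leq _ _)) // (leq_trans (size_comp_poly_leq _ _)) //.
have [-> _ _ _] := op j j; rewrite ltnS.
have h : ((size (a n *: 'X : {poly R})).-1 <= 1)%N.
  by rewrite -subn1 leq_subLR (leq_trans (size_scale_leq _ _)) // size_polyX.
by rewrite (leq_trans (leq_mul (leqnn _) h)) // muln1 /= -ltnS; exact: ltn_ord.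
Qed.

Lemma horner_rand_poly (R : realType) (p : nat -> {poly R}) (a : nat -> R) (c : nat -> R) (n : nat) t :
  (rand_poly p a c n).[t] = (psum p n.+1 c).[a n * t].
Proof. by rewrite rand_polyE horner_comp hornerZ hornerX. Qed.

Lemma continuous_weight_sqr (R : realType) (Q : R -> R) (alpha Lam : R) :
  regular_weight Q alpha Lam -> continuous (fun x => expR (- Q x) ^+ 2).
Proof.
move=> W; have cQ : continuous (fun x => expR (- Q x)).
  move=> x; apply: continuous_comp; last exact: continuous_expR.
  apply: continuousN; apply: differentiable_continuous; apply/derivable1_diffP.
  exact: (rw_derivable W).
have -> : (fun x => expR (- Q x) ^+ 2) = (fun x => expR (- Q x) * expR (- Q x)).
  by apply/funext => x; rewrite expr2.
by move=> x; apply: cvgM; exact: cQ.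
Qed.

Lemma roots_upper (R : realType) (Q : R -> R) (p : nat -> {poly R}) (alpha Lam : R) (a : nat -> R) (eta : R) :
  regular_weight Q alpha Lam -> MRS_numbers Q a -> orthonormal_polys (fun x => expR (- Q x)) p ->
  0 < eta ->
  \forall n \near \oo, forall (c : nat -> R) (lc : R[i]) (r : seq R[i]) (s : R),
    (forall j, (j < n.+1)%N -> `|c j| <= n%:R ^+ 2) ->
    map_poly (toC R) (rand_poly p a c n) = lc *: \prod_(z <- r) ('X - z%:P) -> (size r <= n)%N ->
    0 < s -> s <= 1 ->
    exists tau, [/\ 0 <= tau, tau <= n%:R^-1 &
      normc lc * (\prod_(z <- r) root_weight tau s z) * (s / 2) ^+ size r <=
        expR (n%:R * (s `^ alpha / alpha + eta))].
Proof.
move=> W HM op e0; have al1 := rw_alpha W; have al0 : 0 < alpha by lra.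
pose e3 := Num.min 1 (eta / 3).
have e30 : 0 < e3 by rewrite lt_min ltr01 divr_gt0.
have e31 : e3 <= 1 by rewrite ge_min lexx.
have e32 : e3 <= eta / 3 by rewrite ge_min lexx orbT.
move: e3 e30 e31 e32 => e3 e30 e31 e32.
have ha1 := MRS_cvg_pinfty W HM 1.
have hms := mean_shift_le W HM e30.
(* The power 12 and its constant bound 16 L^2 G below; exp 2 pays for the factor 1 + 1/n in the
   exponent. *)
have hpe := pow_le_exp ((17 * 16 ^+ 2 * 8) * expR 2) 12 e30.
apply: filterS3 (filterI (nbhs_infty_gt 0) ha1) hms hpe => n [n0 an1] hmsn hpn.
move=> c lc r s hc hP rn s0 s1.
have n0' : (0 : R) < n%:R by rewrite ltr0n.
have n1 : (1 : R) <= n%:R by rewrite ler1n.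
have a0 : 0 < a n by lra.
set nn : R := n%:R in n0' n1 *.
pose L := (4 * (n * n.+1))%N.
have LE : L%:R = 4 * (nn * (nn + 1)) :> R by rewrite /L !natrM natr1.
(* There are 4 n^2 (n + 1) nodes and the total mass is n + 1, which makes at most 16 n^4, while the
   shifts fill a length a_n / n >= 1/n. *)
pose c0 : R := 17 * nn ^+ 5.
have c01 : 1 <= c0 by have := exprn_ege1 5 n1; rewrite /c0; lra.
pose f x := christoffel p n.+1 x * expR (- Q x) ^+ 2.
have cf : continuous f.
  move=> x; apply: continuousM; first exact: continuous_christoffel.
  exact: continuous_weight_sqr W x.
have f0 x : 0 <= f x by rewrite mulr_ge0 ?christoffel_ge0 // exprn_ge0 // expR_ge0.
have fS := christoffel_integral op n.+1.
have hlt : (n * L)%:R * n.+1%:R < c0 * (a n / nn).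
  have : c0 / nn <= c0 * (a n / nn).
    by rewrite mulrA ler_wpM2r ?invr_ge0 ?(ltW n0') // ler_peMr //; lra.
  apply: lt_le_trans.
  rewrite ltr_pdivlMr // natrM LE -natr1 -/nn /c0.
  have : nn * (4 * (nn * (nn + 1))) * (nn + 1) * nn <= nn * (4 * (nn * (nn + nn))) * (nn + nn) * nn.
    rewrite ler_wpM2r ?(ltW n0') //; apply: ler_pM; [|lra| |lra].
      by rewrite !mulr_ge0 //; lra.
    by rewrite ler_wpM2l ?(ltW n0') // ler_wpM2l // ler_wpM2l ?(ltW n0') //; lra.
  have -> : nn * (4 * (nn * (nn + nn))) * (nn + nn) * nn = 16 * nn ^+ 5 by ring.
  have : 0 < nn ^+ 5 by rewrite exprn_gt0.
  lra.
(* The Christoffel function has total mass n + 1 against W^2, so some translate of the nodes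
   avoids its peaks; at such nodes the polynomial is at most a power of n times 1/W. *)
have [taux [tx0 txh htau]] := exists_good_shift (fun j => a n * (s * qnode R (n * L) j)) cf f0 fS
   (divr_gt0 a0 n0') (le_trans ler01 c01) hlt.
pose tau := taux / a n.
exists tau.
have tE : taux = a n * tau by rewrite /tau mulrCA mulfV ?mulr1 // gt_eqF.
have t0 : 0 <= tau by rewrite divr_ge0 // ltW.
have t1 : tau <= nn^-1 by rewrite /tau ler_pdivrMr // mulrC.
split => //.
(* The number of terms, the bound for the coefficients, and [c0], which is at least 1 and so also
   bounds its own square root. *)
pose G := (nn + 1) * nn ^+ 2 * c0.
have nn2 : 1 <= nn ^+ 2 := exprn_ege1 2 n1.
have G1 : 1 <= G by rewrite /G !mulr_ege1 //; lra.
have hnode j : (j < n * L)%N -> `|(rand_poly p a c n).[tau + s * qnode R (n * L) j]| <=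
    G * expR (Q (a n * (tau + s * qnode R (n * L) j))).
  move=> jL; rewrite horner_rand_poly.
  have xE : a n * (tau + s * qnode R (n * L) j) = a n * (s * qnode R (n * L) j) + taux.
    by rewrite tE; ring.
  rewrite xE; set x := _ + taux; have fx := htau j jL; rewrite -/x in fx.
  apply: le_trans (psum_le_christoffel p x (exprn_ge0 2 (ltW n0')) hc) _.
  rewrite -[n.+1%:R]natr1 -/nn /G -[leRHS]mulrA; apply: ler_wpM2l; first by rewrite mulr_ge0 //; lra.
  have K0 := christoffel_ge0 p n.+1 x.
  have h1 : Num.sqrt (christoffel p n.+1 x) * expR (- Q x) <= c0.
    have -> : Num.sqrt (christoffel p n.+1 x) * expR (- Q x) = Num.sqrt (f x).
      by rewrite /f sqrtrM // sqrtr_sqr ger0_norm // expR_ge0.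
    apply: le_trans (ler_wsqrtr fx) _; rewrite -[leRHS]ger0_norm; last lra.
    by rewrite -sqrtr_sqr; apply: ler_wsqrtr; rewrite expr2; nra.
  have -> : Num.sqrt (christoffel p n.+1 x) = Num.sqrt (christoffel p n.+1 x) * expR (- Q x) * expR (Q x).
    by rewrite -mulrA -expRD addNr expR0 mulr1.
  by apply: ler_wpM2r => //; exact: expR_ge0.
apply: le_trans (root_weight_le hP s0 n0 rn G1 (fun t => rw_ge0 W (a n * t)) hnode) _.
have e4 : (n * L)%N = (4 * (n * (n * n.+1)))%N by rewrite /L mulnCA.
rewrite -/L e4.
have nm : (n <= n * (n * n.+1))%N by rewrite leq_pmulr // muln_gt0 n0.
have := hmsn _ tau s nm s0 s1 t0 t1; set mn := node_mean _ _; rewrite -/nn => hmn.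
have sp1 : s `^ alpha <= 1 by apply: powR_le1; lra.
have sp := powR_ge0 s alpha.
set sa := s `^ alpha / alpha in hmn *.
have sa1 : sa <= 1 by rewrite /sa ler_pdivrMr //; lra.
have ex : (1 + nn^-1) * mn <= nn * (sa + e3) + 2.
  apply: (@le_trans _ _ ((1 + nn^-1) * (nn * (sa + e3)))).
    by rewrite ler_wpM2l // addr_ge0 // invr_ge0 ltW.
  by rewrite mulrDl mul1r mulKf ?gt_eqF //; lra.
have poly : 16 * L%:R ^+ 2 * G <= (17 * 16 ^+ 2 * 8) * nn ^+ 12.
  rewrite LE /G /c0.
  have h1 : (nn + 1) ^+ 3 <= (nn + nn) ^+ 3 by rewrite lerXn2r ?nnegrE //; lra.
  have -> : 16 * (4 * (nn * (nn + 1))) ^+ 2 * ((nn + 1) * nn ^+ 2 * (17 * nn ^+ 5)) =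
     (17 * 16 ^+ 2) * nn ^+ 9 * (nn + 1) ^+ 3 by ring.
  have -> : (17 * 16 ^+ 2 * 8) * nn ^+ 12 = (17 * 16 ^+ 2) * nn ^+ 9 * (nn + nn) ^+ 3 by ring.
  by rewrite ler_wpM2l // mulr_ge0 // exprn_ge0 // ltW.
apply: (@le_trans _ _ ((17 * 16 ^+ 2 * 8) * nn ^+ 12 * expR (nn * (sa + e3) + 2))).
  apply: ler_pM => //; rewrite ?expR_ge0 ?ler_expR //.
  by rewrite mulr_ge0 //; lra.
rewrite expRD mulrA mulrC mulrA [expR 2 * _]mulrA [expR 2 * _]mulrC.
apply: (@le_trans _ _ (expR (e3 * nn) * expR (nn * (sa + e3)))).
  by apply: ler_wpM2r => //; exact: expR_ge0.
rewrite -expRD ler_expR; nra.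
Qed.

Lemma integral_oneDsqr (R : realType) (B : R) : 0 <= B ->
  (\int[@lebesgue_measure R]_x (B * (oneDsqr x)^-1)%:E = (B * pi)%:E)%E.
Proof.
move=> B0; under eq_integral do rewrite EFinM.
have i0 (x : R) : 0 <= (oneDsqr x)^-1 by rewrite invr_ge0 (le_trans ler01) // oneDsqr_ge1.
have mf : measurable_fun setT (fun x : R => (oneDsqr x)^-1).
  exact: continuous_measurable_fun continuous_oneDsqrV.
rewrite ge0_integralZl_EFin //; last exact/measurable_EFinP.
rewrite ge0_symfun_integralT //; first last.
- by move=> x /=; rewrite /oneDsqr sqrrN.
- exact: continuous_oneDsqrV.
have -> : [set x : R | 0 <= x] = `[0, +oo[%classic.
  by apply/seteqP; split => x /=; rewrite in_itv /= andbT.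
rewrite integral0y_oneDsqr -!EFinM; congr EFin; by field.
Qed.

(* With P = H q + r, q the product over nu, the coefficient c_(n-k) of P is also that of H q
   since deg r < n - k, so Bessel's inequality bounds it by the weighted L2 norm of H q. *)
Lemma coef_le_pnorm_divp (R : realType) (Q : R -> R) (p : nat -> {poly R}) (alpha Lam : R) (a : nat -> R)
    (c : nat -> R) (nu : seq R) (n k K K1 : nat) (E rho : R) :
  regular_weight Q alpha Lam -> orthonormal_polys (fun x => expR (- Q x)) p ->
  1 <= a n -> 1 <= rho -> (size nu + K <= n)%N -> (n <= size nu + K1)%N -> (k < K)%N ->
  (forall t : R, (1 + t ^+ 2) * Num.max 1 `|t| ^+ (2 * K1) *
     (`|\prod_(v <- nu) (t - v)| * expR (- Q (a n * t))) ^+ 2 <= E) ->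
  c (n - k)%N ^+ 2 <= pnorm rho (rand_poly p a c n %/ \prod_(v <- nu) ('X - v%:P)) ^+ 2 * E * a n ^+ 2 * pi.
Proof.
move=> W op a1 r1 hK hK1 kK hE.
set P := rand_poly p a c n; set q := \prod_(v <- nu) _; set H := P %/ q.
have a0 : a n != 0 by rewrite gt_eqF //; lra.
have sq : size q = (size nu).+1 by rewrite size_prod_XsubC.
have q0 : q != 0 by rewrite -size_poly_gt0 sq.
have sX (b : R) : b != 0 -> size (b *: 'X : {poly R}) = 2%N.
  by move=> b0; rewrite size_scale // size_polyX.
have sP : (size P <= n.+1)%N := size_rand_poly a c n op.
pose l : {poly R} := (a n)^-1 *: 'X.
have sl : size l = 2%N by rewrite sX // invr_eq0.
have cE : psum p n.+1 c = P \Po l.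
  rewrite /P rand_polyE -comp_polyA comp_polyZ comp_polyX scalerA mulfV // scale1r.
  by rewrite comp_polyXr.
pose g := (H * q) \Po l; pose r := (P %% q) \Po l.
have gr : psum p n.+1 c = g + r by rewrite cE /g /r -comp_polyD -divp_eq.
have sr : (size r <= size nu)%N by rewrite size_comp_poly2 // -ltnS -sq ltn_modp.
have sg : (size g <= n.+1)%N.
  have -> : g = psum p n.+1 c - r by rewrite gr addrK.
  rewrite (leq_trans (size_polyD _ _)) // geq_max size_polyN cE size_comp_poly2 // sP /=.
  by rewrite (leq_trans sr) //; lia.
have sH : (size H <= K1.+1)%N by rewrite size_divp // sq /= leq_subLR; apply: leq_trans sP _; rewrite addnS ltnS.
have j1 : (size nu <= n - k)%N by lia.
have j2 : (n - k < n.+1)%N by lia.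
have E0 : 0 <= E.
  by apply: le_trans (hE 0); rewrite !mulr_ge0 ?exprn_ge0 ?addr_ge0 ?sqr_ge0 ?le_max ?ler01.
have := coef_sqr_le_integral op gr sg sr j1 j2.
(* The integrand is dominated by B / (1 + x^2), whose integral is B pi; the factor a_n^2 pays for
   passing from 1 + t^2 to 1 + x^2 with x = a_n t. *)
set B := pnorm rho H ^+ 2 * E * a n ^+ 2.
have B0 : 0 <= B by rewrite mulr_ge0 ?sqr_ge0 // mulr_ge0 ?sqr_ge0.
rewrite -lee_fin => h; apply: le_trans h _; rewrite -(integral_oneDsqr B0).
apply: ge0_le_integral => //.
- by move=> x _; rewrite lee_fin mulr_ge0 ?sqr_ge0.
- apply/measurable_EFinP; apply: continuous_measurable_fun => x.
  apply: cvgM; last exact: continuous_weight_sqr W x.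
  by apply: (@cvgM _ _ _ _ (fun x => g.[x]) (fun x => g.[x])); exact: continuous_poly.
- apply/measurable_EFinP; apply: measurable_funM => //.
  exact: continuous_measurable_fun continuous_oneDsqrV.
move=> x _; rewrite lee_fin; pose t := x / a n.
have xt : x = a n * t by rewrite /t mulrCA mulfV ?mulr1.
have gx : g.[x] = H.[t] * \prod_(v <- nu) (t - v).
  rewrite /g horner_comp hornerZ hornerX [_^-1 * x]mulrC -/t hornerM /q horner_prod.
  by congr (_ * _); apply: eq_bigr => v _; rewrite hornerXsubC.
have hH := horner_le_pnorm t r1 sH.
have h1 : 0 < 1 + t ^+ 2 by have := sqr_ge0 t; lra.
have h2 : 0 < oneDsqr x by have := oneDsqr_ge1 x; lra.
rewrite ler_pdivlMr //.
have <- : Q (a n * t) = Q x by rewrite -xt.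
set w := `|\prod_(v <- nu) (t - v)| * expR (- Q (a n * t)).
have -> : g.[x] ^+ 2 * expR (- Q (a n * t)) ^+ 2 = `|H.[t]| ^+ 2 * w ^+ 2.
  rewrite gx /w !exprMn !(real_normK (num_real _)).
  ring.
have h3 : `|H.[t]| ^+ 2 <= pnorm rho H ^+ 2 * Num.max 1 `|t| ^+ (2 * K1).
  by rewrite mulnC exprM -exprMn lerXn2r ?nnegrE // (le_trans (normr_ge0 _) hH).
have h4 : oneDsqr x <= a n ^+ 2 * (1 + t ^+ 2).
  by rewrite /oneDsqr {1}xt exprMn mulrDr mulr1 lerD2r exprn_ege1.
apply: (@le_trans _ _ (pnorm rho H ^+ 2 * Num.max 1 `|t| ^+ (2 * K1) * w ^+ 2 * (a n ^+ 2 * (1 + t ^+ 2)))).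
  apply: ler_pM => //; first by rewrite mulr_ge0 ?sqr_ge0.
  by rewrite ler_wpM2r ?sqr_ge0.
have -> : pnorm rho H ^+ 2 * Num.max 1 `|t| ^+ (2 * K1) * w ^+ 2 * (a n ^+ 2 * (1 + t ^+ 2)) =
  pnorm rho H ^+ 2 * ((1 + t ^+ 2) * Num.max 1 `|t| ^+ (2 * K1) * w ^+ 2) * a n ^+ 2 by ring.
by rewrite ler_wpM2r ?sqr_ge0 // ler_wpM2l ?sqr_ge0.
Qed.

(** The reason for rho = n: the cost n + 2 per root and the gain n - 1 per node differ by a factor 1
    + 3/(n - 1), whose n-th power is at most exp 6 for n >= 2. *)
Lemma expr_ratio_le (R : realType) (n m : nat) : (2 <= n)%N -> (m <= n)%N ->
  (n%:R + 2) ^+ m <= expR 6 * (n%:R - 1) ^+ m :> R.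
Proof.
move=> n2 mn; have nn : (2 : R) <= n%:R by rewrite (ler_nat R 2).
have x0 : (0 : R) < n%:R - 1 by lra.
have h : (n%:R + 2 : R) <= expR (3 / (n%:R - 1)) * (n%:R - 1).
  rewrite -ler_pdivrMr //; apply: le_trans (expR_ge1Dx _).
  by rewrite ler_pdivrMr // mulrDl mul1r divfK ?gt_eqF //; lra.
apply: (@le_trans _ _ ((expR (3 / (n%:R - 1)) * (n%:R - 1)) ^+ m)).
  by rewrite lerXn2r ?nnegrE // ?mulr_ge0 ?expR_ge0 //; lra.
rewrite exprMn ler_wpM2r ?exprn_ge0 ?(ltW x0) // -expRM_natl ler_expR mulrA ler_pdivrMr //.
have : m%:R <= n%:R :> R by rewrite ler_nat.
lra.
Qed.

(** The quotient of P by the node polynomial is bounded from its roots, by [pnorm_roots_le] and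
    [pnorm_div_prod]; a coefficient of size at least 1/2 prevents it from being too small. The
    polynomial factors are absorbed by half of eta. *)
Lemma roots_lower (R : realType) (Q : R -> R) (p : nat -> {poly R}) (alpha Lam : R) (a : nat -> R)
    (eta : R) (K : nat) :
  regular_weight Q alpha Lam -> MRS_numbers Q a -> orthonormal_polys (fun x => expR (- Q x)) p ->
  0 < eta ->
  \forall n \near \oo, forall (c : nat -> R) k (lc : R[i]) (r : seq R[i]) (tau s W0 theta : R),
    (k < K)%N -> 1 / 2 <= `|c (n - k)%N| ->
    map_poly (toC R) (rand_poly p a c n) = lc *: \prod_(z <- r) ('X - z%:P) -> (size r <= n)%N ->
    0 < s -> s <= 1 -> 0 <= tau -> tau <= 1 -> 0 < W0 -> W0^-1 + 2 / n%:R <= theta -> theta <= 1 ->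
    1 <= expR (n%:R * (eta - ln 2 - alpha^-1)) * (normc lc * \prod_(z <- r) root_weight tau s z) *
         theta ^+ count (fun z => W0 <= root_weight tau s z) r.
Proof.
move=> W HM op e0; have e2 : 0 < eta / 2 by rewrite divr_gt0.
have [K1 hw] := weighted_nodes K W HM e2.
have [C C0 hC] := MRS_le_linear W HM.
have ha1 := MRS_cvg_pinfty W HM 1.
have hpe := pow_le_exp (4 * C * expR 6 * 3 ^+ K1) K1.+1 e2.
apply: filterS3 (filterI (nbhs_infty_ge 2) ha1) (filterI hw hC) hpe => n [n2 a1] [[nu [n1K nK1 nu1 hnu]] aC] hp.
move=> c k lc r tau s W0 theta kK ck hP rn s0 s1 t0 t1 W00 hth th1.
have nn : (2 : R) <= n%:R by rewrite (ler_nat R 2).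
have nn0 : (0 : R) < n%:R by lra.
have nn1 : (1 : R) <= n%:R by lra.
have th0 : 0 <= theta by apply: le_trans hth; rewrite addr_ge0 ?invr_ge0 ?divr_ge0 ?(ltW W00) ?(ltW nn0).
set P := rand_poly p a c n in hP.
have hup := pnorm_roots_le hP s0 s1 t0 t1 nn0 W00 hth th1.
set X := normc lc * _ in hup *.
set N0 := count _ _ in hup *.
have X0 : 0 <= X * theta ^+ N0.
  rewrite mulr_ge0 ?exprn_ge0 // mulr_ge0 ?normc_ge0 //.
  by apply: prodr_ge0 => z _; rewrite (le_trans ler01) // gauge_ge1.
pose q := \prod_(v <- nu) ('X - v%:P).
have sq : size q = (size nu).+1 by rewrite size_prod_XsubC.
have q0 : q != 0 by rewrite -size_poly_gt0 sq.
pose H := P %/ q.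
have hlow : (n%:R - 1) ^+ size nu * pnorm n%:R H <= pnorm n%:R P.
  rewrite [in leRHS](divp_eq P q); apply: pnorm_div_prod => //.
  by rewrite -ltnS -sq ltn_modp.
have m0n : (size nu <= n)%N by apply: leq_trans n1K; rewrite leq_addr.
have n10 : (0 : R) < n%:R - 1 by clear -nn; lra.
have Y0 : 0 <= (3 * n%:R) ^+ K1 :> R by rewrite exprn_ge0 // mulr_ge0 // ltW.
have hH : pnorm n%:R H <= (3 * n%:R) ^+ K1 * expR 6 * (X * theta ^+ N0).
  rewrite -(@ler_pM2l _ ((n%:R - 1) ^+ size nu)) ?exprn_gt0 //.
  apply: le_trans hlow (le_trans hup _); rewrite -mulrA.
  rewrite [leRHS]mulrA ler_wpM2r //.
  have h1 : (n%:R + 2) ^+ size r <= (n%:R + 2) ^+ (size nu + K1) :> R.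
    by apply: ler_weXn2l; [clear -nn; lra|exact: leq_trans rn nK1].
  apply: le_trans h1 _; rewrite exprD [_ ^+ K1 * expR 6]mulrC mulrA.
  have n20 : (0 : R) <= n%:R + 2 by clear -nn; lra.
  apply: ler_pM; rewrite ?(exprn_ge0 _ n20) //.
    by rewrite mulrC expr_ratio_le.
  by rewrite lerXn2r ?nnegrE //; clear -nn; lra.
set Y := _ * (X * _) in hH.
have Yp : 0 <= Y by rewrite mulr_ge0 // mulr_ge0 // expR_ge0.
have := coef_le_pnorm_divp c W op a1 nn1 n1K nK1 kK hnu.
rewrite -/P -/q -/H; set b := eta / 2 - _ - _.
have -> : expR (2 * n%:R * b) = expR (n%:R * b) ^+ 2 by rewrite -expRM_natl mulrA.
have H0 := pnorm_ge0 H (ltW nn0).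
have E0 := expR_ge0 (n%:R * b).
rewrite -!exprMn => hc.
set Z := pnorm n%:R H * _ * _ in hc.
have Z0 : 0 <= Z by rewrite /Z !mulr_ge0 //; clear -a1; lra.
(* From 1/4 <= c^2 <= pi Z^2 and pi < 4. *)
have hZ : 1 <= 4 * Z.
  have : c (n - k)%N ^+ 2 = `|c (n - k)%N| ^+ 2 by rewrite real_normK // num_real.
  have := pihalf_lt2 R; have := sqr_ge0 Z; clear -ck Z0 hc; nra.
apply: le_trans hZ _.
have hZ2 : Z <= Y * expR (n%:R * b) * (C * n%:R).
  by apply: ler_pM => //; [rewrite mulr_ge0|clear -a1; lra|rewrite ler_wpM2r].
apply: (@le_trans _ _ (4 * (Y * expR (n%:R * b) * (C * n%:R)))); first by rewrite ler_wpM2l.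
have -> : 4 * (Y * expR (n%:R * b) * (C * n%:R)) =
  (4 * C * expR 6 * 3 ^+ K1 * n%:R ^+ K1.+1) * expR (n%:R * b) * (X * theta ^+ N0).
  by rewrite /Y exprMn exprS; ring.
rewrite -[leRHS]mulrA ler_wpM2r //.
apply: (@le_trans _ _ (expR (eta / 2 * n%:R) * expR (n%:R * b))); first by rewrite ler_wpM2r.
by rewrite -expRD ler_expR /b; clear; lra.
Qed.

(** * Roots outside the bulk *)

(** The linear terms cancel: s^alpha / alpha contributes -2 eps and -ln s contributes 2 eps. *)
Lemma rate_bound (R : realType) (alpha eps : R) : 0 < alpha -> 0 < eps -> eps <= 1 / 8 ->
  (1 - 2 * eps) `^ alpha / alpha - alpha^-1 - ln (1 - 2 * eps) <= (4 * alpha + 8) * eps ^+ 2.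
Proof.
move=> a0 e0 e1; set s := 1 - 2 * eps.
have s0 : 0 < s by rewrite /s; lra.
have h1 : - ln s <= s^-1 - 1.
  rewrite -lnV ?posrE //; have -> : s^-1 = 1 + (s^-1 - 1) by ring.
  have si : 0 < s^-1 by rewrite invr_gt0.
  have := @le_ln1Dx _ (s^-1 - 1); lra.
have h2 : s^-1 - 1 <= 2 * eps + 8 * eps ^+ 2.
  have -> : s^-1 - 1 = (2 * eps) / s by rewrite /s; field; rewrite -/s gt_eqF.
  by rewrite ler_pdivrMr // /s; have := sqr_ge0 eps; nra.
pose x := alpha * (2 * eps).
have x0 : 0 <= x by rewrite mulr_ge0 ?(ltW a0) //; lra.
have h3 : s `^ alpha <= 1 - x + x ^+ 2.
  rewrite /powR gt_eqF //.
  have l : ln s <= - (2 * eps) by rewrite /s; apply: le_ln1Dx; lra.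
  apply: (@le_trans _ _ (expR (- x))).
    by rewrite ler_expR /x; nra.
  rewrite expRN -[leLHS]div1r ler_pdivrMr ?expR_gt0 //.
  have q0 : 0 <= 1 - x + x ^+ 2 by have := sqr_ge0 (x - 1); have := sqr_ge0 x; nra.
  apply: (@le_trans _ _ ((1 - x + x ^+ 2) * (1 + x))).
    by have := exprn_ge0 3 x0; lra.
  by rewrite ler_wpM2l // expR_ge1Dx.
have h4 : s `^ alpha / alpha <= alpha^-1 - 2 * eps + 4 * alpha * eps ^+ 2.
  rewrite ler_pdivrMr //.
  have -> : (alpha^-1 - 2 * eps + 4 * alpha * eps ^+ 2) * alpha = 1 - x + x ^+ 2.
    by rewrite /x; field; rewrite gt_eqF.
  by [].
lra.
Qed.

Lemma expR_le_1D2x (R : realType) (x : R) : 0 <= x -> x <= 1 / 2 -> expR x <= 1 + 2 * x.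
Proof.
move=> x0 x1; have h := expR_ge1Dx (- x).
rewrite -[expR x]invrK -expRN -div1r ler_pdivrMr ?expR_gt0 //; nra.
Qed.

Lemma root_count_le (R : realType) (Q : R -> R) (p : nat -> {poly R}) (alpha Lam : R) (a : nat -> R) (eps : R) (K : nat) :
  regular_weight Q alpha Lam -> MRS_numbers Q a -> orthonormal_polys (fun x => expR (- Q x)) p ->
  0 < eps -> eps <= 1 / 8 ->
  \forall n \near \oo, forall (c : nat -> R) (lc : R[i]) (r : seq R[i]),
    (forall j, (j < n.+1)%N -> `|c j| <= n%:R ^+ 2) ->
    (exists2 k, (k < K)%N & 1 / 2 <= `|c (n - k)%N|) ->
    map_poly (toC R) (rand_poly p a c n) = lc *: \prod_(z <- r) ('X - z%:P) -> (size r <= n)%N ->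
    (count (fun z : R[i] => 1 - eps < normc z) r)%:R <= (32 * alpha + 80) * eps * n%:R.
Proof.
move=> W HM op e0 e1; have al1 := rw_alpha W; have al0 : 0 < alpha by lra.
have ee0 : 0 < eps ^+ 2 by rewrite exprn_gt0.
have hu := roots_upper W HM op ee0.
have hl := roots_lower K W HM op ee0.
have hn : \forall n \near \oo, 16 / eps < n%:R :> R by exact: nbhs_infty_gtr.
apply: filterS3 (filterI (nbhs_infty_gt 0) hn) hu hl => n [n0 en] hun hln c lc r hc [k kK ck] hP rn.
have nn0 : (0 : R) < n%:R by rewrite ltr0n.
have nn1 : (1 : R) <= n%:R by rewrite ler1n.
have ni : n%:R^-1 < eps / 16 :> R by rewrite -[eps / 16]invf_div ltf_pV2 ?posrE ?divr_gt0.
(* A root with |z| > 1 - eps has gauge at least W0, since (1 - eps - 1/n)/(1 - 2 eps) exceeds 1 +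
   eps/2. Passing from eps/2 to eps/4 in [theta] makes room for 2/n, and exp(eps/8) <= 1 + eps/4
   turns [theta] into an exponential. *)
pose s := 1 - 2 * eps; pose W0 := 1 + eps / 2; pose theta := (1 + eps / 4)^-1.
have s0 : 0 < s by rewrite /s; lra.
have s1 : s <= 1 by rewrite /s; lra.
have W00 : 0 < W0 by rewrite /W0; lra.
have q0 : 0 < 1 + eps / 4 by lra.
have hth : W0^-1 + 2 / n%:R <= theta.
  have : W0^-1 + eps / 8 <= theta.
    rewrite /theta -[leRHS]div1r ler_pdivlMr // mulrDl.
    have -> : W0^-1 * (1 + eps / 4) = 1 - (eps / 4) / W0.
      by rewrite /W0; field; rewrite gt_eqF //; lra.
    have : eps / 8 * (1 + eps / 4) <= (eps / 4) / W0 by rewrite ler_pdivlMr // /W0; nra.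
    lra.
  lra.
have th1 : theta <= 1 by rewrite invf_le1 //; lra.
have [tau [t0 t1 hX]] := hun c lc r s hc hP rn s0 s1.
have tau1 : tau <= 1 by lra.
have := hln c k lc r tau s W0 theta kK ck hP rn s0 s1 t0 tau1 W00 hth th1.
set X := normc lc * _ in hX *; set N0 := count _ _ => hL.
have NN : (count (fun z : R[i] => (1 - eps < normc z)%R) r <= N0)%N.
  apply: sub_count => z /= hz; apply: le_trans (normc_le_gauge _).
  set y := _ / _; have zE : z - (tau%:C)%C = y * (s%:C)%C by rewrite /y divfK // toC_neq0 // gt_eqF.
  have := normc_ge_sub z (tau%:C)%C; rewrite zE ComplexField.Normc.normcM !normc_real.
  rewrite (ger0_norm t0) (ger0_norm (ltW s0)) => h.
  rewrite -(ler_pM2r s0); apply: le_trans h; rewrite /W0 /s; nra.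
apply: (@le_trans _ _ N0%:R); first by rewrite ler_nat.
have X0 : 0 <= X.
  rewrite mulr_ge0 ?normc_ge0 //.
  by apply: prodr_ge0 => z _; rewrite (le_trans ler01) // gauge_ge1.
have s2 : 0 < s / 2 by rewrite divr_gt0.
(* A degree below n does no harm, because s/2 < 1. *)
have hX' : X * (s / 2) ^+ n <= expR (n%:R * (s `^ alpha / alpha + eps ^+ 2)).
  apply: le_trans hX; rewrite ler_wpM2l //; apply: ler_wiXn2l => //; [exact: ltW|lra].
have sn : (s / 2) ^+ n = expR (n%:R * (ln s - ln 2)).
  rewrite expRM_natl expRD expRN !lnK ?posrE //.
have th0 : 0 <= theta by rewrite invr_ge0 ltW.
(* The terms ln 2 of the two estimates cancel, which leaves the rate
   (s^alpha - 1) / alpha - ln s = O(eps^2), against a gain eps / 8 per outer root. *)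
have hq : expR (n%:R * (ln s - ln 2)) <=
   expR (n%:R * (eps ^+ 2 - ln 2 - alpha^-1)) * expR (n%:R * (s `^ alpha / alpha + eps ^+ 2)) * theta ^+ N0.
  rewrite -sn -[leLHS]mul1r.
  apply: (@le_trans _ _ (expR (n%:R * (eps ^+ 2 - ln 2 - alpha^-1)) * X * theta ^+ N0 * (s / 2) ^+ n)).
    by rewrite ler_wpM2r // exprn_ge0 // ltW.
  rewrite mulrAC ler_wpM2r ?exprn_ge0 // -mulrA ler_wpM2l ?expR_ge0 //.
have hth2 : theta ^+ N0 <= expR (- (N0%:R * (eps / 8))).
  rewrite -mulrN expRM_natl lerXn2r ?nnegrE ?expR_ge0 // expRN /theta lef_pV2 ?posrE ?expR_gt0 //.
  by have := @expR_le_1D2x _ (eps / 8); clear -e0 e1; lra.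
have : expR (n%:R * (ln s - ln 2)) <=
   expR (n%:R * (eps ^+ 2 - ln 2 - alpha^-1)) * expR (n%:R * (s `^ alpha / alpha + eps ^+ 2)) * expR (- (N0%:R * (eps / 8))).
  by apply: le_trans hq _; rewrite ler_wpM2l // mulr_ge0 ?expR_ge0.
rewrite -!expRD ler_expR => h.
have hr := rate_bound al0 e0 e1; rewrite -/s in hr.
(* The 10 is the 8 of [rate_bound] plus the two errors eps^2 of the upper and the lower estimate;
   multiplication by 8 gives 32 alpha + 80. *)
have h2 : N0%:R * (eps / 8) <= n%:R * ((4 * alpha + 10) * eps ^+ 2).
  apply: (@le_trans _ _ (n%:R * (2 * eps ^+ 2 + (s `^ alpha / alpha - alpha^-1 - ln s)))); first by clear -h; lra.
  by rewrite ler_wpM2l // ?(ltW nn0) //; clear -hr; lra.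
rewrite -(@ler_pM2r _ (eps / 8)) ?divr_gt0 //; apply: le_trans h2 _; clear; lra.
Qed.

Lemma nzeros_le_roots (R : realType) (P : {poly R}) (eps : R) (lc : R[i]) (r : seq R[i]) (B : R) :
  P != 0 -> map_poly (toC R) P = lc *: \prod_(z <- r) ('X - z%:P) ->
  (count (fun z : R[i] => 1 - eps < normc z) r)%:R <= B ->
  (nzeros P (~` Dset eps) <= B%:E)%E.
Proof.
move=> P0 hP hB; rewrite /nzeros (negbTE P0); apply: ge_ereal_sup => _ [s [us hs] <-].
rewrite lee_fin; apply: le_trans hB; rewrite ler_nat.
apply: (sum_mup_le P0 hP us) => x xs /=.
rewrite normc_real; have := hs x xs; rewrite /Dset /= in_itv /= => /negP.
by rewrite negb_and -!ltNge ltr_normr => /orP[h|h]; apply/orP; [right; lra|left].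
Qed.

Lemma roots_of_poly (R : realType) (P : {poly R}) (n : nat) : P != 0 -> (size P <= n.+1)%N ->
  exists lc r, [/\ map_poly (toC R) P = lc *: \prod_(z <- r) ('X - z%:P) & (size r <= n)%N].
Proof.
move=> P0 sP; have [r hr] := closed_field_poly_normal (map_poly (toC R) P).
exists (lead_coef (map_poly (toC R) P)), r; split => //.
have l0 : lead_coef (map_poly (toC R) P) != 0 by rewrite lead_coef_eq0 map_poly_eq0.
by rewrite -ltnS; move: sP; rewrite -(size_map_poly (toC R)) hr size_scale // size_prod_XsubC.
Qed.

Lemma nzeros_ge0 (R : realType) (P : {poly R}) (E : set R) : (0 <= nzeros P E)%E.
Proof.
rewrite /nzeros; case: ifP => // _; apply: ereal_sup_ubound; exists [::] => //.
by rewrite big_nil.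
Qed.

Lemma nzeros_le_deg (R : realType) (P : {poly R}) (eps : R) (n : nat) : (size P <= n.+1)%N ->
  (nzeros P (~` Dset eps) <= n%:R%:E)%E.
Proof.
move=> sP; have [->|P0] := eqVneq P 0; first by rewrite /nzeros eqxx lee_fin.
have [lc [r [hP sr]]] := roots_of_poly P0 sP.
apply: (nzeros_le_roots P0 hP); rewrite ler_nat; exact: leq_trans (count_size _ _) sr.
Qed.

Lemma nzeros_outside_le (R : realType) (Q : R -> R) (p : nat -> {poly R}) (alpha Lam : R) (a : nat -> R) (eps : R) (K : nat) :
  regular_weight Q alpha Lam -> MRS_numbers Q a -> orthonormal_polys (fun x => expR (- Q x)) p ->
  0 < eps -> eps <= 1 / 8 ->
  \forall n \near \oo, forall (c : nat -> R),
    (forall j, (j < n.+1)%N -> `|c j| <= n%:R ^+ 2) ->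
    (exists2 k, (k < K)%N & 1 / 2 <= `|c (n - k)%N|) ->
    (nzeros (rand_poly p a c n) (~` Dset eps) <= ((32 * alpha + 80) * eps * n%:R)%:E)%E.
Proof.
move=> W HM op e0 e1; have al1 := rw_alpha W.
apply: filterS (root_count_le K W HM op e0 e1) => n h c hc hk.
have [->|P0] := eqVneq (rand_poly p a c n) 0.
  by rewrite /nzeros eqxx lee_fin mulr_ge0 // mulr_ge0 //; lra.
have [lc [r [hP sr]]] := roots_of_poly P0 (size_rand_poly a c n op).
exact: nzeros_le_roots P0 hP (h c lc r hc hk hP sr).
Qed.

(** * Random coefficients *)

(** The integral of a nonnegative function is a supremum over the simple functions below it, so this
    applies to the number of zeros as a function of the random parameter without discussing its
    measurability. *)
Lemma ge0_le_integral_majorant d (T : measurableType d) (R : realType) (mu : measure T R)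
    (f g : T -> \bar R) : (forall x, 0 <= f x)%E -> (forall x, f x <= g x)%E ->
  (\int[mu]_x f x <= \int[mu]_x g x)%E.
Proof.
move=> f0 fg; have g0 x : (0 <= g x)%E by apply: le_trans (fg x).
rewrite !ge0_integralTE //; apply: ereal_sup_le => _ [h hf <-].
by exists h => // x; apply: le_trans (fg x).
Qed.

Lemma limn_esup_le_near (R : realType) (u : (\bar R)^nat) (b : \bar R) :
  (\forall n \near \oo, u n <= b)%E -> (limn_esup u <= b)%E.
Proof.
move=> h; rewrite /limn_esup /limf_esup.
apply: (@le_trans _ _ (ereal_sup [set u x | x in [set n | (u n <= b)%E]])).
  by apply: ereal_inf_lbound; exists [set n | (u n <= b)%E].
by apply: ge_ereal_sup => _ [n hn <-].
Qed.

Lemma limn_esup_ge0 (R : realType) (u : (\bar R)^nat) : (forall n, 0 <= u n)%E -> (0 <= limn_esup u)%E.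
Proof.
move=> h; rewrite /limn_esup /limf_esup; apply: le_ereal_inf_tmp => _ [V [n _ hV] <-].
apply: le_trans (h n) _; apply: ereal_sup_ubound; exists n => //; exact: hV (leqnn n).
Qed.

Definition abs_gt (R : realType) (lam : R) : set R := [set x | lam < `|x|].

Definition abs_lt (R : realType) (lam : R) : set R := [set x | `|x| < lam].

Lemma measurable_abs_gt (R : realType) (lam : R) : measurable (abs_gt lam).
Proof.
have -> : abs_gt lam = setT `&` (fun x : R => `|x|) @^-1` `]lam, +oo[%classic.
  by rewrite setTI; apply/seteqP; split => x /=; rewrite in_itv /= andbT.
apply: (continuous_measurable_fun (@norm_continuous R R)) => //; exact: measurable_itv.
Qed.

Lemma measurable_abs_lt (R : realType) (lam : R) : measurable (abs_lt lam).
Proof.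
have -> : abs_lt lam = setT `&` (fun x : R => `|x|) @^-1` `]-oo, lam[%classic.
  by rewrite setTI; apply/seteqP; split => x /=; rewrite in_itv.
apply: (continuous_measurable_fun (@norm_continuous R R)) => //; exact: measurable_itv.
Qed.

Section bad_event.
Variables (d : measure_display) (T : measurableType d) (R : realType) (P : probability T R).
Variables (X : nat -> T -> R) (D q : R).
Hypothesis mX : forall k, measurable_fun setT (X k).
Hypothesis indepX : mutually_independent P X.
Hypothesis tailX : forall k (lam : R), 1 <= lam -> (P (X k @^-1` abs_gt lam) <= (D / lam)%:E)%E.
Hypothesis smallX : forall k, (P (X k @^-1` abs_lt (1 / 2)%R) <= (1 - q)%:E)%E.

Definition large_coef (n : nat) : set T :=
  \big[setU/set0]_(j < n.+1) X j @^-1` abs_gt (n%:R ^+ 2)%R.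

Definition small_coefs (K n : nat) : set T :=
  \big[setI/setT]_(i <- [seq (n - k)%N | k <- iota 0 K]) X i @^-1` abs_lt (1 / 2)%R.

Let mpre k B : measurable B -> measurable (X k @^-1` B).
Proof. by move=> mB; rewrite -[X in measurable X]setTI; exact: mX. Qed.

Lemma measurable_large_coef n : measurable (large_coef n).
Proof. by apply: bigsetU_measurable => j _; apply: mpre; exact: measurable_abs_gt. Qed.

Lemma measurable_small_coefs K n : measurable (small_coefs K n).
Proof. by apply: bigsetI_measurable => j _; apply: mpre; exact: measurable_abs_lt. Qed.

(** The threshold n^2 makes the union bound over n + 1 coefficients O(1/n) with a tail of order
    1/lam only. *)
Lemma prob_large_coef n : (0 < n)%N -> (P (large_coef n) <= (2 * D / n%:R)%:E)%E.
Proof.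
move=> n0; have nn : (1 : R) <= n%:R by rewrite ler1n.
have nn0 : (0 : R) < n%:R by rewrite ltr0n.
have D0 : 0 <= D.
  have := tailX 0 (lexx 1); rewrite divr1 => h; rewrite -lee_fin; exact: le_trans h.
apply: (@le_trans _ _ (\sum_(j < n.+1) P (X j @^-1` abs_gt (n%:R ^+ 2)%R))%E).
  apply: (content_subadditive P (F := fun j => X j @^-1` abs_gt (n%:R ^+ 2))) => //; last exact: measurable_large_coef.
  by move=> k _; apply: mpre; exact: measurable_abs_gt.
apply: (@le_trans _ _ (\sum_(j < n.+1) (D / n%:R ^+ 2)%:E)%E).
  by apply: lee_sum => j _; apply: tailX; exact: exprn_ege1.
rewrite sumEFin lee_fin sumr_const card_ord -[_ *+ n.+1]mulr_natl -[n.+1%:R]natr1.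
rewrite ler_pdivlMr // expr2.
have -> : (n%:R + 1) * (D / (n%:R * n%:R)) * n%:R = (n%:R + 1) / n%:R * D.
  by field; rewrite gt_eqF.
by rewrite ler_wpM2r // ler_pdivrMr //; lra.
Qed.

Lemma prob_small_coefs K n : (K <= n)%N -> (P (small_coefs K n) <= ((1 - q) ^+ K)%:E)%E.
Proof.
move=> Kn; rewrite /small_coefs.
rewrite (@indepX _ (fun=> abs_lt (1 / 2))); first last.
- by move=> i; exact: measurable_abs_lt.
(* K <= n keeps the truncated differences n - k distinct, as independence requires. *)
- rewrite map_inj_in_uniq ?iota_uniq // => i j; rewrite !mem_iota /= !add0n => hi hj h.
  by rewrite -(subKn (ltnW (leq_trans hi Kn))) h subKn // ltnW // (leq_trans hj Kn).
have sK : size [seq (n - k)%N | k <- iota 0 K] = K by rewrite size_map size_iota.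
rewrite -[K in leRHS]sK; elim: (map _ _) => [|i s IH]; first by rewrite big_nil expr0.
rewrite big_cons exprS EFinM; apply: lee_pmul => //.
by apply: (big_ind (fun x => 0 <= x)%E) => // x y; exact: mule_ge0.
Qed.

Lemma not_large_coef n w : ~ large_coef n w -> forall j, (j < n.+1)%N -> `|X j w| <= n%:R ^+ 2.
Proof.
rewrite /large_coef -(bigcup_mkord n.+1 (fun j => X j @^-1` abs_gt (n%:R ^+ 2))) => h j jn.
by rewrite leNgt; apply/negP => hj; apply: h; exists j.
Qed.

Lemma not_small_coefs K n w : ~ small_coefs K n w -> exists2 k, (k < K)%N & 1 / 2 <= `|X (n - k)%N w|.
Proof.
move=> h; apply: contrapT => hn; apply: h.
rewrite /small_coefs -bigcap_seq => i /= /mapP[k]; rewrite mem_iota /= add0n => kK ->.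
by rewrite /abs_lt /= ltNge; apply/negP => hk; apply: hn; exists k.
Qed.

Lemma integral_nzeros_le (Z : T -> \bar R) (n K : nat) (B : R) : (0 < n)%N -> (K <= n)%N -> 0 <= B ->
  (forall w, 0 <= Z w)%E -> (forall w, Z w <= n%:R%:E)%E ->
  (forall w, ~ large_coef n w -> ~ small_coefs K n w -> Z w <= B%:E)%E ->
  (\int[P]_w Z w <= (B + n%:R * (2 * D / n%:R + (1 - q) ^+ K))%:E)%E.
Proof.
move=> n0 Kn B0 Z0 Zn hZ; pose G := large_coef n `|` small_coefs K n.
have mL := measurable_large_coef n; have mS := measurable_small_coefs K n.
have mG : measurable G by exact: measurableU.
have mI : measurable_fun setT (fun w : T => (\1_G w)%:E : \bar R).
  by apply/measurable_EFinP; exact: measurable_indic.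
apply: (@le_trans _ _ (\int[P]_w (B%:E + n%:R%:E * (\1_G w)%:E)))%E.
  apply: ge0_le_integral_majorant => // w; rewrite indicE.
  have [/set_mem Gw|/negP nG] := boolP (w \in G).
    by rewrite mule1; apply: le_trans (Zn w) _; rewrite -[leLHS]add0e leeD2r // lee_fin.
  rewrite mule0 adde0; apply: hZ => h; apply: nG; apply/mem_set; [left|right]; exact: h.
rewrite ge0_integralD //=; last by apply: measurable_funeM.
rewrite integral_cst //.
have -> : (B%:E * P [set: T] = B%:E)%E by rewrite [X in (_ * X)%E](probability_setT P) mule1.
rewrite ge0_integralZl_EFin //.
rewrite integral_indic // setIT EFinD leeD2l // EFinM lee_pmul2l ?lte_fin ?ltr0n //.
apply: le_trans (measureU2 _ mL mS) _; rewrite EFinD.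
by apply: leeD; [exact: prob_large_coef|exact: prob_small_coefs].
Qed.

End bad_event.

Lemma limn_esup_ratio_le d (T : measurableType d) (R : realType) (P : probability T R)
    (X : nat -> T -> R) (D q : R) (Q : R -> R) (p : nat -> {poly R}) (alpha Lam : R) (a : nat -> R) (eps : R) :
  (forall k, measurable_fun setT (X k)) -> mutually_independent P X ->
  (forall k (lam : R), 1 <= lam -> (P (X k @^-1` abs_gt lam) <= (D / lam)%:E)%E) ->
  0 < q -> q <= 1 -> (forall k, P (X k @^-1` abs_lt (1 / 2)%R) <= (1 - q)%:E)%E ->
  regular_weight Q alpha Lam -> MRS_numbers Q a -> orthonormal_polys (fun x => expR (- Q x)) p ->
  0 < eps -> eps <= 1 / 8 ->
  (limn_esup (exp_zero_ratio P X p a eps) <= ((32 * alpha + 80) * eps)%:E)%E.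
Proof.
move=> mX indepX tailX q0 q1 smallX W HM op e0 e1; have al1 := rw_alpha W.
apply/lee_addgt0Pr => dl dl0.
have d2 : 0 < dl / 2 by rewrite divr_gt0.
have qn : `|1 - q| < 1 by rewrite ger0_norm; lra.
(* The window K depends only on [dl] and q and is fixed before n tends to infinity. *)
have [K _ /(_ K (leqnn K)) /= hK] := @cvgr_lt _ _ _ _ _ _ (cvg_expr qn) _ d2.
apply: limn_esup_le_near.
have hn : \forall n \near \oo, 4 * D / dl < n%:R by exact: nbhs_infty_gtr.
apply: filterS3 (filterI (nbhs_infty_gt 0) (nbhs_infty_ge K)) hn (nzeros_outside_le K W HM op e0 e1).
move=> n [n0 nK] nD hz; have nn0 : (0 : R) < n%:R by rewrite ltr0n.
have B0 : 0 <= (32 * alpha + 80) * eps * n%:R by rewrite mulr_ge0 // ?(ltW nn0) // mulr_ge0 //; lra.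
rewrite /exp_zero_ratio.
set Z := fun w => nzeros _ _.
have h : (\int[P]_w Z w <= ((32 * alpha + 80) * eps * n%:R + n%:R * (2 * D / n%:R + (1 - q) ^+ K))%:E)%E.
  apply: (integral_nzeros_le mX indepX tailX smallX n0 nK B0) => w.
  - exact: nzeros_ge0.
  - by apply: nzeros_le_deg; exact: size_rand_poly op.
  - by move=> hl hs; apply: hz; [exact: not_large_coef hl|exact: not_small_coefs hs].
have ni : 0 <= n%:R^-1 :> R by rewrite invr_ge0 ltW.
apply: le_trans (lee_wpmul2l _ h) _; first by rewrite lee_fin.
rewrite -EFinM -EFinD lee_fin.
have -> : n%:R^-1 * ((32 * alpha + 80) * eps * n%:R + n%:R * (2 * D / n%:R + (1 - q) ^+ K)) =
   (32 * alpha + 80) * eps + (2 * D / n%:R + (1 - q) ^+ K) by field; rewrite gt_eqF.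
have : 2 * D / n%:R <= dl / 2.
  by rewrite ler_pdivrMr //; move: nD; rewrite ltr_pdivrMr //; lra.
by move: hK; lra.
Qed.

Lemma limn_esup_ratio_cvg d (T : measurableType d) (R : realType) (P : probability T R)
    (X : nat -> T -> R) (D q : R) (Q : R -> R) (p : nat -> {poly R}) (alpha Lam : R) (a : nat -> R) :
  (forall k, measurable_fun setT (X k)) -> mutually_independent P X ->
  (forall k (lam : R), 1 <= lam -> (P (X k @^-1` abs_gt lam) <= (D / lam)%:E)%E) ->
  0 < q -> q <= 1 -> (forall k, P (X k @^-1` abs_lt (1 / 2)%R) <= (1 - q)%:E)%E ->
  regular_weight Q alpha Lam -> MRS_numbers Q a -> orthonormal_polys (fun x => expR (- Q x)) p ->
  (fun eps => limn_esup (exp_zero_ratio P X p a eps)) @ 0^'+ --> 0%E.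
Proof.
move=> mX indepX tailX q0 q1 smallX W HM op.
have lin : (fun eps : R => ((32 * alpha + 80) * eps)%:E) @ 0^'+ --> 0%E.
  apply/cvg_EFin; first by near=> x.
  rewrite -[X in _ --> X](mulr0 (32 * alpha + 80)).
  apply: cvgM; first exact: cvg_cst.
  exact: cvg_at_right_filter cvg_id.
apply: (squeeze_cvge _ (cvg_cst 0%E) lin).
near=> eps; apply/andP; split.
  apply: limn_esup_ge0 => n; rewrite /exp_zero_ratio mule_ge0 ?lee_fin //.
  by apply: integral_ge0 => w _; exact: nzeros_ge0.
apply: limn_esup_ratio_le mX indepX tailX q0 q1 smallX W HM op _ _.
  by near: eps; exact: nbhs_right_gt.
by near: eps; apply: nbhs_right_le; lra.
Unshelve. all: by end_near. Qed.

(** * Tail and small-ball estimates for the two families of coefficients *)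

Lemma tail_unit_variance d (T : measurableType d) (R : realType) (P : probability T R) (X : {RV P >-> R}) (lam : R) :
  ('E_P[X] = 0)%E -> ('V_P[X] = 1)%E -> 1 <= lam -> (P (X @^-1` abs_gt lam) <= (1 / lam)%:E)%E.
Proof.
move=> E0 V1 l1; have l0 : 0 < lam by lra.
have := chebyshev X l0; rewrite E0 V1 mule1 => h.
have mX : measurable_fun setT (X : T -> R) by exact: measurable_funPT.
have m1 : measurable (X @^-1` abs_gt lam).
  by rewrite -[X in measurable X]setTI; apply: mX => //; exact: measurable_abs_gt.
apply: (@le_trans _ _ (P [set x | lam <= `|X x - fine 0%E|])).
  apply: le_measure; rewrite ?inE //.
    have -> : [set x | lam <= `|X x - fine 0%E|] = setT `&` X @^-1` (~` abs_lt lam).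
      rewrite setTI; apply/seteqP; split => x; rewrite /abs_lt /= subr0.
        by rewrite leNgt => /negP.
      by move/negP; rewrite -leNgt.
    by apply: mX => //; apply: measurableC; exact: measurable_abs_lt.
  by move=> x; rewrite /abs_gt /= subr0; exact: ltW.
apply: le_trans h _; rewrite lee_fin div1r lef_pV2 ?posrE ?exprn_gt0 // expr2.
by rewrite ler_peMr // ltW.
Qed.

Lemma integral_sqr_unit_variance d (T : measurableType d) (R : realType) (P : probability T R) (X : {RV P >-> R}) :
  ('E_P[X] = 0)%E -> ('V_P[X] = 1)%E -> (\int[P]_w (X w ^+ 2)%:E = 1)%E.
Proof.
move=> E0; rewrite /variance covariance.unlock expectation.unlock.
have -> : fine (\int[P]_w (X w)%:E)%E = 0.
  by rewrite -expectation_def E0.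
move=> <-; apply: eq_integral => w _.
by rewrite /= /GRing.mul /= !subr0.
Qed.

(** The second moment 1 is split by size. Values below 1/2 contribute at most 1/4, and values above
    [lam] at most M/L <= 1/4 because lam^e0 = L. The rest is at most lam^2 P(|X| >= 1/2), so this
    probability is at least 1/(2 lam^2), uniformly in k. *)
Lemma small_ball_unit_variance d (T : measurableType d) (R : realType) (P : probability T R)
    (X : nat -> {RV P >-> R}) (e0 M : R) :
  (forall k, ('E_P[X k] = 0)%E) -> (forall k, ('V_P[X k] = 1)%E) -> 0 < e0 ->
  (forall k, (\int[P]_w (`|X k w| `^ (2 + e0))%:E <= M%:E)%E) ->
  exists q : R, [/\ 0 < q, q <= 1 & forall k, (P (X k @^-1` abs_lt (1 / 2)%R) <= (1 - q)%:E)%E].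
Proof.
move=> E0 V1 e00 hM.
have M0 : 0 <= M.
  have := hM 0; rewrite -lee_fin; apply: le_trans.
  by apply: integral_ge0 => w _; rewrite lee_fin powR_ge0.
pose L := 4 * (M + 1).
have L1 : 1 <= L by rewrite /L; lra.
pose lam := L `^ e0^-1.
have lam1 : 1 <= lam by rewrite /lam -(powRr0 L); apply: ler_powR => //; rewrite invr_ge0 ltW.
have lamE : lam `^ e0 = L by rewrite /lam -powRrM mulVf ?gt_eqF // powRr1 //; lra.
have l2 : 1 <= lam ^+ 2 by exact: exprn_ege1.
exists (2 * lam ^+ 2)^-1; split.
- by rewrite invr_gt0; lra.
- by rewrite invf_le1; lra.
move=> k; set Y : T -> R := X k.
have mY : measurable_fun setT Y by exact: measurable_funPT.
pose A := Y @^-1` abs_lt (1 / 2)%R.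
have mA : measurable A.
  by rewrite /A -[X in measurable X]setTI; apply: mY => //; exact: measurable_abs_lt.
have mI (B : set T) : measurable B -> measurable_fun setT (fun w : T => (\1_B w)%:E : \bar R).
  by move=> mB; apply/measurable_EFinP; exact: measurable_indic.
have mP : measurable_fun setT (fun w => (`|Y w| `^ (2 + e0))%:E).
  apply/measurable_EFinP; apply: (measurableT_comp (measurable_powR _)).
  exact: measurableT_comp.
have key w : Y w ^+ 2 <= 1 / 4 + lam ^+ 2 * \1_(~` A) w + L^-1 * `|Y w| `^ (2 + e0).
  have p0 : 0 <= L^-1 * `|Y w| `^ (2 + e0) by rewrite mulr_ge0 ?powR_ge0 // invr_ge0; lra.
  rewrite -(real_normK (num_real (Y w))) indicE; have n0 := normr_ge0 (Y w).
  have [h1|h1] := ltP `|Y w| (1 / 2).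
    have -> : (w \in ~` A) = false by apply/negP => /set_mem; apply.
    by rewrite mulr0; nra.
  have -> : (w \in ~` A) = true by apply/mem_set => /=; rewrite /A /abs_lt /= ltNge h1.
  rewrite mulr1; have [h2|h2] := leP `|Y w| lam.
    have : `|Y w| ^+ 2 <= lam ^+ 2 by rewrite lerXn2r // nnegrE; lra.
    lra.
  have y0 : `|Y w| != 0 by rewrite gt_eqF //; lra.
  have : `|Y w| ^+ 2 <= L^-1 * `|Y w| `^ (2 + e0).
    rewrite powRD ?y0 ?implybT // powR_mulrn // mulrCA ler_peMr ?sqr_ge0 //.
    rewrite -[leLHS](mulVf (x := L)) ?gt_eqF //; last lra.
    rewrite ler_wpM2l ?invr_ge0 //; first lra.
    by rewrite -lamE; apply: ge0_ler_powR; rewrite ?nnegrE //; lra.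
  lra.
have : (1 <= (1 / 4 + lam ^+ 2 * (1 - fine (P A)) + L^-1 * M)%:E)%E.
  rewrite -(integral_sqr_unit_variance (E0 k) (V1 k)).
  apply: (@le_trans _ _ (\int[P]_w ((1 / 4)%:E + (lam ^+ 2)%:E * (\1_(~` A) w)%:E + (L^-1)%:E * (`|Y w| `^ (2 + e0))%:E)))%E.
    apply: ge0_le_integral_majorant => w; first by rewrite lee_fin sqr_ge0.
    by rewrite -!EFinM -!EFinD lee_fin.
  have f1 w : (0 <= (1 / 4)%:E + (lam ^+ 2)%:E * (\1_(~` A) w)%:E)%E.
    by rewrite -EFinM -EFinD lee_fin addr_ge0 // mulr_ge0 ?sqr_ge0.
  rewrite ge0_integralD //=; first last.
  - by apply: measurable_funeM.
  - by move=> w _; rewrite -EFinM lee_fin mulr_ge0 ?powR_ge0 // invr_ge0; lra.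
  - apply: emeasurable_funD => //; apply: measurable_funeM; apply: mI; exact: measurableC.
  rewrite ge0_integralD //=; first last.
  - by apply: measurable_funeM; apply: mI; exact: measurableC.
  - by move=> w _; rewrite -EFinM lee_fin mulr_ge0 ?sqr_ge0.
  rewrite integral_cst // [X in (_ * X + _ + _)%E](probability_setT P) mule1.
  rewrite ge0_integralZl_EFin ?sqr_ge0 //; last by apply: mI; exact: measurableC.
  rewrite ge0_integralZl_EFin //; [|by rewrite invr_ge0; lra].
  rewrite integral_indic //; last exact: measurableC.
  have PC : P (~` A `&` setT) = (1 - fine (P A))%:E.
    by rewrite setIT (probability_setC P mA) EFinB fineK // fin_num_measure.
  rewrite [X in (_ + _ * X + _)%E]PC [X in (_ <= X)%E]EFinD.
  have L0 : (0 <= (L^-1)%:E)%E by rewrite lee_fin invr_ge0; lra.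
  apply: leeD; first exact: lexx.
  by rewrite EFinM; apply: lee_wpmul2l => //; exact: hM.
rewrite lee_fin => h.
have hL : L^-1 * M <= 1 / 4 by rewrite mulrC ler_pdivrMr /L; lra.
have lp : 0 < lam ^+ 2 by lra.
rewrite -(@fineK _ (P A)) ?fin_num_measure // lee_fin.
have -> : (2 * lam ^+ 2)^-1 = (1 / 2) / lam ^+ 2 by field; rewrite gt_eqF //; lra.
suff : (1 / 2) / lam ^+ 2 <= 1 - fine (P A) by lra.
by rewrite ler_pdivrMr //; lra.
Qed.

Lemma normal_peak_le (R : realType) : normal_peak (1 : R) <= 1 / 2.
Proof.
have h : 2 <= Num.sqrt ((1 : R) ^+ 2 * pi *+ 2).
  have -> : (2 : R) = Num.sqrt (2 ^+ 2) by rewrite sqrtr_sqr ger0_norm.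
  by apply: ler_wsqrtr; rewrite expr1n mul1r mulr2n expr2; have := pi_ge2 R; lra.
by rewrite /normal_peak div1r lef_pV2 ?posrE //; lra.
Qed.

(** Of the two factors 1 + x^2, one yields 1/lam on |x| > lam in [normal_tail], and the other is
    integrable with integral pi. *)
Lemma normal_pdf_le (R : realType) (x : R) : normal_pdf 0 1 x <= 16 / (1 + x ^+ 2) ^+ 2.
Proof.
rewrite normal_pdfE ?oner_eq0 // /normal_fun subr0 expr1n mulNr expRN.
have p1 := normal_peak_le R.
have s0 := sqr_ge0 x.
have h : (1 + x ^+ 2) ^+ 2 <= 16 * expR (x ^+ 2 / 2).
  have -> : x ^+ 2 / 2 = 2%:R * (x ^+ 2 / 4) by field.
  rewrite expRM_natl; have := expR_ge1Dx (x ^+ 2 / 4).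
  have -> : (16 : R) = 4 ^+ 2 by ring.
  rewrite -exprMn => h; have := expR_ge0 (x ^+ 2 / 4) => h'.
  by rewrite lerXn2r ?nnegrE //; lra.
have d0 : 0 < (1 + x ^+ 2) ^+ 2 by rewrite exprn_gt0 //; lra.
rewrite ler_pdivlMr // mulrAC ler_pdivrMr ?expR_gt0 //.
apply: le_trans h; rewrite ler_piMl //; [exact: ltW|lra].
Qed.

Lemma normal_tail (R : realType) (lam : R) : 1 <= lam ->
  (normal_prob 0 1 (abs_gt lam) <= (16 * pi / lam)%:E)%E.
Proof.
move=> l1; have l0 : 0 < lam by lra.
have B0 : 0 <= 16 / lam by rewrite divr_ge0 // ltW.
have -> : 16 * pi / lam = 16 / lam * pi by ring.
rewrite -(integral_oneDsqr B0) /normal_prob integral_mkcond.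
apply: ge0_le_integral_majorant => x; rewrite patchE; case: ifPn => // xA; rewrite lee_fin.
- exact: normal_pdf_ge0.
- apply: le_trans (normal_pdf_le x) _; move/set_mem: xA; rewrite /abs_gt /= => xl.
  have s0 : 0 < 1 + x ^+ 2 by have := sqr_ge0 x; lra.
  rewrite /oneDsqr expr2 invfM mulrA ler_wpM2r ?invr_ge0 ?(ltW s0) // ler_wpM2l // lef_pV2 ?posrE //.
  by rewrite -(real_normK (num_real x)); nra.
- by rewrite mulr_ge0 // invr_ge0 (le_trans ler01) // oneDsqr_ge1.
Qed.

Lemma normal_small_ball (R : realType) : (normal_prob 0 1 (abs_lt (1 / 2 : R)) <= (1 - 1 / 2)%:E)%E.
Proof.
have AE : abs_lt (1 / 2 : R) = `](- (1 / 2)), (1 / 2)[%classic.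
  by apply/seteqP; split => x; rewrite /abs_lt /= in_itv /= ltr_norml.
apply: (@le_trans _ _ (\int[lebesgue_measure]_(x in abs_lt (1 / 2)%R) (1 / 2 : R)%:E))%E.
  rewrite /normal_prob [leLHS]integral_mkcond [leRHS]integral_mkcond.
  apply: ge0_le_integral_majorant => x; rewrite !patchE; case: ifPn => // xA; rewrite lee_fin.
    exact: normal_pdf_ge0.
  by apply: le_trans (normal_pdf_ub _ _ (oner_neq0 _)) (normal_peak_le _).
rewrite integral_cst; last exact: measurable_abs_lt.
rewrite [X in (_ * X)%E](_ : _ = 1%E).
  by rewrite mule1 lee_fin; lra.
rewrite AE [LHS]lebesgue_measure_itv /= lte_fin ifT; last lra.
by rewrite -EFinD; congr EFin; lra.
Qed.

Lemma weight_class_regular (R : realType) (Q : R -> R) (alpha : R) :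
  weight_class_FC2 Q -> (forall x, Q (- x) = Q x) -> Tfun Q x @[x --> +oo] --> alpha -> 1 < alpha ->
  exists Lam, regular_weight Q alpha Lam.
Proof.
move=> [Q0 [dQ [cQ [Q00 [hQ [_ [_ [_ [_ [[Lam L1 hT] _]]]]]]]]]] even cT a1.
by exists Lam; split.
Qed.

Theorem theorem2p4 (R : realType) (Q : R -> R) (p : nat -> {poly R}) (a : nat -> R)
  (alpha : R)
  (d : measure_display) (T : measurableType d) (P : probability T R)
  (xi : nat -> {RV P >-> R}) (eps0 : R)
  (d' : measure_display) (T' : measurableType d') (P' : probability T' R)
  (xit : nat -> {RV P' >-> R}) :
  weight_class_FC2 Q ->
  (forall x, Q (- x) = Q x) ->
  Tfun Q x @[x --> +oo] --> alpha -> 1 < alpha ->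
  orthonormal_polys (fun x => expR (- Q x)) p ->
  MRS_numbers Q a ->
  (* xi_k independent, mean 0, variance 1, uniformly bounded (2+eps0)-moments *)
  mutually_independent P (fun k => xi k) ->
  (forall k, ('E_P[xi k] = 0)%E) ->
  (forall k, ('V_P[xi k] = 1)%E) ->
  0 < eps0 ->
  (exists M : R, forall k,
     (\int[P]_(w in setT) (`|xi k w| `^ (2 + eps0))%:E <= M%:E)%E) ->
  (* xit_k i.i.d. standard Gaussian *)
  mutually_independent P' (fun k => xit k) ->
  (forall k (B : set R), measurable B ->
     P' (xit k @^-1` B) = normal_prob 0 1 B) ->
  (fun eps => limn_esup (exp_zero_ratio P (fun k => xi k) p a eps)) @ 0^'+ --> 0%E /\
  (fun eps => limn_esup (exp_zero_ratio P' (fun k => xit k) p a eps)) @ 0^'+ --> 0%E.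
Proof.
move=> wQ evenQ cT a1 op HM indep E0 V1 e00 [M hM] indep' gauss.
have [Lam W] := weight_class_regular wQ evenQ cT a1.
have [q [q0 q1 hq]] := small_ball_unit_variance E0 V1 e00 hM.
have mX k : measurable_fun setT (xi k : T -> R) by exact: measurable_funPT.
have mX' k : measurable_fun setT (xit k : T' -> R) by exact: measurable_funPT.
split.
  apply: (@limn_esup_ratio_cvg _ _ _ _ _ 1 q Q p alpha Lam a) => // k lam l1.
  exact: tail_unit_variance.
apply: (@limn_esup_ratio_cvg _ _ _ _ _ (16 * pi) (1 / 2) Q p alpha Lam a) => //; try lra.
  move=> k lam l1; rewrite (gauss k _ (measurable_abs_gt lam)); exact: normal_tail.
move=> k; rewrite (gauss k _ (measurable_abs_lt (1 / 2))); exact: normal_small_ball.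
Qed.
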